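(* Let $C_1=\{B_0,B_1\}$ be the pair of real $3\times 3$ high-pass transition matrices of the Daubechies length-four filter, and let $\rho_p(C_1)$ be its $p$-norm joint spectral radius. For every $1<p<\infty$ with $p\neq 2$, with $p'$ the conjugate exponent defined by $\frac1p+\frac1{p'}=1$, $$\rho_p(C_1)\,\rho_{p'}(C_1)>2 .$$ Consequently, the system of basic Daubechies length-four wavelet packets $\{w_n(\cdot-k): n\in\mathbb{Z}_{\ge 0},\ k\in\mathbb{Z}\}$ does not form a Schauder basis of $L^p(\mathbb{R})$ for any $1<p<\infty$, $p\neq 2$.
   Context: Filter. The Daubechies length-four low-pass filter $a=a_0$ is given by $a_0(0)=\frac{1+\sqrt3}{4}$, $a_0(1)=\frac{3+\sqrt3}{4}$, $a_0(2)=\frac{3-\sqrt3}{4}$, $a_0(3)=\frac{1-\sqrt3}{4}$, and $a_0(k)=0$ for all other $k\in\mathbb{Z}$. It satisfies $\sum_k a(k)=2$ and $\sum_k a(k)a(k+2j)=2\delta_{j,0}$. Wavelet packets. Let $\phi\in L^2(\mathbb{R})$ be the associated scaling function, i.e. the compactly supported solution of $\phi(x)=\sum_k a(k)\phi(2x-k)$ with orthonormal integer shifts. Put $b(k)=(-1)^k a(1-k)$ and $\psi(x)=\sum_k b(k)\phi(2x-k)$. The basic wavelet packets are the functions $w_n$ with $w_0=\phi$, $w_1=\psi$ and $$w_{2n}(x)=\sum_k a(k)w_n(2x-k),\qquad w_{2n+1}(x)=\sum_k b(k)w_n(2x-k),\qquad n\in\mathbb{Z}_{\ge0}.$$ The functions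 $w_n(\cdot-k)$, $n\in\mathbb{Z}_{\ge 0}$, $k\in\mathbb{Z}$, form an orthonormal basis of $L^2(\mathbb{R})$. ''Does not form a Schauder basis of $L^p(\mathbb{R})$'' means that no enumeration of this countable system as a sequence is a Schauder basis of $L^p(\mathbb{R})$. Matrices. Set $a_1(k)=(-1)^k a_0(k)$ for $k\in\mathbb{Z}$, and for $\eta\in\{0,1\}$ let $B_\eta$ be the $3\times3$ matrix with entries $(B_\eta)_{\alpha\beta}=a_1(\eta+2\alpha-\beta)$, $0\le\alpha,\beta\le 2$. Explicitly, $$B_0=\begin{pmatrix}\frac{1+\sqrt3}{4}&0&0\\ \frac{3-\sqrt3}{4}&-\frac{3+\sqrt3}{4}&\frac{1+\sqrt3}{4}\\ 0&\frac{\sqrt3-1}{4}&\frac{3-\sqrt3}{4}\end{pmatrix},\qquad B_1=\begin{pmatrix}-\frac{3+\sqrt3}{4}&\frac{1+\sqrt3}{4}&0\\ \frac{\sqrt3-1}{4}&\frac{3-\sqrt3}{4}&-\frac{3+\sqrt3}{4}\\ 0&0&\frac{\sqrt3-1}{4}\end{pmatrix}.$$ $p$-norm joint spectral radius. For $\omega=(\omega_1,\dots,\omega_n)\in\{0,1\}^n$ put $B_\omega=B_{\omega_n}\cdots B_{\omega_1}$. For $1<p<\infty$, $$\rho_p(C_1)=\lim_{n\to\infty}\Bigl(\sum_{\omega\in\{0,1\}^n}\|B_\omega\|^p\Bigr)^{1/(np)},$$ where $\|\cdot\|$ is any fixed matrix norm (the limit does not depend on the choice). *)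

(* Defs.v *)
From HB Require Import structures.
From mathcomp Require Import all_boot all_order all_algebra.
From mathcomp Require Import all_classical all_reals all_analysis.

Set Implicit Arguments.
Unset Strict Implicit.
Unset Printing Implicit Defensive.

Import Order.TTheory GRing.Theory Num.Theory.
Import numFieldNormedType.Exports.

Local Open Scope classical_set_scope.
Local Open Scope ring_scope.

Section Filter.
Context {R : realType}.

Definition a0 (k : int) : R :=
  match k with
  | Posz 0 => (1 + Num.sqrt 3) / 4
  | Posz 1 => (3 + Num.sqrt 3) / 4
  | Posz 2 => (3 - Num.sqrt 3) / 4
  | Posz 3 => (1 - Num.sqrt 3) / 4
  | _ => 0
  end.

(* [b] is the mask of the wavelet; [a1], unlike [b], is neither reflected nor
   shifted, and is the mask of the transition matrices. *)
Definition b (k : int) : R := (-1) ^ k * a0 (1 - k).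

Definition a1 (k : int) : R := (-1) ^ k * a0 k.

Definition transition_mx (eta : 'I_2) : 'M[R]_3 :=
  \matrix_(i < 3, j < 3) a1 (eta%:Z + 2 * i%:Z - j%:Z).

End Filter.

Section JointSpectralRadius.
Context {R : realType} {m : nat}.

Record matrix_norm (N : 'M[R]_m -> R) : Prop := MatrixNorm {
  matrix_norm_eq0 : forall A, N A = 0 -> A = 0;
  matrix_normZ : forall (c : R) A, N (c *: A) = `|c| * N A;
  matrix_normD : forall A B, N (A + B) <= N A + N B }.

(* For w = (w_1, ..., w_n) this is C w_n *m ... *m C w_1. *)
Definition word_mx (C : 'I_2 -> 'M[R]_m) (w : seq 'I_2) : 'M[R]_m :=
  foldl (fun A eta => C eta *m A) 1%:M w.

(* The n = 0 term is irrelevant to the limit. A divergent sequence would get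
   the default value 0, so a positive lower bound on a radius, or on a product
   of two of them, includes the existence of the limits. *)
Definition joint_spectral_radius (N : 'M[R]_m -> R) (p : R)
    (C : 'I_2 -> 'M[R]_m) : R :=
  limn (fun n => (\sum_(w : n.-tuple 'I_2) N (word_mx C w) `^ p)
                   `^ (n%:R * p)^-1).

End JointSpectralRadius.

Section WaveletPackets.
Context {R : realType}.

Definition subdivide (c : int -> R) (f : R -> R) (x : R) : R :=
  \sum_(k \in [set: int]) c k * f (2 * x - k%:~R).

(* Elements of L^2 are represented by functions, so support and refinement
   equation are understood almost everywhere. *)
Record scaling_function (phi : R -> R) : Prop := ScalingFunction {
  scaling_L2 : phi \in Lfun (@lebesgue_measure R) 2%:E;
  scaling_compact : exists M : R,
    {ae @lebesgue_measure R, forall x, M < `|x| -> phi x = 0};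
  scaling_refinement :
    {ae @lebesgue_measure R, forall x, phi x = subdivide a0 phi x};
  scaling_orthonormal : forall k l : int,
    (\int[@lebesgue_measure R]_x (phi (x - k%:~R) * phi (x - l%:~R))%:E
       = (k == l)%:R%:E)%E }.

(* Binary recursion, bounded by [fuel]; see [wpacketE], [wpacket_even] and
   [wpacket_odd]. The even rule at n = 0 is the refinement equation for
   [phi]. *)
Fixpoint wpacket_rec (phi : R -> R) (fuel n : nat) : R -> R :=
  match fuel, n with
  | _, 0 | 0, _ => phi
  | fuel'.+1, _ =>
      subdivide (if odd n then b else a0) (wpacket_rec phi fuel' n./2)
  end.

Definition wpacket (phi : R -> R) (n : nat) : R -> R := wpacket_rec phi n n.

Lemma wpacket0 phi : wpacket phi 0 = phi.
Proof. by []. Qed.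

Lemma wpacket_recE phi m n :
  (n <= m)%N -> wpacket_rec phi m n = wpacket phi n.
Proof.
rewrite /wpacket; elim/ltn_ind: n m => -[|n] IH [|m] //= le_nm.
have le1 : (uphalf n <= n)%N.
  by rewrite uphalf_half -[leqRHS]odd_double_half leq_add2l -addnn leq_addr.
by rewrite (IH _ _ m) ?(IH _ _ n) // (leq_trans le1).
Qed.

Lemma wpacketE phi n : (0 < n)%N ->
  wpacket phi n = subdivide (if odd n then b else a0) (wpacket phi n./2).
Proof.
case: n => // n _; rewrite {1}/wpacket /= wpacket_recE //.
by rewrite uphalf_half -[leqRHS]odd_double_half leq_add2l -addnn leq_addr.
Qed.

Lemma wpacket_even phi n : (0 < n)%N ->
  wpacket phi (2 * n) = subdivide a0 (wpacket phi n).
Proof.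
by move=> n0; rewrite mul2n wpacketE ?double_gt0// odd_double doubleK.
Qed.

Lemma wpacket_odd phi n :
  wpacket phi (2 * n).+1 = subdivide b (wpacket phi n).
Proof. by rewrite mul2n wpacketE //= odd_double /= uphalf_double. Qed.

End WaveletPackets.

Section SchauderBasis.
Context {R : realType}.

Definition Lp_expansion (p : R) (e : nat -> R -> R) (f : R -> R)
    (c : nat -> R) : Prop :=
  (fun n => Lnorm (@lebesgue_measure R) p%:E
     (EFin \o (fun x => f x - \sum_(i < n) c i * e i x))) @ \oo --> 0%E.

(* Working with representatives does not affect uniqueness, which concerns
   only the coefficients. *)
Definition Lp_schauder_basis (p : R) (e : nat -> R -> R) : Prop :=
  (forall i, e i \in Lfun (@lebesgue_measure R) p%:E) /\
  (forall f, f \in Lfun (@lebesgue_measure R) p%:E ->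
     exists! c : nat -> R, Lp_expansion p e f c).

End SchauderBasis.

(* Main.v *)
From HB Require Import structures.
From mathcomp Require Import all_boot all_order all_algebra.
From mathcomp Require Import ring lra.
From mathcomp Require Import all_classical all_reals all_analysis.
From mathcomp Require Import measurable_realfun.
Require Import Defs.

Set Implicit Arguments.
Unset Strict Implicit.
Unset Printing Implicit Defensive.

Import Order.TTheory GRing.Theory Num.Theory.
Import numFieldNormedType.Exports.

Local Open Scope classical_set_scope.
Local Open Scope ring_scope.

(** Let [f |-> f (B_0 v) + f (B_1 v)] be the transfer operator on functions of
    a vector v. Its n-th iterate sums f over the images of v under all the
    words of length n; applied to the q-th power of the l^q norm it gives the
    word sums [wsum q n v], whose growth rate in n is rho_q^q.

    The exponent 2 is critical. Orthonormality of the filter provides a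
    positive definite quadratic form, [energy], that the transfer operator
    exactly doubles, so rho_2^2 = 2. For conjugate exponents p and p', the
    product [kpow] of the p-th root of the p-word sum and the p'-th root of the
    p'-word sum is compared with the energy by cutting words after m letters:
    Hoelder's inequality over the words of length m bounds the sum of the
    products at the images of v by the product at v. The inequality improves by
    a fixed factor when the two families of weights are far from proportional
    ([hoelder_gap]), and for p <> 2 they are. Indeed, B_0 has one eigenvalue
    outside the unit circle and two inside, so a long enough power of B_0
    either expands or contracts any given vector by a large factor
    ([B0_dichotomy]), and since the average energy over words is fixed, some
    word then yields much more energy than another one ([energy_split]); the
    p-th and p'-th powers of a norm weigh this disparity differently. To turn
    that statement on vectors into one on word sums, one needs that word sums
    of length n + 6 are comparable with the l^q norm, with a constant that does
    not depend on n ([wsum_comparable]); this is an irreducibility property of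
    the pair (B_0, B_1). Iterating the improved inequality shows that the
    product of word sums of length n = j m is at least c k^j 2^n with k > 1
    ([growth]), and the strict inequality between the spectral radii follows;
    the limits that define them exist by subadditivity ([fekete]).

    For wavelet packets, let W_J = w_n with n = 2^J - 1. Iterating the
    definition of odd packets, W_J is a combination of the functions
    phi (2^J x - (2^J - 1) + m), with coefficients q_m such that the sum of the
    |q_m|^r is the word sum of length J of exponent r at the first basis vector
    ([packet_comb], [qpoly_sum]). Perfect reconstruction goes the other way:
    each of these functions is a finite combination of packets, in which W_J
    occurs with coefficient 2^-J q_m ([packet_represents]). In a Schauder basis
    e_i the i-th coefficient of f times the norm of e_i is bounded by a constant
    times the norm of f ([basis_constant]). Take for f the combination of the
    functions above with the coefficients sgn(q_m) |q_m|^(p'-1), which is dual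
    to q. As the translates of phi overlap boundedly, the norm of f is at most
    of the order of 2^(-J/p) times the l^p norm of its coefficients
    ([dyadic_upper]); as the translates of phi are orthonormal, the norm of W_J
    is at least of the order of 2^(-J/p) times the l^p norm of q
    ([packet_lower]). Together these bounds say that the product of conjugate
    word sums of length J is O(2^J), which contradicts its growth. *)

(** * Transition matrices, word sums and the invariant quadratic form *)

Section Transition.
Context {R : realType}.
Implicit Types (v u : 'cV[R]_3) (q : R).

Local Notation s := (Num.sqrt 3 : R).
Local Notation B := (@transition_mx R).

Lemma sqrt3_sq : s * s = 3.
Proof. by rewrite -expr2 sqr_sqrtr. Qed.

Lemma sqrt3_bounds : 17 / 10 < s < 18 / 10.
Proof.
have := sqrt3_sq; have : 0 <= s by exact: sqrtr_ge0.
by move=> s0 ss; apply/andP; split; nra.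
Qed.

Definition vec3 (x y z : R) : 'cV[R]_3 := \col_i nth 0 [:: x; y; z] i.

Lemma vec3P v : v = vec3 (v 0 0) (v 1 0) (v 2 0).
Proof.
apply/matrixP => i j; rewrite !mxE (ord1 j).
by case: i => -[|[|[|//]]] i3 /=; congr (v _ _); apply: val_inj.
Qed.

Lemma vec3D x y z x' y' z' :
  vec3 x y z + vec3 x' y' z' = vec3 (x + x') (y + y') (z + z').
Proof.
apply/matrixP => i j; rewrite !mxE.
by case: i => -[|[|[|//]]] i3 /=.
Qed.

Lemma vec3Z c x y z : c *: vec3 x y z = vec3 (c * x) (c * y) (c * z).
Proof.
apply/matrixP => i j; rewrite !mxE.
by case: i => -[|[|[|//]]] i3 /=.
Qed.

(** Evaluates the integer arguments of the filter, and nothing else, so that its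
    definition by cases reduces. *)
Ltac compute_a1 :=
  repeat match goal with |- context [@a1 ?R ?k] =>
    let k' := eval vm_compute in k in
    progress change (@a1 R k) with (@a1 R k') end.

Lemma mul_B0 x y z : B 0 *m vec3 x y z =
  vec3 ((1 + s) / 4 * x) ((3 - s) / 4 * x - (3 + s) / 4 * y + (1 + s) / 4 * z)
       ((s - 1) / 4 * y + (3 - s) / 4 * z).
Proof.
apply/matrixP => i j; rewrite !mxE !big_ord_recl big_ord0 !mxE.
case: i => -[|[|[|//]]] i3 /=.
all: compute_a1; rewrite /a1 /= ?mulr0 ?mul0r -?exprnP; by field.
Qed.

Lemma mul_B1 x y z : B 1 *m vec3 x y z =
  vec3 (- (3 + s) / 4 * x + (1 + s) / 4 * y)
       ((s - 1) / 4 * x + (3 - s) / 4 * y - (3 + s) / 4 * z)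
       ((s - 1) / 4 * z).
Proof.
apply/matrixP => i j; rewrite !mxE !big_ord_recl big_ord0 !mxE.
case: i => -[|[|[|//]]] i3 /=.
all: compute_a1; rewrite /a1 /= ?mulr0 ?mul0r -?exprnP; by field.
Qed.

Lemma vec3_eq (x y z x' y' z' : R) :
  x = x' -> y = y' -> z = z' -> vec3 x y z = vec3 x' y' z'.
Proof. by move=> -> -> ->. Qed.

Definition transfer (f : 'cV[R]_3 -> R) v := f (B 0 *m v) + f (B 1 *m v).

Definition lpow q v := \sum_(i < 3) `|v i 0| `^ q.

Definition wsum q n := iter n transfer (lpow q).

Lemma wsumS q n v : wsum q n.+1 v = wsum q n (B 0 *m v) + wsum q n (B 1 *m v).
Proof. by []. Qed.

(** The quadratic form that comes from the orthonormality of the filter: the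
    transfer operator doubles it. It plays the part of the Euclidean norm and
    makes the case of exponent 2 exact. *)
Definition energy v :=
  32 * (v 0 0 ^+ 2 + v 1 0 ^+ 2 + v 2 0 ^+ 2) - 9 * (v 0 0 + v 1 0 + v 2 0) ^+ 2.

Lemma vec3E x y z :
  ((vec3 x y z 0 0 = x) * (vec3 x y z 1 0 = y) * (vec3 x y z 2 0 = z))%type.
Proof. by rewrite !mxE. Qed.

Lemma energy_transfer v : transfer energy v = 2 * energy v.
Proof.
rewrite (vec3P v) /transfer /energy mul_B0 mul_B1 !vec3E.
by have ss := sqrt3_sq; field: ss.
Qed.

(** Cauchy-Schwarz: (x + y + z)^2 <= 3 (x^2 + y^2 + z^2), and 32 - 27 = 5. *)
Lemma energy_ge v : 5 * (v 0 0 ^+ 2 + v 1 0 ^+ 2 + v 2 0 ^+ 2) <= energy v.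
Proof.
rewrite /energy; set x := v 0 0; set y := v 1 0; set z := v 2 0.
have := sqr_ge0 (x - y); have := sqr_ge0 (y - z); have := sqr_ge0 (x - z).
by nra.
Qed.

Lemma energy_le v : energy v <= 32 * (v 0 0 ^+ 2 + v 1 0 ^+ 2 + v 2 0 ^+ 2).
Proof. by rewrite /energy lerBlDr lerDl mulr_ge0// sqr_ge0. Qed.

(** What survives, for the q-th power of a seminorm, of the axioms of a seminorm.
    The constant 2^q is not sharp, but it requires no convexity and is
    preserved by the transfer operator. *)
Record quasi_seminorm q (h : 'cV[R]_3 -> R) : Prop := QuasiSeminorm {
  quasi_ge0 : forall v, 0 <= h v;
  quasiZ : forall c v, h (c *: v) = `|c| `^ q * h v;
  quasiD : forall u v, h (u + v) <= 2 `^ q * (h u + h v) }.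

Lemma powR_normD q (x y : R) : 0 <= q ->
  `|x + y| `^ q <= 2 `^ q * (`|x| `^ q + `|y| `^ q).
Proof.
move=> q0; wlog xy : x y / `|x| <= `|y|.
  move=> W; have [/W//|/ltW/W] := leP `|x| `|y|.
  by rewrite addrC [X in _ * X]addrC.
apply: (@le_trans _ _ ((2 * `|y|) `^ q)).
  rewrite ge0_ler_powR ?nnegrE ?mulr_ge0//.
  by apply: (le_trans (ler_normD _ _)); rewrite mulr_natl mulr2n lerD2r.
by rewrite powRM// ler_wpM2l ?powR_ge0// lerDr powR_ge0.
Qed.

Lemma lpow_quasi q : 0 <= q -> quasi_seminorm q (lpow q).
Proof.
move=> q0; split=> [v|c v|u v].
- by apply: sumr_ge0 => i _; exact: powR_ge0.
- rewrite /lpow mulr_sumr; apply: eq_bigr => i _.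
  by rewrite mxE normrM powRM.
- rewrite /lpow -big_split/= mulr_sumr; apply: ler_sum => i _.
  by rewrite mxE powR_normD.
Qed.

Lemma transfer_quasi q h : quasi_seminorm q h -> quasi_seminorm q (transfer h).
Proof.
move=> [h0 hZ hD]; split=> [v|c v|u v]; rewrite /transfer.
- by rewrite addr_ge0.
- by rewrite -!scalemxAr !hZ -mulrDr.
- by rewrite !mulmxDr addrACA mulrDr lerD.
Qed.

Lemma wsum_quasi q n : 0 <= q -> quasi_seminorm q (wsum q n).
Proof.
move=> q0; elim: n => [|n IH]; first exact: lpow_quasi.
exact: transfer_quasi.
Qed.

Lemma quasi_comb3 q h c1 c2 c3 u1 u2 u3 : 0 <= q -> quasi_seminorm q h ->
  h (c1 *: u1 + c2 *: u2 + c3 *: u3) <= 2 `^ q * 2 `^ q *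
     (`|c1| `^ q * h u1 + `|c2| `^ q * h u2 + `|c3| `^ q * h u3).
Proof.
move=> q0 [h0 hZ hD].
have q1 : 1 <= 2 `^ q :> R by have := @ler_powR R 2 (ler1n _ 2) _ _ q0; rewrite powRr0.
apply: (le_trans (hD _ _)); rewrite -mulrA ler_wpM2l ?powR_ge0// mulrDr.
apply: lerD; last first.
  by rewrite hZ ler_peMl// mulr_ge0// powR_ge0.
by rewrite (le_trans (hD _ _))// !hZ.
Qed.

Definition e3 (i : 'I_3) : 'cV[R]_3 := delta_mx i 0.

Lemma vec3_decomp v : v = v 0 0 *: e3 0 + v 1 0 *: e3 1 + v 2 0 *: e3 2.
Proof.
rewrite [LHS]vec3P; apply/matrixP => i j; rewrite !mxE ord1 !eqxx !andbT.
by case: i => -[|[|[|//]]] i3 /=; rewrite ?mulr1 ?mulr0 ?addr0 ?add0r.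
Qed.

Lemma sum3E (f : 'I_3 -> R) : \sum_(i < 3) f i = f 0 + f 1 + f 2.
Proof.
rewrite !big_ord_recl big_ord0 addr0 addrA.
by congr (_ + f _ + f _); exact: val_inj.
Qed.

Lemma quasi_bound q h v : 0 <= q -> quasi_seminorm q h ->
  h v <= 2 `^ q * 2 `^ q * (\sum_i h (e3 i)) * lpow q v.
Proof.
move=> q0 hh; have [h0 _ _] := hh.
rewrite [X in h X]vec3_decomp (le_trans (quasi_comb3 _ _ _ _ _ _ q0 hh))//.
rewrite -!mulrA !ler_wpM2l ?powR_ge0// /lpow !sum3E.
set a := h _; set b := h _; set c := h _.
set x := _ `^ _; set y := _ `^ _; set z := _ `^ _.
have [x0 y0] : 0 <= x /\ 0 <= y by split; exact: powR_ge0.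
have z0 : 0 <= z by exact: powR_ge0.
have [a0 b0] : 0 <= a /\ 0 <= b by split; exact: h0.
have c0 : 0 <= c by exact: h0.
by nra.
Qed.

Lemma lpow_mulmx q (M : 'M[R]_3) : 0 <= q ->
  exists2 C : R, 0 < C & forall v, lpow q (M *m v) <= C * lpow q v.
Proof.
move=> q0.
have hh : quasi_seminorm q (fun v => lpow q (M *m v)).
  have [h0 hZ hD] := lpow_quasi q0; split=> [v|c v|u v] //.
  - by rewrite -scalemxAr hZ.
  - by rewrite mulmxDr.
exists (2 `^ q * 2 `^ q * (\sum_i lpow q (M *m e3 i)) + 1).
  rewrite ltr_wpDl// !mulr_ge0 ?powR_ge0// sumr_ge0// => i _.
  by case: hh => h0 _ _.
move=> v; rewrite (le_trans (quasi_bound v q0 hh))// ler_wpM2r//.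
  by case: (lpow_quasi q0).
by rewrite lerDl.
Qed.

End Transition.

(** * Word sums are uniformly comparable with l^q norms *)

Section Comparison.
Context {R : realType}.
Implicit Types (v u : 'cV[R]_3) (q : R).
Local Notation s := (Num.sqrt 3 : R).
Local Notation B := (@transition_mx R).

Definition mx3 (l : seq (seq R)) : 'M[R]_3 :=
  \matrix_(i, j) nth 0 (nth [::] l i) j.

Lemma mul_mx3 a b c d e f g h k x y z :
  mx3 [:: [:: a; b; c]; [:: d; e; f]; [:: g; h; k]] *m vec3 x y z =
  vec3 (a * x + b * y + c * z) (d * x + e * y + f * z) (g * x + h * y + k * z).
Proof.
apply/matrixP => i j; rewrite !mxE !big_ord_recl big_ord0 !mxE.
by case: i => -[|[|[|//]]] i3 /=; rewrite addr0 addrA.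
Qed.

Definition B0_inv : 'M[R]_3 := mx3
  [:: [:: 2 * s - 2; 0; 0];
      [:: (9 * s - 15) / 2; (s - 3) / 2; (1 + s) / 2];
      [:: (5 * s - 9) / 2; (s - 1) / 2; (3 + s) / 2]].

Definition B1_inv : 'M[R]_3 := mx3
  [:: [:: (s - 3) / 2; (1 + s) / 2; (9 + 5 * s) / 2];
      [:: (s - 1) / 2; (3 + s) / 2; (15 + 9 * s) / 2];
      [:: 0; 0; 2 + 2 * s]].

Lemma B0_invK v : B0_inv *m (B 0 *m v) = v.
Proof.
have ss := @sqrt3_sq R.
by rewrite (vec3P v) mul_B0 mul_mx3; apply: vec3_eq; field: ss.
Qed.

Lemma B1_invK v : B1_inv *m (B 1 *m v) = v.
Proof.
have ss := @sqrt3_sq R.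
by rewrite (vec3P v) mul_B1 mul_mx3; apply: vec3_eq; field: ss.
Qed.

(** Both transition matrices are invertible, so no letter shrinks a vector by more
    than a constant factor. *)
Lemma lpow_B q : 0 <= q -> exists2 C : R, 0 < C & forall v,
  lpow q v <= C * lpow q (B 0 *m v) /\ lpow q v <= C * lpow q (B 1 *m v).
Proof.
move=> q0; have [C C0 hC] := lpow_mulmx B0_inv q0.
have [D D0 hD] := lpow_mulmx B1_inv q0.
have [l0 _ _] := lpow_quasi q0.
exists (C + D) => [|v]; first exact: addr_gt0.
split.
  apply: le_trans (_ : C * lpow q (B 0 *m v) <= _).
    by have := hC (B 0 *m v); rewrite B0_invK.
  by apply: ler_wpM2r; [exact: l0 | rewrite lerDl ltW].
apply: le_trans (_ : D * lpow q (B 1 *m v) <= _).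
  by have := hD (B 1 *m v); rewrite B1_invK.
by apply: ler_wpM2r; [exact: l0 | rewrite lerDr ltW].
Qed.

(** It is enough to follow the words that begin with the letter 0, since B_0
    does not contract by more than a constant factor. *)
Lemma wsum_le_succ q : 0 <= q ->
  exists2 C : R, 0 < C & forall n v, wsum q n v <= C * wsum q n.+1 v.
Proof.
move=> q0; have [C C0 hC] := lpow_B q0; exists C => //; elim => [|n IH] v.
  have [l0 _ _] := lpow_quasi q0.
  rewrite wsumS (le_trans (hC v).1)//; apply: ler_wpM2l; first exact: ltW.
  by rewrite lerDl; exact: l0.
by rewrite wsumS [leRHS]mulrDr lerD.
Qed.

Lemma wsum_leD q k : 0 <= q ->
  exists2 C : R, 0 < C & forall n v, wsum q n v <= C * wsum q (k + n) v.
Proof.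
move=> q0; have [C C0 hC] := wsum_le_succ q0.
elim: k => [|k [D D0 hD]]; first by exists 1 => // n v; rewrite mul1r.
exists (D * C) => [|n v]; first exact: mulr_gt0.
by rewrite (le_trans (hD _ _))// -mulrA ler_wpM2l// ltW.
Qed.

Lemma wsum_B q n v : 0 <= q ->
  wsum q n (B 0 *m v) <= wsum q n.+1 v /\ wsum q n (B 1 *m v) <= wsum q n.+1 v.
Proof.
move=> q0; have [h0 _ _] := wsum_quasi n q0.
by rewrite wsumS lerDl lerDr; split; exact: h0.
Qed.

Definition csum v : R := v 0 0 + v 1 0 + v 2 0.

(** This vector spans the kernel of B_0 + B_1, and the linear form [csum]
    vanishes on the image of B_0 + B_1. *)
Definition kervec : 'cV[R]_3 := vec3 ((1 + s) / 2) 1 ((1 - s) / 2).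

Let K v := B 0 *m v + B 1 *m v.

(** All the column sums of K = B_0 + B_1 equal the alternating sum of the filter,
    which is 0. Hence K is singular, and its adjugate, a polynomial of degree 2
    in K, has rank one. This rank-one map sends every vector to the fixed
    direction [kervec] and is a combination of words of length at most 2. *)
Lemma adjugate_sum v :
  csum v *: kervec = (- 4) *: K (K v) + (- 2 * s) *: K v + 2 *: v.
Proof.
have ss := @sqrt3_sq R.
rewrite (vec3P v) /K /csum /kervec.
rewrite !(mul_B0, mul_B1, vec3D, vec3Z, vec3E).
by apply: vec3_eq; field: ss.
Qed.

(** The left side is the word sum at the image of v by a rank-one combination of
    words of length at most 2. *)
Lemma wsum_kervec q : 0 <= q -> exists2 C : R, 0 < C &
  forall n v, `|csum v| `^ q * wsum q n kervec <= C * wsum q n.+2 v.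
Proof.
move=> q0; have [C C0 hC] := wsum_leD 2 q0.
have [D D0 hD] := wsum_leD 1 q0.
pose k := 2 `^ q : R; have k0 : 0 < k by exact: powR_gt0.
pose E := k * k * (`|- 4| `^ q * (k * k) + `|- 2 * s| `^ q * (k * D) + `|2| `^ q * C).
exists (E + 1) => [|n v].
  by rewrite ltr_wpDl// !(mulr_ge0, addr_ge0) ?powR_ge0// ltW.
have [h0 hZ hD'] := wsum_quasi n q0.
have hK u m : wsum q m (K u) <= k * wsum q m.+1 u.
  by have [_ _ +] := wsum_quasi m q0; apply.
rewrite -hZ adjugate_sum (le_trans (quasi_comb3 _ _ _ _ _ _ q0 (wsum_quasi n q0)))//.
have w0 : 0 <= wsum q n.+2 v by have [+ _ _] := wsum_quasi n.+2 q0; apply.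
rewrite (@le_trans _ _ (E * wsum q n.+2 v))//; last by rewrite ler_wpM2r// lerDl.
rewrite /E -/k -[leRHS]mulrA; apply: ler_wpM2l; first by rewrite mulr_ge0// ltW.
rewrite [leRHS]mulrDl [X in _ <= X + _]mulrDl.
apply: lerD; [apply: lerD|]; rewrite -!mulrA; apply: ler_wpM2l; rewrite ?powR_ge0//.
- by rewrite (le_trans (hK _ _))// ler_wpM2l// ltW.
- rewrite (le_trans (hK _ _))// ler_wpM2l ?(ltW k0)//; exact: hD.
Qed.

(** The vector [kervec] is cyclic for B_0; the coefficients solve a linear system
    over Q(sqrt 3). *)
Lemma delta_kervec (i : 'I_3) : exists c1 c2 c3 : R, e3 i =
  c1 *: kervec + c2 *: (B 0 *m kervec) + c3 *: (B 0 *m (B 0 *m kervec)).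
Proof.
have ss := @sqrt3_sq R.
have -> : e3 i = vec3 (i == 0)%:R (i == 1)%:R (i == 2)%:R :> 'cV[R]_3.
  by rewrite [LHS]vec3P !mxE !eqxx !andbT; apply: vec3_eq; rewrite eq_sym.
rewrite /kervec !(mul_B0, vec3Z, vec3D).
case: i => -[|[|[|//]]] i3 /=.
- exists ((68 * s - 127) / 74), ((35 * s - 30) / 37), ((82 - 34 * s) / 37).
  by rewrite !(vec3Z, vec3D); apply: vec3_eq; field: ss.
- exists ((- 4 * s - 23) / 74), ((11 * s - 20) / 37), ((30 + 2 * s) / 37).
  by rewrite !(vec3Z, vec3D); apply: vec3_eq; field: ss.
- exists ((- 92 * s - 159) / 74), ((31 * s + 58) / 37), ((98 + 46 * s) / 37).
  by rewrite !(vec3Z, vec3D); apply: vec3_eq; field: ss.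
Qed.

(** Dual to the previous property: the linear forms [csum], [csum] B_0 and
    [csum] B_0^2 are independent, with the dual basis displayed here. *)
Lemma csum_observable v : v =
  csum v *: vec3 (- (1 + s) / 4) (1 / 2) ((3 + s) / 4)
  + csum (B 0 *m v) *: vec3 ((3 + s) / 4) (- 1 / 2) (- (1 + s) / 4)
  + csum (B 0 *m (B 0 *m v)) *: vec3 ((1 + s) / 2) 0 (- (1 + s) / 2).
Proof.
have ss := @sqrt3_sq R.
rewrite [LHS]vec3P (vec3P v) /csum.
rewrite !(mul_B0, vec3D, vec3Z, vec3E).
by apply: vec3_eq; field: ss.
Qed.

(** The size of the word sums of length n as a function on vectors: up to a
    constant, its maximum on the unit sphere of the l^q norm. *)
Definition wtot q n : R := \sum_i wsum q n (e3 i).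

Lemma wsum_ge0 q n v : 0 <= q -> 0 <= wsum q n v.
Proof. by move=> q0; have [h0 _ _] := wsum_quasi n q0. Qed.

Lemma lpow_ge0 q v : 0 <= lpow q v.
Proof. by apply: sumr_ge0 => i _; exact: powR_ge0. Qed.

Lemma lpow_e3 q (i : 'I_3) : q != 0 -> lpow q (e3 i) = 1 :> R.
Proof.
move=> q0; rewrite /lpow (bigD1 i)//= mxE !eqxx normr1 powR1.
rewrite big1 ?addr0// => j /negbTE ji.
by rewrite mxE ji normr0 powR0.
Qed.

Lemma wtot_gt0 q n : 0 < q -> 0 < wtot q n.
Proof.
move=> q0; have [C C0 hC] := wsum_leD n (ltW q0).
rewrite /wtot (bigD1 0)//= ltr_pwDl//; last first.
  by apply: sumr_ge0 => i _; exact/wsum_ge0/ltW.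
have := hC 0%N (e3 0); rewrite addn0 -(ler_pdivrMl _ _ C0); apply: lt_le_trans.
by rewrite [wsum _ _ _]lpow_e3 ?gt_eqF// mulr1 invr_gt0.
Qed.

Lemma wtot_kervec q : 0 <= q ->
  exists2 C : R, 0 < C & forall n, wtot q n <= C * wsum q n.+2 kervec.
Proof.
move=> q0; have [C C0 hC] := wsum_leD 2 q0.
have [D D0 hD] := wsum_leD 1 q0.
have H i : exists2 E : R, 0 < E & forall n, wsum q n (e3 i) <= E * wsum q n.+2 kervec.
  have [c1 [c2 [c3 ->]]] := delta_kervec i.
  pose E := 2 `^ q * 2 `^ q * (`|c1| `^ q * C + `|c2| `^ q * D + `|c3| `^ q).
  exists (E + 1) => [|n].
    by rewrite ltr_wpDl// !(mulr_ge0, addr_ge0) ?powR_ge0// ltW.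
  rewrite (le_trans (quasi_comb3 _ _ _ _ _ _ q0 (wsum_quasi n q0)))//.
  rewrite (@le_trans _ _ (E * wsum q n.+2 kervec))//; last first.
    by rewrite ler_wpM2r ?wsum_ge0// lerDl.
  rewrite /E -[leRHS]mulrA; apply: ler_wpM2l; first by rewrite mulr_ge0// powR_ge0.
  rewrite [leRHS]mulrDl [X in _ <= X + _]mulrDl.
  apply: lerD; [apply: lerD|]; rewrite -?mulrA; apply: ler_wpM2l; rewrite ?powR_ge0//.
  - rewrite (le_trans (hD _ _))// ler_wpM2l ?(ltW D0)//.
    by case: (wsum_B n.+1 kervec q0).
  - have [+ _] := wsum_B n (B 0 *m kervec) q0; move=> /le_trans; apply.
    by case: (wsum_B n.+1 kervec q0).
have [[E0 E00 H0] [E1 E10 H1] [E2 E20 H2]] := And3 (H 0) (H 1) (H 2).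
exists (E0 + E1 + E2) => [|n]; first by rewrite !addr_gt0.
by rewrite /wtot sum3E !mulrDl !lerD.
Qed.

(** From v one reaches a vector on which [csum] is not small in at most two
    letters, then [kervec] in two more, and from there every basis vector in
    two more: this is why 6 letters suffice. *)
Lemma wsum_lower q : 0 <= q ->
  exists2 C : R, 0 < C & forall n v, lpow q v * wtot q n <= C * wsum q (6 + n) v.
Proof.
move=> q0; have [C C0 hC] := wtot_kervec q0.
have [D D0 hD] := wsum_kervec q0.
have [E E0 hE] := wsum_leD 2 q0.
have [F F0 hF] := wsum_leD 1 q0.
have P n v : `|csum v| `^ q * wtot q n <= C * D * wsum q (4 + n) v.
  rewrite -mulrA; apply: (@le_trans _ _ (C * (`|csum v| `^ q * wsum q n.+2 kervec))).
    by rewrite mulrCA ler_wpM2l ?powR_ge0.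
  by apply: ler_wpM2l; [exact: ltW | exact: hD].
set f1 : 'cV[R]_3 := vec3 (- (1 + s) / 4) (1 / 2) ((3 + s) / 4).
set f2 : 'cV[R]_3 := vec3 ((3 + s) / 4) (- 1 / 2) (- (1 + s) / 4).
set f3 : 'cV[R]_3 := vec3 ((1 + s) / 2) 0 (- (1 + s) / 2).
pose k := 2 `^ q * 2 `^ q : R.
pose G := k * (C * D) * (E * lpow q f1 + F * lpow q f2 + lpow q f3).
exists (G + 1) => [|n v].
  by rewrite ltr_wpDl// !(mulr_ge0, addr_ge0) ?powR_ge0 ?lpow_ge0// ltW.
rewrite (@le_trans _ _ (G * wsum q (6 + n) v))//; last first.
  by rewrite ler_wpM2r ?wsum_ge0// lerDl.
have w0 : 0 <= wtot q n by apply: sumr_ge0 => i _; exact: wsum_ge0.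
rewrite {1}(csum_observable v) -/f1 -/f2 -/f3.
apply: (le_trans (ler_wpM2r w0 (quasi_comb3 _ _ _ _ _ _ q0 (lpow_quasi q0)))).
rewrite -/k /G -[leLHS]mulrA -2![leRHS]mulrA; apply: ler_wpM2l.
  by rewrite mulr_ge0// powR_ge0.
have B1 u : wsum q (4 + n) (B 0 *m u) <= wsum q (5 + n) u.
  by case: (wsum_B (4 + n) u q0).
have B2 u : wsum q (4 + n) (B 0 *m (B 0 *m u)) <= wsum q (6 + n) u.
  by rewrite (le_trans (B1 _))//; case: (wsum_B (5 + n) u q0).
have CD0 : 0 <= C * D by rewrite mulr_ge0// ltW.
rewrite 2![in leLHS]mulrDl 2![in leRHS]mulrDl 2![in leRHS]mulrDr.
apply: lerD; [apply: lerD|]; rewrite mulrAC.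
- apply: (le_trans (ler_wpM2r (lpow_ge0 _ _) (P _ _))).
  by rewrite -[leLHS]mulrA ler_wpM2l// mulrAC ler_wpM2r ?lpow_ge0//.
- apply: (le_trans (ler_wpM2r (lpow_ge0 _ _) (P _ _))).
  rewrite -[leLHS]mulrA ler_wpM2l// mulrAC ler_wpM2r ?lpow_ge0//.
  by rewrite (le_trans (B1 v))//; exact: hF.
- apply: (le_trans (ler_wpM2r (lpow_ge0 _ _) (P _ _))).
  by rewrite -[leLHS]mulrA ler_wpM2l// mulrC ler_wpM2l ?lpow_ge0.
Qed.

Lemma wsum_upper q n v : 0 <= q ->
  wsum q n v <= 2 `^ q * 2 `^ q * wtot q n * lpow q v.
Proof. by move=> q0; exact/quasi_bound/wsum_quasi. Qed.

Lemma wtot_leD q k : 0 <= q ->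
  exists2 C : R, 0 < C & forall n, wtot q (k + n) <= C * wtot q n.
Proof.
move=> q0; elim: k => [|k [C C0 hC]]; first by exists 1 => // n; rewrite mul1r.
pose D : R := 2 `^ q * 2 `^ q *
  \sum_i (lpow q (B 0 *m e3 i) + lpow q (B 1 *m e3 i)).
have D0 : 0 <= D.
  rewrite !mulr_ge0 ?powR_ge0// sumr_ge0// => i _.
  by rewrite addr_ge0// lpow_ge0.
exists ((D + 1) * C) => [|n]; first by rewrite mulr_gt0// ltr_wpDl.
rewrite addSn -mulrA; apply: (@le_trans _ _ ((D + 1) * wtot q (k + n))); last first.
  by rewrite ler_wpM2l// addr_ge0.
have w0 : 0 <= wtot q (k + n) by apply: sumr_ge0 => i _; exact: wsum_ge0.
apply: (@le_trans _ _ (D * wtot q (k + n))); last by rewrite ler_wpM2r// lerDl.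
rewrite {1}/wtot /D mulrAC mulr_sumr; apply: ler_sum => i _.
by rewrite wsumS mulrDr; apply: lerD; exact: wsum_upper.
Qed.

(** All the word sums [wsum q (6 + n)] have essentially the shape of the l^q norm,
    whatever n: words of bounded length lead from any vector to any direction.
    The scale t depends on n; the constant C does not. *)
Lemma wsum_comparable q : 0 < q -> exists2 C : R, 0 < C &
  forall n, exists2 t : R, 0 < t & forall v,
    t * lpow q v <= C * wsum q (6 + n) v /\ wsum q (6 + n) v <= C * t * lpow q v.
Proof.
move=> q0; have q0' := ltW q0.
have [C C0 hC] := wsum_lower q0'; have [D D0 hD] := wtot_leD 6 q0'.
pose k := 2 `^ q * 2 `^ q : R.
have k0 : 0 <= k by rewrite mulr_ge0// powR_ge0.
exists (C + k * D) => [|n]; first by rewrite ltr_pwDl// mulr_ge0// ltW.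
exists (wtot q n) => [|v]; first exact: wtot_gt0.
have w0 := wtot_gt0 n q0.
split.
  rewrite mulrC (le_trans (hC _ _))// ler_wpM2r ?wsum_ge0// lerDl mulr_ge0// ltW//.
rewrite (le_trans (wsum_upper _ _ q0'))// ler_wpM2r ?lpow_ge0//.
rewrite (@le_trans _ _ (k * (D * wtot q n)))//; first by rewrite ler_wpM2l.
by rewrite mulrA ler_wpM2r ?(ltW w0)// lerDr ltW.
Qed.

End Comparison.

(** * Spectral decomposition of B_0 *)

Section Splitting.
Context {R : realType}.
Implicit Types (v u : 'cV[R]_3) (q : R).
Local Notation s := (Num.sqrt 3 : R).
Local Notation B := (@transition_mx R).

Lemma ex_expr_lt (r e : R) : 0 <= r < 1 -> 0 < e -> exists2 N, (0 < N)%N & r ^+ N < e.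
Proof.
move=> /andP[r0 r1] e0.
have : r ^+ n @[n --> \oo] --> 0 by apply: cvg_expr; rewrite ger0_norm.
move/cvgrPdist_lt => /(_ e e0)[N _ /(_ N.+1 (leqnSn N))/=].
by rewrite sub0r normrN normrX (ger0_norm r0) => ?; exists N.+1.
Qed.

(** Besides (1 + sqrt 3) / 4, the eigenvalues of B_0 are those of its lower right
    block, of trace - sqrt 3 / 2 and determinant - 1 / 2. *)
Lemma B0_eigenvalues : exists l m : R,
  [/\ l + m = - s / 2, l * m = - 1 / 2, l <= - (6 / 5) & `|m| <= 1 / 2].
Proof.
have ss := @sqrt3_sq R; have /andP[s1 s2] := @sqrt3_bounds R.
have [tt t0] : Num.sqrt 11 * Num.sqrt 11 = 11 :> R /\ 0 <= Num.sqrt 11 :> R.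
  by rewrite -expr2 sqr_sqrtr// sqrtr_ge0.
move: tt t0; set t := Num.sqrt 11 => tt t0.
have t1 : 33 / 10 <= t by nra.
have t2 : t <= 34 / 10 by nra.
exists (- (s + t) / 4), ((t - s) / 4); split.
- by field.
- by field: ss tt.
- by lra.
- by rewrite ler_norml; apply/andP; split; lra.
Qed.

Definition applyB0 v : 'cV[R]_3 := B 0 *m v.
Local Notation b := applyB0.
Let Q c1 c2 c3 v := c1 *: b (b v) + c2 *: b v + c3 *: v.

Lemma lpow_quadratic q c1 c2 c3 : 0 <= q ->
  exists2 C : R, 0 < C & forall v, lpow q (Q c1 c2 c3 v) <= C * lpow q v.
Proof.
move=> q0; have [C C0 hC] := lpow_mulmx (c1 *: B 0 *m B 0 + c2 *: B 0 + c3%:M) q0.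
exists C => // v; apply: le_trans (hC v).
by rewrite !mulmxDl mul_scalar_mx /Q /applyB0 !scalemxAl mulmxA.
Qed.

(** The spectral projections are the Lagrange interpolation polynomials in B_0 at
    its three eigenvalues, which are distinct; as polynomials of degree 2 in
    B_0 they are bounded. *)
Lemma spectral_decomposition : exists l m c : R,
  [/\ l <= - (6 / 5), `|m| <= 1 / 2, 0 <= c <= 7 / 10 &
  exists2 K : R, 0 < K & forall v, exists y z x,
  [/\ v = y + z + x, b y = l *: y, b z = c *: z, b x = m *: x &
   lpow 1 y <= K * lpow 1 v /\ lpow 1 z <= K * lpow 1 v /\
   lpow 1 x <= K * lpow 1 v] ].
Proof.
have ss := @sqrt3_sq R; have /andP[s1 s2] := @sqrt3_bounds R.
have [l [m [lm1 lm2 l1 m1]]] := B0_eigenvalues.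
pose c : R := (1 + s) / 4.
have [m2 m3] : - (1 / 2) <= m /\ m <= 1 / 2 by split; move: m1; rewrite ler_norml => /andP[].
exists l, m, c; split => //; first by rewrite /c; apply/andP; split; lra.
have lc : l - c != 0 by rewrite lt_eqF// /c; lra.
have lmn : l - m != 0 by rewrite lt_eqF//; lra.
have cm : c - m != 0 by rewrite gt_eqF// /c; lra.
pose cy := 1 / ((l - c) * (l - m)).
pose cz := 1 / ((c - l) * (c - m)).
pose cx := 1 / ((m - l) * (m - c)).
have [Cy Cy0 hy] := lpow_quadratic cy (- cy * (c + m)) (cy * (c * m)) ler01.
have [Cz Cz0 hz] := lpow_quadratic cz (- cz * (l + m)) (cz * (l * m)) ler01.
have [Cx Cx0 hx] := lpow_quadratic cx (- cx * (l + c)) (cx * (l * c)) ler01.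
exists (Cy + Cz + Cx) => [|v]; first by rewrite !addr_gt0.
have CH w : b (b (b w)) = (l + m + c) *: b (b w) - (l * m + (l + m) * c) *: b w + (l * m * c) *: w.
  rewrite lm1 lm2 /applyB0 /c (vec3P w) -scaleNr !(mul_B0, vec3Z, vec3D).
  by apply: vec3_eq; field: ss.
have bQ a1 a2 a3 w : b (Q a1 a2 a3 w) = a1 *: b (b (b w)) + a2 *: b (b w) + a3 *: b w.
  by rewrite /Q /applyB0 !mulmxDr -!scalemxAr.
exists (Q cy (- cy * (c + m)) (cy * (c * m)) v), (Q cz (- cz * (l + m)) (cz * (l * m)) v),
  (Q cx (- cx * (l + c)) (cx * (l * c)) v).
have L w := lpow_ge0 1 w.
split; last first.
- split; [|split].
  + by rewrite (le_trans (hy _))// [leLHS]mulrC [leRHS]mulrC; apply: ler_wpM2l; [exact: L | lra].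
  + by rewrite (le_trans (hz _))// [leLHS]mulrC [leRHS]mulrC; apply: ler_wpM2l; [exact: L | lra].
  + by rewrite (le_trans (hx _))// [leLHS]mulrC [leRHS]mulrC; apply: ler_wpM2l; [exact: L | lra].
- rewrite bQ CH /Q; apply/matrixP => i j; rewrite !mxE.
  by ring.
- rewrite bQ CH /Q; apply/matrixP => i j; rewrite !mxE.
  by ring.
- rewrite bQ CH /Q; apply/matrixP => i j; rewrite !mxE.
  by ring.
- rewrite /Q; apply/matrixP => i j; rewrite !mxE /cy /cz /cx.
  set p1 := \sum_ _ _; set p2 := \sum_ _ _.
  by field; rewrite lc lmn cm /= -[c - l]opprB -[m - l]opprB -[m - c]opprB !oppr_eq0 lc lmn cm.
Qed.

End Splitting.

Section Dichotomy.
Context {R : realType}.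
Implicit Types (v u : 'cV[R]_3) (q : R).
Local Notation s := (Num.sqrt 3 : R).
Local Notation B := (@transition_mx R).
Local Notation b := applyB0.

(** If the component of v along the expanding eigenvector is large, 2 N steps
    multiply v by a large factor. Otherwise that component is so small that it
    is still harmless after N steps, while the other components have been
    contracted. *)
Lemma B0_dichotomy (M : R) : 0 < M -> exists2 N, (0 < N)%N & forall v,
  M * lpow 1 v <= lpow 1 (iter N.*2 b v) \/ M * lpow 1 (iter N b v) <= lpow 1 v.
Proof.
move=> M0.
have [l [m [c [l1 m1 /andP[c0 c1] [K K0 hK]]]]] := @spectral_decomposition R.
(* A bound for the inverse of the expanding eigenvalue and for the two
   contracting ones. *)
pose r : R := 5 / 6.
have l0 : 1 <= `|l| by rewrite ler0_norm; lra.
have lr : `|l|^-1 <= r.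
  rewrite ler0_norm; last lra.
  by rewrite /r -[leRHS]invrK lef_pV2 ?posrE; lra.
pose D := 4 * (4 * (M + 2 * K) + 2 * K).
have D0 : 0 < D by rewrite /D; lra.
have r0 : 0 <= r < 1 by rewrite /r; apply/andP; split; lra.
have [|N N0 hN] := ex_expr_lt r0 (_ : 0 < (M * D)^-1); first by rewrite invr_gt0 mulr_gt0.
exists N => // v; have [y [z [x [vE yE zE xE [hy [hz hx]]]]]] := hK v.
have [hge0 hZ hD] := lpow_quasi (@ler01 R).
have it n : iter n b v = l ^+ n *: y + c ^+ n *: z + m ^+ n *: x.
  elim: n => [|n IH]; first by rewrite !expr0 !scale1r.
  rewrite iterS IH /applyB0 !mulmxDr -!scalemxAr.
  by rewrite -[B 0 *m y]/(b y) -[B 0 *m z]/(b z) -[B 0 *m x]/(b x) yE zE xE !scalerA -!exprSr.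
have [vb0 y0] := conj (hge0 v) (hge0 y).
set h := lpow 1 in hge0 hZ hD hy hz hx vb0 y0 *.
have h1 a w : h (a *: w) = `|a| * h w by rewrite hZ powRr1.
have p2 : 2 `^ 1 = 2 :> R by rewrite powRr1.
have h3 u1 u2 u3 : h (u1 + u2 + u3) <= 4 * (h u1 + h u2 + h u3).
  have := quasi_comb3 1 1 1 u1 u2 u3 ler01 (lpow_quasi (@ler01 R)).
  by rewrite !scale1r normr1 powR1 !mul1r p2 -/h => /le_trans; apply; lra.
have cm n : `|c ^+ n| <= r ^+ n /\ `|m ^+ n| <= r ^+ n.
  have [cr mr] : `|c| <= r /\ `|m| <= r by rewrite (ger0_norm c0) /r; split; lra.
  by rewrite !normrX; split; apply: lerXn2r; rewrite ?nnegrE//; case/andP: r0.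
have rest n : `|c ^+ n| * h z + `|m ^+ n| * h x <= r ^+ n * (2 * K * h v).
  have [h1n h2n] := cm n.
  rewrite (_ : 2 * K * h v = K * h v + K * h v); last by ring.
  by rewrite mulrDr; apply: lerD; apply: ler_pM.
have up n : h (iter n b v) <= 4 * (`|l| ^+ n * h y + r ^+ n * (2 * K * h v)).
  rewrite it (le_trans (h3 _ _ _))// !h1 normrX ler_wpM2l// -addrA.
  by rewrite lerD2l.
have dn n : `|l| ^+ n * h y <= 4 * (h (iter n b v) + r ^+ n * (2 * K * h v)).
  rewrite -normrX -h1.
  have -> : l ^+ n *: y = iter n b v + (- c ^+ n) *: z + (- m ^+ n) *: x.
    by rewrite it !scaleNr; apply/matrixP => i j; rewrite !mxE; ring.
  rewrite (le_trans (h3 _ _ _))// !h1 !normrN ler_wpM2l// -addrA.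
  by rewrite lerD2l.
have [|/ltW small] := leP (M * h v) (h (iter N.*2 b v)); [by left | right].
have r1 n : r ^+ n <= 1.
  by rewrite exprn_ile1//; case/andP: r0 => // _ /ltW.
have rn n : 0 <= r ^+ n by rewrite exprn_ge0; case/andP: r0.
have big : `|l| ^+ N.*2 * h y <= 4 * (M + 2 * K) * h v.
  rewrite (le_trans (dn _))// -[leRHS]mulrA ler_wpM2l// [leRHS]mulrDl lerD//.
  rewrite -[leRHS]mul1r; apply: ler_wpM2r => //.
  by rewrite !mulr_ge0// ltW.
have med : `|l| ^+ N * h y <= r ^+ N * (4 * (M + 2 * K) * h v).
  have -> : `|l| ^+ N * h y = (`|l|^-1) ^+ N * (`|l| ^+ N.*2 * h y).
    rewrite mulrA exprVn -addnn exprD mulrA mulVf ?mul1r//.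
    by rewrite expf_neq0// gt_eqF//; lra.
  apply: ler_pM => //.
  - by rewrite ?(mulr_ge0, exprn_ge0, invr_ge0).
  - by apply: lerXn2r; rewrite ?nnegrE ?invr_ge0//; case/andP: r0.
have fin : h (iter N b v) <= r ^+ N * (D * h v).
  rewrite (le_trans (up _))//.
  apply: (@le_trans _ _ (4 * (r ^+ N * (4 * (M + 2 * K) * h v) + r ^+ N * (2 * K * h v)))).
    by rewrite ler_wpM2l// lerD2r.
  by rewrite /D le_eqVlt; apply/orP; left; apply/eqP; ring.
rewrite (le_trans (ler_wpM2l (ltW M0) fin))//.
rewrite (_ : M * (r ^+ N * (D * h v)) = r ^+ N * (M * D) * h v); last by ring.
rewrite -[leRHS]mul1r; apply: ler_wpM2r => //.
have MD : 0 < M * D by exact: mulr_gt0.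
by rewrite -(mulVf (lt0r_neq0 MD)); apply: ler_wpM2r; exact: ltW.
Qed.
End Dichotomy.

(** * Hoelder's inequality with a gap *)

Section WeightedHoelder.
Context {R : realType}.
Implicit Types a b t : R.

Lemma weighted_amgm a b t : 0 <= t <= 1 -> 0 < a -> 0 < b ->
  a `^ t * b `^ (1 - t) <= t * a + (1 - t) * b.
Proof.
move=> /andP[t0 t1] a0 b0.
have [->|tn0] := eqVneq t 0.
  by rewrite powRr0 subr0 (powRr1 (ltW b0)) !mul1r mul0r add0r.
have [->|tn1] := eqVneq t 1.
  by rewrite subrr powRr0 (powRr1 (ltW a0)) mulr1 mul1r mul0r addr0.
have t0' : 0 < t by rewrite lt_neqAle eq_sym tn0.
have t1' : 0 < 1 - t by rewrite subr_gt0 lt_neqAle tn1.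
have := @conjugate_powR R (a `^ t) (b `^ (1 - t)) t^-1 (1 - t)^-1 (powR_ge0 _ _) (powR_ge0 _ _).
rewrite !invr_gt0 !invrK -!powRrM !divff ?gt_eqF// !powRr1 ?(ltW a0) ?(ltW b0)//.
rewrite [a * t]mulrC [b * _]mulrC; apply => //.
by rewrite addrC subrK.
Qed.

(** For equal weights this is the identity for (sqrt a - sqrt b)^2. Other weights
    are reduced to that case by writing a^i b^j as a weighted geometric mean of
    a and sqrt (a b). *)
Lemma weighted_amgm_defect a b i j e : i + j = 1 -> 0 <= e -> e <= i -> e <= j ->
  0 < a -> 0 < b ->
  a `^ i * b `^ j <= i * a + j * b - e * (Num.sqrt a - Num.sqrt b) ^+ 2.
Proof.
move=> ij e0; wlog : a b i j ij / j <= i.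
  move=> W ei ej a0 b0; have [ji|/ltW ji] := leP j i; first exact: W.
  rewrite mulrC [i * a + _]addrC -[(_ - _) ^+ 2]sqrrN opprB.
  by apply: W => //; rewrite addrC.
move=> ji ei ej a0 b0.
set x := Num.sqrt a; set y := Num.sqrt b.
have x0 : 0 < x by rewrite sqrtr_gt0.
have y0 : 0 < y by rewrite sqrtr_gt0.
have xa : x * x = a by rewrite -expr2 sqr_sqrtr// ltW.
have yb : y * y = b by rewrite -expr2 sqr_sqrtr// ltW.
have E : a `^ i * b `^ j = a `^ (i - j) * (x * y) `^ (1 - (i - j)).
  rewrite -xa -yb (_ : 1 - (i - j) = j + j); last by rewrite -ij; ring.
  have P (z : R) k : 0 < z -> (z * z) `^ k = z `^ (k + k).
    by move=> z0; rewrite powRM ?ltW// -powRD// (gt_eqF z0)/= implybT.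
  rewrite !P// powRM ?ltW// mulrA -powRD ?(gt_eqF x0) /= ?implybT//.
  by congr (_ `^ _ * _); ring.
rewrite E (le_trans (weighted_amgm _ a0 (mulr_gt0 x0 y0)))//.
  by rewrite subr_ge0 ji/=; lra.
rewrite -{1}xa -xa -yb.
have := sqr_ge0 (x - y); rewrite -subr_ge0 => h.
have -> : i = 1 - j by rewrite -ij addrK.
have : 0 <= (j - e) * (x - y) ^+ 2 by rewrite mulr_ge0 ?sqr_ge0// subr_ge0.
by nra.
Qed.

Lemma hoelder_defect (I : finType) (x y : I -> R) i j e d k0 : i + j = 1 -> 0 <= e ->
  e <= i -> e <= j -> (forall k, 0 < x k) -> (forall k, 0 < y k) ->
  d <= (Num.sqrt (x k0 / \sum_k x k) - Num.sqrt (y k0 / \sum_k y k)) ^+ 2 ->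
  \sum_k x k `^ i * y k `^ j <=
    (1 - e * d) * ((\sum_k x k) `^ i * (\sum_k y k) `^ j).
Proof.
move=> ij e0 ei ej x0 y0; set S := \sum_k x k; set T := \sum_k y k => dk.
have S0 : 0 < S by rewrite /S (bigD1 k0)//= ltr_pwDl// sumr_ge0// => k _; exact: ltW.
have T0 : 0 < T by rewrite /T (bigD1 k0)//= ltr_pwDl// sumr_ge0// => k _; exact: ltW.
have E k : x k `^ i * y k `^ j =
    ((x k / S) `^ i * (y k / T) `^ j) * (S `^ i * T `^ j).
  rewrite mulrACA -!powRM ?divr_ge0 ?(ltW S0) ?(ltW T0) ?(ltW (x0 _)) ?(ltW (y0 _))//.
  by rewrite !divfK ?gt_eqF.
under eq_bigr do rewrite E.
rewrite -mulr_suml ler_wpM2r ?mulr_ge0 ?powR_ge0//.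
pose q k := (Num.sqrt (x k / S) - Num.sqrt (y k / T)) ^+ 2.
apply: (@le_trans _ _ (\sum_k (i * (x k / S) + j * (y k / T) - e * q k))).
  by apply: ler_sum => k _; apply: weighted_amgm_defect => //; exact: divr_gt0.
rewrite big_split/= sumrN big_split/= -!mulr_sumr -!mulr_suml !divff ?gt_eqF//.
rewrite !mulr1 ij lerD2l lerN2 ler_wpM2l// (le_trans dk)//.
by rewrite (bigD1 k0)//= lerDl sumr_ge0// => k _; exact: sqr_ge0.
Qed.

Lemma sqrt_gap a b f : 0 <= b -> f <= a -> 4 * b <= a -> f / 4 <= (Num.sqrt a - Num.sqrt b) ^+ 2.
Proof.
move=> b0 fa ba.
have a0 : 0 <= a by rewrite (le_trans _ ba)// mulr_ge0.
have := sqr_sqrtr a0; have := sqr_sqrtr b0.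
have := sqrtr_ge0 a; have := sqrtr_ge0 b.
set x := Num.sqrt a; set y := Num.sqrt b => y0 x0 yb xa.
have : 2 * y <= x by rewrite -(ler_pXn2r (n:=2)) ?nnegrE ?mulr_ge0// exprMn xa yb; lra.
by nra.
Qed.

(** Equality in Hoelder's inequality requires the normalized weights to
    coincide. If the ratio x / y varies by a factor 16 between two indices, the
    normalized weights differ by a factor 4 at one of them, and the floor f
    makes that index count. *)
Lemma hoelder_gap (I : finType) (x y : I -> R) i j e f k1 k2 : i + j = 1 -> 0 <= e ->
  e <= i -> e <= j -> (forall k, 0 < x k) -> (forall k, 0 < y k) ->
  (forall k, f * \sum_l x l <= x k) -> (forall k, f * \sum_l y l <= y k) ->
  16 * (x k2 * y k1) <= x k1 * y k2 ->
  \sum_k x k `^ i * y k `^ j <=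
    (1 - e * (f / 4)) * ((\sum_k x k) `^ i * (\sum_k y k) `^ j).
Proof.
move=> ij e0 ei ej x0 y0 fx fy.
have S0 : 0 < \sum_l x l by rewrite (bigD1 k1)//= ltr_pwDl// sumr_ge0// => k _; exact: ltW.
have T0 : 0 < \sum_l y l by rewrite (bigD1 k1)//= ltr_pwDl// sumr_ge0// => k _; exact: ltW.
move=> gap.
set s := fun k => x k / \sum_l x l; set t := fun k => y k / \sum_l y l.
have s0 k : 0 < s k by exact: divr_gt0.
have t0 k : 0 < t k by exact: divr_gt0.
have sf k : f <= s k by rewrite ler_pdivlMr.
have tf k : f <= t k by rewrite ler_pdivlMr.
have st : 16 * (s k2 * t k1) <= s k1 * t k2.
  have E u w : s u * t w = (x u * y w) * ((\sum_l x l) * (\sum_l y l))^-1.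
    by rewrite /s /t /= mulrACA invfM.
  rewrite !E mulrA; apply: ler_wpM2r => //.
  by rewrite invr_ge0 mulr_ge0// ltW.
have [h|h] := leP (4 * t k1) (s k1).
  by apply: (@hoelder_defect _ _ _ _ _ _ _ k1) => //; apply: sqrt_gap; [exact: ltW (t0 _) | exact: sf | exact: h].
apply: (@hoelder_defect _ _ _ _ _ _ _ k2) => //.
rewrite -[_ ^+ 2]sqrrN opprB.
apply: sqrt_gap; [exact: ltW (s0 _) | exact: tf |].
rewrite leNgt; apply/negP => h2.
have : s k1 * t k2 < (4 * t k1) * (4 * s k2).
  by apply: ltr_pM => //; exact: ltW (_ : 0 < _).
rewrite ltNge (_ : 4 * t k1 * (4 * s k2) = 16 * (s k2 * t k1)); last by ring.
by rewrite st.
Qed.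
End WeightedHoelder.

(** * Words that separate the energy *)

Section WordSums.
Context {R : realType}.
Implicit Types (v u : 'cV[R]_3) (q : R).
Local Notation B := (@transition_mx R).

Lemma big_tuple_cons (T : finType) n (F : n.+1.-tuple T -> R) :
  \sum_w F w = \sum_(e : T) \sum_(w : n.-tuple T) F (cons_tuple e w).
Proof.
rewrite pair_big/= (reindex (fun x : T * n.-tuple T => cons_tuple x.1 x.2))//=.
exists (fun w => (thead w, behead_tuple w)) => [[e w]|w] _ /=.
  by congr (_, _); apply: val_inj.
by apply: val_inj; rewrite /= [in RHS](tuple_eta w).
Qed.

Lemma word_mx_cons (C : 'I_2 -> 'M[R]_3) e w :
  word_mx C (e :: w) = word_mx C w *m C e.
Proof.
rewrite /word_mx /= mulmx1.
have H (A : 'M[R]_3) : foldl (fun A eta => C eta *m A) A w =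
    foldl (fun A eta => C eta *m A) 1%:M w *m A.
  elim: w A => [|x w IH] A /=; first by rewrite mul1mx.
  by rewrite (IH (C x *m A)) (IH (C x *m 1%:M)) mulmx1 mulmxA.
exact: H.
Qed.

Local Notation wd w v := (word_mx B w *m v).

Lemma iter_transfer m f v :
  iter m transfer f v = \sum_(w : m.-tuple 'I_2) f (wd w v).
Proof.
elim: m v => [|m IH] v.
  rewrite (big_pred1 [tuple]) => [|w]; first by rewrite /word_mx/= mul1mx.
  by rewrite [w]tuple0 /= eqxx.
rewrite iterS /transfer !IH big_tuple_cons big_ord_recl big_ord1.
congr (_ + _); apply: eq_bigr => w _; by rewrite word_mx_cons mulmxA.
Qed.

Lemma energy_iter m v : iter m transfer energy v = 2 ^+ m * energy v.
Proof.
elim: m v => [|m IH] v; first by rewrite mul1r.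
rewrite iterS /transfer !IH -mulrDr -[_ + _]/(transfer energy v).
by rewrite energy_transfer mulrA -exprSr.
Qed.

Lemma energy_ge0 v : 0 <= energy v.
Proof. by apply: le_trans (energy_ge v); rewrite pmulr_rge0 ?addr_ge0 ?sqr_ge0. Qed.

(** The energy doubles when summed over the two letters, so that one letter
    increases it and one decreases it. *)
Lemma energy_word m v : exists u u' : m.-tuple 'I_2,
  energy v <= energy (wd u v) /\ energy (wd u' v) <= energy v.
Proof.
elim: m v => [|m IH] v.
  by exists [tuple], [tuple]; rewrite /word_mx/= mul1mx.
have := energy_transfer v; rewrite /transfer => E.
have [e [e' [he he']]] : exists e e', energy v <= energy (B e *m v) /\
    energy (B e' *m v) <= energy v.
  have [h|h] := leP (energy v) (energy (B 0 *m v)); [exists 0, 1|exists 1, 0].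
    by split => //; lra.
  by split => //; lra.
have [u [_ [hu _]]] := IH (B e *m v).
have [_ [u' [_ hu']]] := IH (B e' *m v).
exists (cons_tuple e u), (cons_tuple e' u'); rewrite !word_mx_cons -!mulmxA.
by split; [exact: le_trans hu | exact: le_trans he'].
Qed.

Lemma lpow1_energy v :
  energy v <= 32 * lpow 1 v ^+ 2 /\ lpow 1 v ^+ 2 <= energy v.
Proof.
rewrite /lpow sum3E !powRr1//.
have := energy_le v; have := energy_ge v.
rewrite -(real_normK (num_real (v 0 0))) -(real_normK (num_real (v 1 0))) -(real_normK (num_real (v 2 0))).
have := normr_ge0 (v 0 0); have := normr_ge0 (v 1 0); have := normr_ge0 (v 2 0).
set x := `|v 0 0|; set y := `|v 1 0|; set z := `|v 2 0|; set e := energy v.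
move=> z0 y0 x0 he1 he2.
have [xy xz yz] := And3 (mulr_ge0 x0 y0) (mulr_ge0 x0 z0) (mulr_ge0 y0 z0).
have := sqr_ge0 (x - y); have := sqr_ge0 (x - z); have := sqr_ge0 (y - z).
rewrite !sqrrB (_ : (x + y + z) ^+ 2 = x ^+ 2 + y ^+ 2 + z ^+ 2 +
  2 * (x * y + x * z + y * z)); last by ring.
by move=> ? ? ?; split; lra.
Qed.

Lemma iter_B0 n v : iter n applyB0 v = wd (nseq n (0 : 'I_2)) v.
Proof.
elim: n v => [|n IH] v; first by rewrite /word_mx/= mul1mx.
by rewrite iterSr IH /= word_mx_cons mulmxA.
Qed.

Lemma word_mx_cat (w1 w2 : seq 'I_2) v : wd (w1 ++ w2) v = wd w2 (wd w1 v).
Proof.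
elim: w1 v => [|e w1 IH] v; first by rewrite /word_mx/= mul1mx.
by rewrite /= !word_mx_cons -!mulmxA IH.
Qed.

(** Words of length 2 N: when B_0^(2N) expands v, compare it with a word that does
    not increase the energy; when B_0^N contracts v, follow it by such a word
    and compare with a word that does not decrease the energy. *)
Lemma energy_split (M : R) : 0 < M -> exists2 m, (0 < m)%N &
  forall v, exists u u' : m.-tuple 'I_2, M * energy (wd u' v) <= energy (wd u v).
Proof.
(* The energy and the square of the l^1 norm differ by a factor 32 at most. *)
move=> M0; have M1 : 0 < 32 * (M + 1) by lra.
have [N N0 hN] := B0_dichotomy M1.
exists (N + N)%N => [|v]; first by rewrite addn_gt0 N0.
have K u u' : 32 * (M + 1) * lpow 1 u <= lpow 1 u' -> M * energy u <= energy u'.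
  have [h1 _] := lpow1_energy u; have [_ h2] := lpow1_energy u'.
  move=> h; have L := lpow_ge0 1 u.
  have : (32 * (M + 1) * lpow 1 u) ^+ 2 <= lpow 1 u' ^+ 2.
    by rewrite lerXn2r// ?nnegrE ?lpow_ge0// mulr_ge0// ltW.
  rewrite exprMn => h3; apply: (le_trans _ h2); apply: (le_trans _ h3).
  apply: (le_trans (ler_wpM2l (ltW M0) h1)); rewrite mulrA ler_wpM2r ?sqr_ge0//.
  by nra.
have [u [u' [hu hu']]] := energy_word (N + N) v.
have [h|h] := hN v.
  have s1 : size (nseq N.*2 (0 : 'I_2)) == (N + N)%N by rewrite size_nseq addnn.
  exists (Tuple s1), u'; rewrite /= -iter_B0.
  by apply: le_trans (K _ _ h); rewrite ler_wpM2l// ltW.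
have [_ [w [_ hw]]] := energy_word N (iter N applyB0 v).
have s1 : size (nseq N (0 : 'I_2) ++ w) == (N + N)%N.
  by rewrite size_cat size_nseq size_tuple.
exists u, (Tuple s1); rewrite /= word_mx_cat -iter_B0.
apply: le_trans hu; apply: le_trans (K _ _ h).
by rewrite ler_wpM2l// ltW.
Qed.

Lemma lpow_energy q : 0 < q -> exists2 C : R, 0 < C & forall v,
  energy v `^ (q / 2) <= C * lpow q v /\ lpow q v <= C * energy v `^ (q / 2).
Proof.
move=> q0; have q2 : 0 <= q / 2 by rewrite divr_ge0// ltW.
have P (x : R) : `|x| `^ q = (x ^+ 2) `^ (q / 2).
  rewrite -(real_normK (num_real x)) -powR_mulrn// -powRrM; congr (_ `^ _); by field.
(* Some coordinate carries a third of the norm, and 96 is 3 times the constant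
   in [energy_le]. *)
exists (96 `^ (q / 2) + 3) => [|v]; first by rewrite ltr_wpDl// powR_ge0.
have := energy_ge v; have := energy_le v; rewrite /lpow sum3E !P.
set e := energy v.
set x := v 0 0; set y := v 1 0; set z := v 2 0.
have := sqr_ge0 x; have := sqr_ge0 y; have := sqr_ge0 z.
set x2 := x ^+ 2; set y2 := y ^+ 2; set z2 := z ^+ 2 => z0 y0 x0 he1 he2.
have e0 : 0 <= e by exact: energy_ge0.
have mono a b : 0 <= a -> a <= b -> a `^ (q / 2) <= b `^ (q / 2).
  by move=> a0 ab; rewrite ge0_ler_powR ?nnegrE// (le_trans a0).
have [c0 cx cy cz ce] := And5 (powR_ge0 96 (q / 2)) (powR_ge0 x2 (q / 2))
  (powR_ge0 y2 (q / 2)) (powR_ge0 z2 (q / 2)) (powR_ge0 e (q / 2)).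
split; last first.
  have [h1 h2 h3] := And3 (mono x2 e x0 ltac:(lra)) (mono y2 e y0 ltac:(lra)) (mono z2 e z0 ltac:(lra)).
  by nra.
have Q a : 0 <= a -> e <= 96 * a -> e `^ (q / 2) <= 96 `^ (q / 2) * a `^ (q / 2).
  by move=> a0 ea; rewrite -powRM// mono.
have [hx|hx] := leP e (96 * x2); first by have := Q _ x0 hx; nra.
have [hy|hy] := leP e (96 * y2); first by have := Q _ y0 hy; nra.
by have := Q z2 z0 ltac:(lra); nra.
Qed.

End WordSums.

(** * Growth of the product of conjugate word sums *)

Section PowerGrowth.
Context {R : realType}.
Implicit Types (v u : 'cV[R]_3) (q : R).
Local Notation B := (@transition_mx R).
Local Notation wd w v := (word_mx B w *m v).

(** The ratio of the p'-th to the p-th power of a norm is a positive power of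
    that norm, hence a gap of energy is a gap between these ratios. *)
Lemma lpow_split (p p' K : R) : 0 < p -> p < p' -> 0 < K ->
  exists2 m, (0 < m)%N & forall v, exists u u' : m.-tuple 'I_2,
  K * (lpow p (wd u v) * lpow p' (wd u' v)) <=
    lpow p' (wd u v) * lpow p (wd u' v).
Proof.
move=> p0 pp' K0; have p'0 : 0 < p' by exact: lt_trans pp'.
have [C C0 hC] := lpow_energy p0; have [D D0 hD] := lpow_energy p'0.
pose r := (p' - p) / 2.
have r0 : 0 < r by rewrite divr_gt0// subr_gt0.
pose Q := K * (C * D) ^+ 2.
have Q0 : 0 < Q by rewrite mulr_gt0// exprn_gt0// mulr_gt0.
have M0 : 0 < Q `^ r^-1 by exact: powR_gt0.
have [m m0 hm] := energy_split M0.
exists m => // v; have [u [u' huu']] := hm v; exists u, u'.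
set U := wd u v in huu' *; set W := wd u' v in huu' *.
have [hU1 hU2] := hC U; have [hW1 hW2] := hC W.
have [kU1 kU2] := hD U; have [kW1 kW2] := hD W.
set a := energy U in huu' hU1 hU2 kU1 kU2; set b := energy W in huu' hW1 hW2 kW1 kW2.
have a0 : 0 <= a by exact: energy_ge0.
have b0 : 0 <= b by exact: energy_ge0.
have h : Q * b `^ r <= a `^ r.
  have -> : Q = (Q `^ r^-1) `^ r by rewrite -powRrM mulVf ?gt_eqF// powRr1// ltW.
  rewrite -powRM ?powR_ge0//; apply: ge0_ler_powR; rewrite ?nnegrE//.
  - exact: ltW.
  - by rewrite mulr_ge0 ?powR_ge0.
have E (x : R) : x `^ (p' / 2) = x `^ (p / 2) * x `^ r.
  rewrite -powRD; last by rewrite /r -mulrDl addrC subrK mulf_eq0 gt_eqF//= invr_eq0 gt_eqF.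
  by congr (_ `^ _); rewrite /r; field.
have [L1 L2 L3 L4] := And4 (lpow_ge0 p U) (lpow_ge0 p' U) (lpow_ge0 p W) (lpow_ge0 p' W).
set A := a `^ (p / 2) in hU1 hU2 E *; set A' := a `^ (p' / 2) in kU1 kU2.
set b1 := b `^ (p / 2) in hW1 hW2 E *; set b1' := b `^ (p' / 2) in kW1 kW2.
have A0 : 0 <= A by exact: powR_ge0.
have b10 : 0 <= b1 by exact: powR_ge0.
have step1 : lpow p U * lpow p' W <= (C * A) * (D * b1').
  by apply: ler_pM.
have step2 : A' * b1 <= (D * lpow p' U) * (C * lpow p W).
  by apply: ler_pM => //; exact: powR_ge0.
have step3 : Q * (A * b1') <= A' * b1.
  rewrite /A' /b1' !E -/A -/b1.
  have := ler_wpM2l (mulr_ge0 A0 b10) h; congr (_ <= _); ring.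
rewrite -(ler_pM2l (mulr_gt0 C0 D0)).
apply: (@le_trans _ _ (Q * (A * b1'))).
  apply: (@le_trans _ _ (C * D * (K * (C * A * (D * b1'))))).
    by rewrite ler_pM2l ?mulr_gt0// ler_pM2l.
  by rewrite /Q le_eqVlt; apply/orP; left; apply/eqP; ring.
apply: (le_trans step3); apply: (le_trans step2).
by rewrite le_eqVlt; apply/orP; left; apply/eqP; ring.
Qed.

Lemma lpow_wordP q m : 0 < q -> exists2 C : R, 0 < C &
  forall (w : m.-tuple 'I_2) v, lpow q v <= C * lpow q (wd w v).
Proof.
move=> q0; have [C C0 hC] := @lpow_B R q (ltW q0).
exists (C ^+ m) => [|w v]; first exact: exprn_gt0.
case: w => w /= /eqP <-; elim: w v => [|e w IH] v.
  by rewrite expr0 mul1r /word_mx/= mul1mx.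
rewrite word_mx_cons -mulmxA exprS -mulrA.
apply: (@le_trans _ _ (C * lpow q (B e *m v))).
  case: e => -[|[|//]] e2.
    by rewrite (_ : Ordinal e2 = 0); [exact: (hC v).1|exact: val_inj].
  by rewrite (_ : Ordinal e2 = 1); [exact: (hC v).2|exact: val_inj].
by rewrite ler_wpM2l// ltW.
Qed.

Lemma lpow_gt0 q v : v != 0 -> 0 < lpow q v.
Proof.
move=> v0; have [i vi0] : exists i, v i 0 != 0.
  apply/existsP; apply: contraNT v0 => /existsPn h.
  by apply/eqP/matrixP => i j; rewrite mxE ord1; apply/eqP/negPn/h.
rewrite /lpow (bigD1 i)//= ltr_pwDl//; first by rewrite powR_gt0// normr_gt0.
by apply: sumr_ge0 => j _; exact: powR_ge0.
Qed.

(** Words have length 6 + n because [wsum_comparable] starts there. *)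
Definition kpow p p' n v :=
  wsum p (6 + n) v `^ p^-1 * wsum p' (6 + n) v `^ p'^-1.

(** No word of length m is negligible: each of them carries a fixed proportion of
    the word sum of length m + n, because transition matrices are invertible
    and word sums are uniformly comparable with norms. *)
Lemma wsum_floor q m : 0 < q -> exists2 f : R, 0 < f & forall n (w : m.-tuple 'I_2) v,
  f * wsum q (6 + (m + n)) v <= wsum q (6 + n) (wd w v).
Proof.
move=> q0; have q0' := ltW q0.
have [C C0 hC] := @wsum_comparable R q q0.
have [D D0 hD] := lpow_wordP m q0.
pose F := 2 `^ q * 2 `^ q * wtot q m.
have F0 : 0 < F by rewrite !mulr_gt0 ?powR_gt0// wtot_gt0.
have G0 : 0 < D * (C * C) * F by apply: mulr_gt0 => //; do 2!apply: mulr_gt0 => //.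
exists (D * (C * C) * F)^-1 => [|n w v]; first by rewrite invr_gt0.
rewrite ler_pdivrMl//.
have [t t0 ht] := hC n.
have -> : wsum q (6 + (m + n)) v = \sum_(w : m.-tuple 'I_2) wsum q (6 + n) (wd w v).
  by rewrite addnCA /wsum iterD iter_transfer.
apply: (@le_trans _ _ (\sum_(w : m.-tuple 'I_2) C * t * lpow q (wd w v))).
  by apply: ler_sum => x _; case: (ht (wd x v)).
rewrite -mulr_sumr -iter_transfer.
apply: (@le_trans _ _ (C * t * (F * (D * lpow q (wd w v))))).
  rewrite ler_pM2l ?mulr_gt0//; apply: (le_trans (wsum_upper m v q0')).
  by rewrite ler_pM2l.
have [h _] := ht (wd w v).
rewrite (_ : C * t * _ = D * C * F * (t * lpow q (wd w v))); last by ring.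
rewrite (_ : _ * wsum _ _ _ = D * C * F * (C * wsum q (6 + n) (wd w v))); last by ring.
have H0 : 0 < D * C * F by apply: mulr_gt0 => //; apply: mulr_gt0.
by rewrite ler_pM2l.
Qed.

Lemma wsum_gt0 q n v : 0 < q -> v != 0 -> 0 < wsum q (6 + n) v.
Proof.
move=> q0 v0; have [C C0 hC] := @wsum_comparable R q q0.
have [t t0 ht] := hC n; have [h _] := ht v.
by rewrite -(pmulr_rgt0 _ C0) (lt_le_trans _ h)// mulr_gt0// lpow_gt0.
Qed.

Lemma word_neq0 (w : seq 'I_2) v : v != 0 -> wd w v != 0.
Proof.
move=> v0; have [C C0 /(_ (in_tuple w) v)] := lpow_wordP (size w) (@ltr01 R).
move=> /= h; apply: contraTneq (lpow_gt0 1 v0) => E; rewrite -leNgt.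
apply: (le_trans h); rewrite E /lpow big1 ?mulr0// => i _.
by rewrite mxE normr0 powR0// oner_eq0.
Qed.

(** Hoelder's inequality over the words of length m, in which [lpow_split]
    provides the disparity and [wsum_floor] the floor that [hoelder_gap]
    requires. *)
Lemma growth_step (p p' : R) : 0 < p -> p < p' -> p^-1 + p'^-1 = 1 ->
  exists2 m, (0 < m)%N & exists2 k : R, 1 < k & forall n v, v != 0 ->
  k * (\sum_(w : m.-tuple 'I_2) kpow p p' n (wd w v)) <= kpow p p' (m + n) v.
Proof.
move=> p0 pp' conj; have p'0 : 0 < p' by exact: lt_trans pp'.
have [C C0 hC] := @wsum_comparable R p p0.
have [D D0 hD] := @wsum_comparable R p' p'0.
have K0 : 0 < 16 * (C * D) ^+ 2 by rewrite mulr_gt0// exprn_gt0// mulr_gt0.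
have [m m0 hm] := lpow_split p0 pp' K0.
have [f1 f10 hf1] := wsum_floor m p0; have [f2 f20 hf2] := wsum_floor m p'0.
pose f := Num.min (Num.min f1 f2) 1.
have f0 : 0 < f by rewrite !lt_min f10 f20 ltr01.
have ff1 : f <= f1 by rewrite /f !ge_min lexx.
have ff2 : f <= f2 by rewrite /f !ge_min lexx orbT.
have f_1 : f <= 1 by rewrite /f !ge_min lexx !orbT.
(* The constant e has to be a lower bound of both weights. *)
pose i := p^-1; pose j := p'^-1; pose e := i * j.
have i0 : 0 < i by rewrite invr_gt0.
have j0 : 0 < j by rewrite invr_gt0.
have ij : i + j = 1 by [].
have ei : e <= i by rewrite /e ger_pMr// -ij lerDr ltW.
have ej : e <= j by rewrite /e ger_pMl// -ij lerDl ltW.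
have e0 : 0 < e by rewrite mulr_gt0.
have e1 : e < 1 by rewrite (le_lt_trans ei)// -ij ltrDl.
have k0 : 0 < 1 - e * (f / 4).
  rewrite subr_gt0; apply: (@le_lt_trans _ _ (e * 1)); last by rewrite mulr1.
  by rewrite ler_wpM2l ?(ltW e0)//; lra.
exists m => //; exists (1 - e * (f / 4))^-1.
  rewrite invf_gt1// gtrBl mulr_gt0//; lra.
move=> n v v0.
rewrite ler_pdivrMl//.
have S q : wsum q (6 + (m + n)) v = \sum_(w : m.-tuple 'I_2) wsum q (6 + n) (wd w v).
  by rewrite addnCA /wsum iterD iter_transfer.
rewrite /kpow !S.
have [u [u' huu']] := hm v.
apply: (@hoelder_gap _ _ (fun w : m.-tuple 'I_2 => wsum p (6 + n) (wd w v))
  (fun w : m.-tuple 'I_2 => wsum p' (6 + n) (wd w v)) _ _ _ _ u' u) => //.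
- exact: ltW.
- by move=> w; apply: wsum_gt0 => //; exact: word_neq0.
- by move=> w; apply: wsum_gt0 => //; exact: word_neq0.
- move=> w; rewrite -S; apply: le_trans (hf1 n w v).
  by rewrite ler_wpM2r// wsum_ge0// ltW.
- move=> w; rewrite -S; apply: le_trans (hf2 n w v).
  by rewrite ler_wpM2r// wsum_ge0// ltW.
have [t t0 ht] := hC n; have [r r0 hr] := hD n.
set U := wd u v in huu' *; set W := wd u' v in huu' *.
have [_ hU] := ht U; have [hW _] := ht W.
have [kU _] := hr U; have [_ kW] := hr W.
have [L1 L2 L3 L4] := And4 (lpow_ge0 p U) (lpow_ge0 p' U) (lpow_ge0 p W) (lpow_ge0 p' W).
have W1 q x : 0 < q -> 0 <= wsum q (6 + n) x by move=> q0; exact/wsum_ge0/ltW.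
have s1 : wsum p (6 + n) U * wsum p' (6 + n) W <= (C * t * lpow p U) * (D * r * lpow p' W).
  by apply: ler_pM => //; exact: W1.
have s2 : (t * lpow p W) * (r * lpow p' U) <= (C * wsum p (6 + n) W) * (D * wsum p' (6 + n) U).
  by apply: ler_pM => //; rewrite mulr_ge0// ltW.
have CD : 0 < C * D by rewrite mulr_gt0.
rewrite -(ler_pM2l CD).
apply: (@le_trans _ _ ((t * lpow p W) * (r * lpow p' U))); last first.
  by apply: (le_trans s2); rewrite le_eqVlt; apply/orP; left; apply/eqP; ring.
apply: (@le_trans _ _ (C * D * (16 * ((C * t * lpow p U) * (D * r * lpow p' W))))).
  by rewrite ler_pM2l// ler_pM2l.
have tr : 0 < t * r by rewrite mulr_gt0.
move: huu'; rewrite -(ler_pM2l tr); congr (_ <= _); ring.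
Qed.

(** By induction on j: cutting off m letters gains the factor k by [growth_step],
    and the energies at the images of v add up to 2^m times the energy of v. At
    the start, [kpow] dominates the energy because both are comparable with the
    square of a norm. *)
Lemma growth_ordered (p p' : R) : 0 < p -> p < p' -> p^-1 + p'^-1 = 1 ->
  exists2 m, (0 < m)%N & exists k c : R, [/\ 1 < k, 0 < c &
   forall j v, c * k ^+ j * 2 ^+ (j * m) * energy v <= kpow p p' (j * m) v].
Proof.
move=> p0 pp' conj; have p'0 : 0 < p' by exact: lt_trans pp'.
have [m m0 [k k1 hk]] := growth_step p0 pp' conj.
have L q : 0 < q -> exists2 C : R, 0 < C &
    forall v, C * energy v `^ 2^-1 <= wsum q 6 v `^ q^-1.
  move=> q0; have [C C0 hC] := lpow_energy q0.
  have [D D0 hD] := @wsum_leD R q 6 (ltW q0).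
  exists ((C * D) `^ q^-1)^-1 => [|v].
    by rewrite invr_gt0 powR_gt0// mulr_gt0.
  have CD0 : 0 <= C * D by rewrite mulr_ge0// ltW.
  rewrite ler_pdivrMl ?powR_gt0 ?mulr_gt0// -powRM//; last exact/wsum_ge0/ltW.
  have -> : energy v `^ 2^-1 = (energy v `^ (q / 2)) `^ q^-1.
    by rewrite -powRrM mulrAC divff ?mul1r// gt_eqF.
  apply: ge0_ler_powR; rewrite ?nnegrE ?powR_ge0 ?invr_ge0 ?(ltW q0)//.
    by rewrite !mulr_ge0 ?wsum_ge0// ltW.
  have [h _] := hC v; apply: (le_trans h); rewrite -mulrA ler_pM2l//.
  exact: (hD 0%N v).
have [C C0 hC] := L p p0; have [D D0 hD] := L p' p'0.
exists m => //; exists k, (C * D); split=> //; first exact: mulr_gt0.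
elim=> [|j IH] v.
  rewrite !mul0n !expr0 !mulr1 /kpow addn0.
  have E : energy v = energy v `^ 2^-1 * energy v `^ 2^-1.
    by rewrite powR12_sqrt ?energy_ge0// -expr2 sqr_sqrtr// energy_ge0.
  rewrite {1}E mulrACA; apply: ler_pM => //; by rewrite mulr_ge0 ?powR_ge0// ltW.
have [->|v0] := eqVneq v 0.
  have -> : energy (0 : 'cV[R]_3) = 0 by rewrite /energy !mxE; ring.
  by rewrite mulr0 /kpow mulr_ge0 ?powR_ge0.
rewrite mulSn; apply: le_trans (hk _ _ v0).
have k0 : 0 < k by exact: lt_trans k1.
apply: (@le_trans _ _ (k * \sum_(w : m.-tuple 'I_2)
    (C * D * k ^+ j * 2 ^+ (j * m) * energy (wd w v)))); last first.
  by rewrite ler_pM2l//; apply: ler_sum => w _; exact: IH.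
rewrite -mulr_sumr -iter_transfer energy_iter exprS exprD.
by rewrite le_eqVlt; apply/orP; left; apply/eqP; ring.
Qed.

(** The only exponent that is its own conjugate is 2. *)
Lemma conjugate_neq (p p' : R) : 1 < p -> p != 2 -> p^-1 + p'^-1 = 1 ->
  [/\ 0 < p, 0 < p' & p < p' \/ p' < p].
Proof.
move=> p1 p2 conj; have p0 : 0 < p by lra.
have E : p'^-1 = 1 - p^-1 by rewrite -conj addrC addKr.
have p'0 : 0 < p' by rewrite -invr_gt0 E subr_gt0 invf_lt1.
split=> //; have [|pp'|pp'] := ltgtP p p'; [by left|by right|].
move: conj p2; rewrite -pp' => h /eqP; case.
have pp : p^-1 * p = 1 by rewrite mulVf// gt_eqF.
by nra.
Qed.
End PowerGrowth.

(** * Subadditive sequences and equivalence of matrix norms *)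

Section Fekete.
Context {R : realType}.

(** The infimum of the quotients is the limit: Euclidean division of n by an
    index that nearly achieves the infimum. The linear lower bound keeps the
    infimum finite. *)
Lemma fekete (x : nat -> R) (K : R) :
  (forall m n, x (m + n)%N <= x m + x n) -> (forall n, K * n%:R <= x n) ->
  exists l : R, x n / n%:R @[n --> \oo] --> l.
Proof.
move=> sub low.
pose A := [set x n.+1 / n.+1%:R | n in [set: nat]].
have A0 : A !=set0 by exists (x 1%N / 1%:R), 0%N.
have lbA : has_lbound A.
  by exists K => _ [n _ <-]; rewrite ler_pdivlMr// ltr0n.
have infA : has_inf A by split.
exists (inf A); apply/cvgrPdist_le => /= e e0.
have e20 : 0 < e / 2 by rewrite divr_gt0.
have [_ [m _ <-] hm] := inf_adherent e20 infA.
set M := m.+1 in hm.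
have mulx q r : x (q * M + r)%N <= q%:R * x M + x r.
  elim: q => [|q IH]; first by rewrite mul0n mul0r add0r.
  rewrite mulSn -addnA (le_trans (sub _ _))// -natr1 mulrDl mul1r addrC.
  by rewrite -addrA [x M + _]addrC addrA lerD2r.
pose T := \sum_(r < M) `|x r| + M%:R * `|x M / M%:R|.
have T0 : 0 <= T by rewrite addr_ge0 ?sumr_ge0// mulr_ge0.
have [N hN] : exists N : nat, T / (e / 2) < N%:R.
  by eexists; exact: truncnS_gt.
near=> n.
have n0 : (0 < n)%N by near: n; exact: nbhs_infty_gt.
have nN : (N <= n)%N by near: n; exact: nbhs_infty_ge.
have nR : 0 < n%:R :> R by rewrite ltr0n.
have lo : inf A <= x n / n%:R.
  by apply: ge_inf => //; exists n.-1 => //; rewrite prednK.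
have hi : x n / n%:R <= inf A + e.
  rewrite ler_pdivrMr// (divn_eq n M).
  set q := (n %/ M)%N; set r := (n %% M)%N.
  have rM : (r < M)%N by rewrite ltn_pmod.
  apply: (le_trans (mulx q r)).
  have xr : x r <= \sum_(r < M) `|x r|.
    rewrite (bigD1 (Ordinal rM))//=; apply: (le_trans (ler_norm _)).
    by rewrite lerDl sumr_ge0.
  have M0 : 0 < M%:R :> R by rewrite ltr0n.
  have qx : q%:R * x M = (q * M)%:R * (x M / M%:R).
    by rewrite natrM -mulrA [M%:R * _]mulrC divfK// gt_eqF.
  have qle : q%:R * x M <= (q * M + r)%:R * (x M / M%:R) + M%:R * `|x M / M%:R|.
    rewrite qx natrD mulrDl -[leLHS]addr0 -addrA lerD2l.
    rewrite -lerBlDl sub0r; apply: (le_trans (ler_norm _)).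
    by rewrite normrN normrM ler_wpM2r// ger0_norm// ler_nat ltnW.
  have nE : (q * M + r)%N = n by rewrite -divn_eq.
  rewrite nE in qle *.
  have Tn : T <= e / 2 * n%:R.
    rewrite mulrC -ler_pdivrMr//; apply: (le_trans (ltW hN)); by rewrite ler_nat.
  have h2 : n%:R * (x M / M%:R) <= n%:R * (inf A + e / 2) by rewrite ler_pM2l// ltW.
  rewrite /T in Tn; set S := \sum_(r < M) _ in Tn xr.
  set Y := M%:R * `|_| in Tn qle; lra.
rewrite distrC ger0_norm ?subr_ge0//; lra.
Unshelve. all: by end_near. Qed.

End Fekete.

Section NormEquivalence.
Context {R : realType}.

(** The function F is continuous for the maximum norm and positive on its compact
    unit sphere. *)
Lemma norm_lower_bound n (F : 'rV[R]_n -> R) :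
  (forall x, F x = 0 -> x = 0) -> (forall c x, F (c *: x) = `|c| * F x) ->
  (forall x y, F (x + y) <= F x + F y) ->
  exists2 c, 0 < c & forall x, c * `|x| <= F x.
Proof.
move=> F0 FZ FD.
have F00 : F 0 = 0 by rewrite -(scale0r 0) FZ normr0 mul0r.
have Fge0 x : 0 <= F x.
  have := FD x (- x); rewrite subrr F00 -scaleN1r FZ normrN normr1 mul1r.
  by lra.
have [n0|n0] := posnP n.
  exists 1 => // x; rewrite (_ : x = 0) ?normr0 ?mulr0//.
  by apply/matrixP => i [j jn]; exfalso; rewrite n0 in jn.
pose C := \sum_j F (delta_mx 0 j).
have Fle x : F x <= C * `|x|.
  rewrite [in F x](row_sum_delta x) /C mulr_suml.
  have H (s : seq 'I_n) : F (\sum_(j <- s) x 0 j *: delta_mx 0 j) <=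
      \sum_(j <- s) F (delta_mx 0 j) * `|x|.
    elim: s => [|j s IH]; first by rewrite !big_nil F00.
    rewrite !big_cons (le_trans (FD _ _))// lerD// FZ mulrC ler_wpM2l//.
    rewrite [leRHS]/Num.norm/= mx_normrE.
    exact: (le_bigmax _ (fun ij : 'I_1 * 'I_n => `|x ij.1 ij.2|) (0, j)).
  exact: H.
have C0 : 0 <= C by rewrite sumr_ge0.
have cF : continuous F.
  move=> x; apply/(@cvgrPdist_le R _ _ (nbhs x) (nbhs_filter x)) => /= e e0.
  have C10 : 0 < C + 1 by rewrite ltr_wpDl.
  apply/(@nbhs_normP R [the pseudoMetricNormedZmodType R of 'rV[R]_n]); exists (e / (C + 1)) => [|y /= /ltW h]; first exact: divr_gt0.
  have h2 : C * `|x - y| <= e.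
    apply: (@le_trans _ _ ((C + 1) * `|x - y|)).
      by rewrite ler_wpM2r// lerDl.
    by rewrite mulrC -ler_pdivlMr.
  have h3 : F x <= F y + F (x - y) by have := FD y (x - y); rewrite addrC subrK.
  have h4 : F y <= F x + F (x - y).
    have := FD x (y - x); rewrite [X in F X <= _]addrC subrK.
    by rewrite -(opprB x y) -scaleN1r FZ normrN normr1 mul1r.
  rewrite ler_norml; have := Fle (x - y); lra.
pose S := [set x : 'rV[R]_n | `|x| = 1].
have Scompact : compact S.
  apply: bounded_closed_compact.
    exists 1; split=> [|y y1 x]; first exact: num_real.
    by rewrite /S/= => ->; exact: ltW.
  apply: (@preimage_closed _ _ (fun x : 'rV[R]_n => `|x|) [set x | x = 1]) => //.
  by move=> x _; exact: norm_continuous.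
have S0 : S !=set0.
  pose k := Ordinal n0; exists (delta_mx 0 k); rewrite /S/=; apply/eqP.
  rewrite /Num.norm/= mx_normrE eq_le; apply/andP; split.
    apply/bigmax_leP; split=> // -[i j] _ /=; rewrite mxE.
    by case: (_ && _); rewrite ?normr1 ?normr0.
  have := le_bigmax 0 (fun ij : 'I_1 * 'I_n => `|delta_mx 0 k ij.1 ij.2 : R|) (0, k).
  by rewrite /= mxE !eqxx normr1.
have [c cS cmin] := EVT_min_rV S0 Scompact (continuous_subspaceT cF).
have c1 : `|c| = 1 by move: cS; rewrite inE.
exists (F c).
  rewrite lt_neqAle Fge0 andbT eq_sym; apply: contra_eq_neq c1 => /F0 ->.
  by rewrite normr0 eq_sym oner_neq0.
move=> x; have [->|x0] := eqVneq x 0; first by rewrite normr0 mulr0.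
have nx : 0 < `|x| by rewrite normr_gt0.
have := cmin (`|x|^-1 *: x).
rewrite inE /S/= normrZ normfV normr_id mulVf ?gt_eqF// FZ normfV normr_id => /(_ erefl).
by rewrite mulrC ler_pdivlMr.
Qed.

(** Equivalence of an arbitrary norm with the maximum of the entries; one constant
    serves both directions. *)
Lemma matrix_norm_bounds n (N : 'M[R]_n -> R) : matrix_norm N ->
  exists2 c : R, 0 < c & (forall (A : 'M[R]_n) i j, `|A i j| <= c * N A) /\
    forall (A : 'M[R]_n) t, 0 <= t -> (forall i j, `|A i j| <= t) -> N A <= c * t.
Proof.
move=> [N0 NZ ND].
have N00 : N 0 = 0 by rewrite -(scale0r 0) NZ normr0 mul0r.
have Nge0 x : 0 <= N x.
  have := ND x (- x); rewrite subrr N00 -scaleN1r NZ normrN normr1 mul1r.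
  by lra.
have [| | |c c0 hc] := @norm_lower_bound (n * n) (fun x => N (vec_mx x)).
- by move=> x /N0 h; apply: (can_inj vec_mxK); rewrite h linear0.
- by move=> a x; rewrite linearZ NZ.
- by move=> x y; rewrite linearD ND.
pose D := \sum_(i < n) \sum_(j < n) N (delta_mx i j).
have D0 : 0 <= D by rewrite !sumr_ge0// => i _; rewrite sumr_ge0.
exists (c^-1 + D); first by rewrite ltr_wpDr// invr_gt0.
split=> [A i j|A t t0 At].
  apply: (@le_trans _ _ (c^-1 * N A)); last by rewrite ler_wpM2r// lerDl.
  rewrite ler_pdivlMl//; have := hc (mxvec A); rewrite mxvecK; apply: le_trans.
  rewrite ler_pM2l// [leRHS]/Num.norm/= mx_normrE -(mxvecE A i j).
  exact: (le_bigmax _ (fun ij : 'I_1 * 'I_(n * n) => `|mxvec A ij.1 ij.2|) (0, _)).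
have Nsum (I : Type) (s : seq I) (G : I -> 'M[R]_n) :
    N (\sum_(k <- s) G k) <= \sum_(k <- s) N (G k).
  elim: s => [|k s IH]; first by rewrite !big_nil N00.
  by rewrite !big_cons (le_trans (ND _ _))// lerD.
rewrite [in N A](matrix_sum_delta A).
rewrite mulrDl addrC.
apply: (@le_trans _ _ (D * t)); last by rewrite lerDl mulr_ge0// invr_ge0 ltW.
rewrite /D mulr_suml; apply: (le_trans (Nsum _ _ _)); apply: ler_sum => i _.
rewrite mulr_suml; apply: (le_trans (Nsum _ _ _)); apply: ler_sum => j _.
by rewrite NZ mulrC ler_wpM2l.
Qed.
End NormEquivalence.

(** * The product of joint spectral radii *)

Section RadiusProduct.
Context {R : realType}.
Local Notation B := (@transition_mx R).
Implicit Types (p q : R) (N : 'M[R]_3 -> R).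

Lemma wtot_words q n : wtot q n =
  \sum_(w : n.-tuple 'I_2) \sum_i \sum_k `|word_mx B w k i| `^ q.
Proof.
rewrite exchange_big/=; apply: eq_bigr => i _.
rewrite /wsum iter_transfer; apply: eq_bigr => w _.
rewrite /lpow; apply: eq_bigr => k _.
by rewrite /e3 -colE mxE.
Qed.

Lemma cvg_bounded_div_nat (y : nat -> R) (M : R) :
  (forall n, `|y n| <= M) -> y n / n%:R @[n --> \oo] --> 0.
Proof.
move=> yM; apply/cvgrPdist_le => /= e e0.
have [N hN] : exists N : nat, M / e < N%:R by eexists; exact: truncnS_gt.
near=> n.
have nN : (N <= n)%N by near: n; exact: nbhs_infty_ge.
have n0 : (0 < n)%N by near: n; exact: nbhs_infty_gt.
rewrite sub0r normrN normrM normfV (ger0_norm (ler0n _ n)).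
rewrite ler_pdivrMr ?ltr0n// (le_trans (yM n))// mulrC -ler_pdivrMr//.
by rewrite (le_trans (ltW hN))// ler_nat.
Unshelve. all: by end_near. Qed.

(** Cut each word into two and bound the second half uniformly. *)
Lemma wtot_submul q : 0 < q ->
  exists2 C : R, 0 < C & forall m n, wtot q (m + n) <= C * wtot q m * wtot q n.
Proof.
move=> q0; exists (2 `^ q * 2 `^ q) => [|m n]; first by rewrite mulr_gt0 ?powR_gt0.
have H v : wsum q (m + n) v <= 2 `^ q * 2 `^ q * wtot q n * wsum q m v.
  rewrite /wsum iterD !iter_transfer mulr_sumr; apply: ler_sum => w _.
  exact/wsum_upper/ltW.
rewrite {1}/wtot mulrAC /wtot [leRHS]mulr_sumr; apply: ler_sum => i _; exact: H.
Qed.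

(** Up to a constant the totals are submultiplicative, and they decrease at most
    geometrically because one more letter costs at most a constant factor. *)
Lemma wtot_rate q : 0 < q -> exists l : R, ln (wtot q n) / n%:R @[n --> \oo] --> l.
Proof.
move=> q0; have [C C0 hC] := wtot_submul q0.
have [D D0 hD] := wsum_le_succ (ltW q0).
have w0 n : 0 < wtot q n by exact: wtot_gt0.
pose x n := ln (C * wtot q n).
have low n : wtot q 0 * (D ^+ n)^-1 <= wtot q n.
  rewrite ler_pdivrMr ?exprn_gt0//; elim: n => [|n IH]; first by rewrite mulr1.
  rewrite (le_trans IH)// exprS mulrA ler_pM2r ?exprn_gt0// mulrC /wtot mulr_sumr.
  by apply: ler_sum => i _.
have sub m n : x (m + n)%N <= x m + x n.
  rewrite /x -lnM ?posrE ?mulr_gt0// ler_ln ?posrE ?mulr_gt0//.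
  by rewrite mulrACA -mulrA ler_pM2l// mulrA.
have x0 : 0 <= x 0%N by have := sub 0%N 0%N; rewrite addn0; lra.
have xlow n : - ln D * n%:R <= x n.
  have : C * (wtot q 0 * (D ^+ n)^-1) <= C * wtot q n by rewrite ler_pM2l.
  rewrite mulrA -ler_ln ?posrE; last 2 first.
    by rewrite !mulr_gt0// invr_gt0 exprn_gt0.
    by rewrite mulr_gt0.
  rewrite lnM ?posrE ?mulr_gt0// ?invr_gt0 ?exprn_gt0//.
  rewrite lnV ?posrE ?exprn_gt0// lnXn// -/(x 0%N) -/(x n) -mulr_natr; lra.
have [l hl] := fekete sub xlow.
exists l; rewrite -[l]subr0.
have := cvgB hl (@cvg_bounded_div_nat (fun=> ln C) `|ln C| (fun=> lexx _)).
move=> h.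
have -> : (fun n => ln (wtot q n) / n%:R) =
    (fun n => x n / n%:R) \- (fun n => ln C / n%:R).
  by apply/funext => n; rewrite /= -mulrBl /x lnM ?posrE// addrC addKr.
exact: h.
Qed.

Lemma lpow_norm_bounds N q : matrix_norm N -> 0 < q -> exists2 C : R, 0 < C &
  forall A : 'M[R]_3, \sum_i \sum_k `|A k i| `^ q <= C * N A `^ q /\
    N A `^ q <= C * \sum_i \sum_k `|A k i| `^ q.
Proof.
move=> hN q0; have [c c0 [h1 h2]] := matrix_norm_bounds hN.
have N0 A : 0 <= N A by have := h1 A 0 0; rewrite -(pmulr_rge0 _ c0); exact: le_trans.
(* The norm involves nine entries. *)
exists (10 * c `^ q) => [|A]; first by rewrite mulr_gt0// powR_gt0.
split.
  apply: (@le_trans _ _ (\sum_(i < 3) \sum_(k < 3) (c * N A) `^ q)).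
    apply: ler_sum => i _; apply: ler_sum => k _.
    by apply: ge0_ler_powR; rewrite ?nnegrE ?(ltW q0)// mulr_ge0// ltW.
  rewrite !sumr_const !card_ord powRM ?(ltW c0)// -mulrA.
  have := mulr_ge0 (powR_ge0 c q) (powR_ge0 (N A) q).
  by rewrite -mulrnA -mulr_natl (_ : (3 * 3)%N = 9%N) // -mulrA; lra.
set S := \sum_i _.
have S0 : 0 <= S by rewrite !sumr_ge0// => i _; rewrite sumr_ge0// => k _; exact: powR_ge0.
apply: (@le_trans _ _ ((c * S `^ q^-1) `^ q)).
  apply: ge0_ler_powR; rewrite ?nnegrE ?(ltW q0)//.
    by rewrite mulr_ge0 ?powR_ge0// ltW.
  apply: h2 => [|i j]; first exact: powR_ge0.
  have -> : `|A i j| = (`|A i j| `^ q) `^ q^-1.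
    by rewrite -powRrM divff ?gt_eqF// powRr1.
  apply: ge0_ler_powR; rewrite ?nnegrE ?powR_ge0 ?invr_ge0 ?(ltW q0)//.
  rewrite /S (bigD1 j)//= (bigD1 i)//= -addrA lerDl.
  apply: addr_ge0; apply: sumr_ge0 => k _; first exact: powR_ge0.
  by apply: sumr_ge0 => k' _; exact: powR_ge0.
rewrite powRM ?(ltW c0) ?powR_ge0// -powRrM mulVf ?gt_eqF// powRr1//.
have := mulr_ge0 (powR_ge0 c q) S0; lra.
Qed.

(** Up to constants, the sum of the q-th powers of a matrix norm over words is the
    total of the word sums at the basis vectors. *)
Lemma radius_rate N q : matrix_norm N -> 0 < q -> exists l : R,
  ln (wtot q n) / n%:R @[n --> \oo] --> l /\
  joint_spectral_radius N q B = expR (l / q).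
Proof.
move=> hN q0; have [l hl] := wtot_rate q0; exists l; split=> //.
have [C C0 hC] := lpow_norm_bounds hN q0.
pose S n := \sum_(w : n.-tuple 'I_2) N (word_mx B w) `^ q.
have S1 n : wtot q n <= C * S n.
  by rewrite wtot_words /S mulr_sumr; apply: ler_sum => w _; case: (hC (word_mx B w)).
have S2 n : S n <= C * wtot q n.
  by rewrite wtot_words /S mulr_sumr; apply: ler_sum => w _; case: (hC (word_mx B w)).
have w0 n : 0 < wtot q n by exact: wtot_gt0.
have Sp n : 0 < S n by rewrite -(pmulr_rgt0 _ C0) (lt_le_trans (w0 n)).
have bd n : `|ln (S n) - ln (wtot q n)| <= `|ln C|.
  have h1 : ln (wtot q n) <= ln C + ln (S n).
    by rewrite -lnM ?posrE// ler_ln ?posrE ?mulr_gt0.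
  have h2 : ln (S n) <= ln C + ln (wtot q n).
    by rewrite -lnM ?posrE// ler_ln ?posrE ?mulr_gt0.
  by have := ler_norm (ln C); rewrite ler_norml => h3; apply/andP; split; lra.
have cS : ln (S n) / n%:R @[n --> \oo] --> l.
  rewrite -[l]addr0; have := cvgD hl (cvg_bounded_div_nat bd).
  move=> h.
  have -> : (fun n => ln (S n) / n%:R) = (fun n => ln (wtot q n) / n%:R) \+
      (fun n => (ln (S n) - ln (wtot q n)) / n%:R).
    by apply/funext => n; rewrite /= -mulrDl addrC subrK.
  exact: h.
rewrite /joint_spectral_radius; apply/cvg_lim => //.
have -> : (fun n => (\sum_(w : n.-tuple 'I_2) N (word_mx B w) `^ q) `^ (n%:R * q)^-1)
    = (fun n => expR (ln (S n) / n%:R / q)).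
  apply/funext => n; rewrite -/(S n) /powR gt_eqF//.
  by rewrite invfM [_ * ln _]mulrC mulrA.
apply: (@cvg_comp _ _ _ _ expR); last exact: continuous_expR.
exact: cvgMr_tmp.
Qed.

Lemma growth (p p' : R) : 1 < p -> p != 2 -> p^-1 + p'^-1 = 1 ->
  exists2 m, (0 < m)%N & exists k c : R, [/\ 1 < k, 0 < c &
   forall j v, c * k ^+ j * 2 ^+ (j * m) * energy v <= kpow p p' (j * m) v].
Proof.
move=> p1 p2 conj; have [p0 p'0 [pp'|pp']] := conjugate_neq p1 p2 conj.
  exact: growth_ordered.
have [|m m0 [k [c [k1 c0 H]]]] := growth_ordered p'0 pp'; first by rewrite addrC.
exists m; first exact: m0.
exists k, c; split; [exact: k1|exact: c0|move=> j v].
by rewrite /kpow [leRHS]mulrC; exact: H.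
Qed.

Lemma ln_growth (k c X Y p p' : R) (j n : nat) :
  0 < k -> 0 < c -> 0 < X -> 0 < Y ->
  c * k ^+ j * 2 ^+ n <= X `^ p^-1 * Y `^ p'^-1 ->
  ln c + j%:R * ln k + n%:R * ln 2 <= ln X / p + ln Y / p'.
Proof.
move=> k0 c0 X0 Y0.
have kj : 0 < k ^+ j by exact: exprn_gt0.
have tn : 0 < 2 ^+ n :> R by exact: exprn_gt0.
have Xp : 0 < X `^ p^-1 by exact: powR_gt0.
have Yp : 0 < Y `^ p'^-1 by exact: powR_gt0.
rewrite -ler_ln ?posrE; [|by rewrite !mulr_gt0|by rewrite mulr_gt0].
rewrite !lnM ?posrE//; last by rewrite mulr_gt0.
by rewrite !ln_powR !lnXn// -!(mulr_natl (ln _)) ![_^-1 * _]mulrC.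
Qed.

(** In logarithms, [growth] bounds the rates from below by ln 2 plus
    (ln k) / m along the lengths 6 + j m. *)
Theorem radius_product N (p p' : R) : matrix_norm N ->
  1 < p -> p != 2 -> p^-1 + p'^-1 = 1 ->
  joint_spectral_radius N p B * joint_spectral_radius N p' B > 2.
Proof.
move=> hN p1 p2 conj; have [p0 p'0 _] := conjugate_neq p1 p2 conj.
have [l [hl ->]] := radius_rate hN p0.
have [l' [hl' ->]] := radius_rate hN p'0.
have [m m0 [k [c [k1 c0 H]]]] := growth p1 p2 conj.
have k0 : 0 < k by exact: lt_trans k1.
have mR : 0 < m%:R :> R by rewrite ltr0n.
rewrite -expRD -[ltLHS]lnK ?posrE// ltr_expR.
pose E : R := ln 2 + ln k / m%:R.
suff : E <= l / p + l' / p'.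
  by apply: lt_le_trans; rewrite /E ltrDl divr_gt0// ln_gt0.
rewrite leNgt; apply/negP => lt_E.
pose d := (E - (l / p + l' / p')) / 2.
have d0 : 0 < d by rewrite divr_gt0// subr_gt0.
have hsum : ln (wtot p n) / n%:R / p + ln (wtot p' n) / n%:R / p' @[n --> \oo] -->
    l / p + l' / p' by apply: cvgD; exact: cvgMr_tmp.
have /cvgrPdist_lt/(_ d d0)[N0 _ hN0] := hsum.
pose c1 := ln (c * energy (e3 0)).
have en0 : 0 < energy (e3 0 : 'cV[R]_3).
  apply: lt_le_trans (energy_ge _); rewrite /e3 !mxE /= expr1n expr0n /= !addr0; lra.
have Hj j : c1 + ((6 + j * m)%:R - 6) * E <=
    ln (wtot p (6 + j * m)) / p + ln (wtot p' (6 + j * m)) / p'.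
  have w0 q n : 0 < q -> 0 < wtot q n by exact: wtot_gt0.
  have wle q n : 0 < q -> wsum q n (e3 0) <= wtot q n.
    by move=> q0; rewrite /wtot (bigD1 0)//= lerDl sumr_ge0// => *; exact/wsum_ge0/ltW.
  have : c * k ^+ j * 2 ^+ (j * m) * energy (e3 0) <=
     wtot p (6 + j * m) `^ p^-1 * wtot p' (6 + j * m) `^ p'^-1.
    apply: (le_trans (H j (e3 0))); apply: ler_pM; rewrite ?powR_ge0//.
      by apply: ge0_ler_powR; rewrite ?nnegrE ?invr_ge0 ?wle ?(ltW p0) ?(ltW (w0 _ _ p0)) ?wsum_ge0// ltW.
    by apply: ge0_ler_powR; rewrite ?nnegrE ?invr_ge0 ?wle ?(ltW p'0) ?(ltW (w0 _ _ p'0)) ?wsum_ge0// ltW.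
  rewrite -mulrA [2 ^+ _ * _]mulrC mulrA [c * _ * _]mulrAC => h.
  apply: le_trans (ln_growth _ _ _ _ h) => //; last 3 first.
  - exact: mulr_gt0.
  - exact: w0.
  - exact: w0.
  rewrite natrD [6 + _]addrC addrK natrM -/c1 /E.
  by rewrite le_eqVlt; apply/orP; left; apply/eqP; field; rewrite gt_eqF.
have [J hJ] : exists J : nat, Num.max N0%:R ((6 * E - c1) / d) < J%:R.
  by eexists; exact: truncnS_gt.
(* The length n is large enough for d n to absorb the constants. *)
pose n := (6 + J * m)%N.
have Jn : (J <= n)%N by rewrite /n (leq_trans _ (leq_addl _ _))// leq_pmulr.
have n0 : 0 < n%:R :> R by rewrite ltr0n.
have nJ : J%:R <= n%:R :> R by rewrite ler_nat.
move: hJ; rewrite gt_max => /andP[hJ1 hJ2].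
have := hN0 n; rewrite /= -(ler_nat R) (le_trans (ltW hJ1) nJ) => /(_ isT).
rewrite ltr_norml => /andP[h1 _].
have := Hj J; rewrite -/n.
set a := ln (wtot p n) in h1 *; set b := ln (wtot p' n) in h1 *.
have : (6 * E - c1) < d * n%:R.
  rewrite [ltRHS]mulrC -ltr_pdivrMr//; exact: lt_le_trans nJ.
have E1 : a / n%:R / p + b / n%:R / p' = (a / p + b / p') / n%:R by field; rewrite !gt_eqF.
have {h1} : (a / p + b / p') / n%:R < E - d.
  by rewrite -E1; move: h1; rewrite /d; lra.
rewrite ltr_pdivrMr//; nra.
Qed.
End RadiusProduct.

(** * Coordinate functionals of a Schauder basis *)

(** A geometric Cauchy sequence, with the error of its limit. The limit is the
    common bound of the nested intervals around the terms. *)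
Lemma ex_limit {R : realType} (s : nat -> R) (A : R) :
  (forall k, `|s k.+1 - s k| <= A * 2 ^- k) ->
  exists d, forall K, `|d - s K| <= 2 * A * 2 ^- K.
Proof.
move=> sA.
have A0 : 0 <= A by have := sA 0%N; rewrite expr0 invr1 mulr1; apply: le_trans.
have half k : 2 ^- k.+1 = 2 ^- k / 2 :> R by rewrite exprSr invfM.
pose u K := s K - 2 * A * 2 ^- K; pose v K := s K + 2 * A * 2 ^- K.
have up k : u k <= u k.+1 /\ v k.+1 <= v k.
  have := sA k; rewrite /u /v half ler_norml => /andP[h1 h2].
  by set t := 2 ^- k in h1 h2 *; split; nra.
have uv j k : u j <= v k.
  have U n : u j <= u (n + j)%N.
    by elim: n => // n IH; rewrite (le_trans IH)// addSn; case: (up (n + j)%N).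
  have V n : v (n + k)%N <= v k.
    by elim: n => // n IH; apply: le_trans IH; rewrite addSn; case: (up (n + k)%N).
  apply: (le_trans (U k)); apply: le_trans (V j); rewrite addnC /u /v lerBlDr -addrA lerDl.
  by rewrite addr_ge0// !mulr_ge0// invr_ge0 exprn_ge0.
have hs : has_sup (range u).
  by split; [exists (u 0%N), 0%N | exists (v 0%N) => _ [k _ <-]].
exists (sup (range u)) => K; rewrite ler_distl; apply/andP; split.
  by apply: (ub_le_sup hs.2); exists K.
by apply: ge_sup; [case: hs | move=> _ [j _ <-]; exact: uv].
Qed.

Section BasisConstant.
Context {R : realType} {X : lmodType R} (nu : X -> R) (e : nat -> X).
Hypothesis nu_ge0 : forall x, 0 <= nu x.
Hypothesis nuZ : forall c x, nu (c *: x) = `|c| * nu x.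
Hypothesis nuD : forall x y, nu (x + y) <= nu x + nu y.
Hypothesis nu_complete : forall f : nat -> X, (forall n, nu (f n) <= 2 ^- n) ->
  exists F, nu (F - \sum_(i < n) f i) @[n --> \oo] --> 0.

Definition partial (c : nat -> R) n : X := \sum_(i < n) c i *: e i.

Definition expansion f c : Prop := nu (f - partial c n) @[n --> \oo] --> 0.

Hypothesis basis : forall f, exists! c, expansion f c.

Let nu0 : nu 0 = 0.
Proof. by rewrite -(scale0r 0) nuZ normr0 mul0r. Qed.

Let nuN x : nu (- x) = nu x.
Proof. by rewrite -scaleN1r nuZ normrN1 mul1r. Qed.

Let nuB x y : nu (x - y) <= nu x + nu y.
Proof. by rewrite -(nuN y). Qed.

Let nu_dist x y : nu (x - y) = nu (y - x).
Proof. by rewrite -opprB nuN. Qed.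

Let nu_tri z x y : nu (x - y) <= nu (x - z) + nu (z - y).
Proof. by rewrite -[X in nu X <= _](subrKA z). Qed.

Let nu_sum n (f : nat -> X) : nu (\sum_(i < n) f i) <= \sum_(i < n) nu (f i).
Proof.
elim: n => [|n IH]; first by rewrite !big_ord0 nu0.
by rewrite !big_ord_recr/= (le_trans (nuD _ _))// lerD2r.
Qed.

Lemma partialD c d n :
  partial (fun i => c i + d i) n = partial c n + partial d n.
Proof. by rewrite /partial -big_split/=; apply: eq_bigr => i _; rewrite scalerDl. Qed.

Lemma partialZ a c n : partial (fun i => a * c i) n = a *: partial c n.
Proof. by rewrite /partial scaler_sumr; apply: eq_bigr => i _; rewrite scalerA. Qed.

Let squeeze0 (u v : nat -> R) : (forall n, 0 <= u n <= v n) ->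
  v n @[n --> \oo] --> 0 -> u n @[n --> \oo] --> 0.
Proof.
move=> uv v0; apply: (@squeeze_cvgr _ _ _ _ (fun=> 0) v) => //.
  by near=> n; exact: uv.
exact: cvg_cst.
Unshelve. all: by end_near. Qed.

Lemma expansionD f g c d : expansion f c -> expansion g d ->
  expansion (f + g) (fun i => c i + d i).
Proof.
rewrite /expansion => hc hd.
have h : (fun n => nu (f - partial c n) + nu (g - partial d n)) @ \oo --> (0 : R).
  by rewrite -[0]addr0; exact: cvgD.
apply: (squeeze0 _ h) => n.
by rewrite nu_ge0 partialD opprD addrACA nuD.
Qed.

Lemma expansionZ a f c : expansion f c -> expansion (a *: f) (fun i => a * c i).
Proof.
rewrite /expansion => hc.
have h : (fun n => `|a| * nu (f - partial c n)) @ \oo --> (0 : R).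
  by rewrite -[0](mulr0 `|a|); exact: cvgMl_tmp.
apply: (squeeze0 _ h) => n.
by rewrite nu_ge0 partialZ -scalerBr nuZ lexx.
Qed.

(** Vectors whose expansion has partial sums of norm at most M; the object to which
    the category argument applies. Bounded partial sums, and not merely
    convergence, are needed to sum series of such vectors. *)
Definition bounded_exp (M : R) f : Prop :=
  exists2 c, expansion f c & forall n, nu (partial c n) <= M.

Lemma bounded_expD M M' f g : bounded_exp M f -> bounded_exp M' g ->
  bounded_exp (M + M') (f + g).
Proof.
move=> [c hc cM] [d hd dM]; exists (fun i => c i + d i); first exact: expansionD.
by move=> n; rewrite partialD (le_trans (nuD _ _))// lerD.
Qed.

Lemma bounded_expZ a M f : bounded_exp M f -> bounded_exp (`|a| * M) (a *: f).
Proof.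
move=> [c hc cM]; exists (fun i => a * c i); first exact: expansionZ.
by move=> n; rewrite partialZ nuZ ler_wpM2l.
Qed.

Lemma ex_bounded_exp f : exists M : nat, bounded_exp M%:R f.
Proof.
have [c [hc _]] := basis f.
have /cvgrPdist_lt/(_ 1 ltr01)[N _ hN] := hc.
pose A := \sum_(n < N) nu (partial c n) + (1 + nu f).
have A0 : 0 <= A by rewrite !addr_ge0// sumr_ge0.
have [M hM] : exists M : nat, A < M%:R by eexists; exact: truncnS_gt.
exists M; exists c => // n; apply: le_trans (ltW hM); rewrite /A.
have [nN|Nn] := ltnP n N.
  rewrite (bigD1 (Ordinal nN))//= -addrA lerDl !addr_ge0// sumr_ge0//.
have := hN n Nn; rewrite /= sub0r normrN ger0_norm// => h.
apply: (@le_trans _ _ (1 + nu f)); last by rewrite lerDr sumr_ge0.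
rewrite -[partial c n](subKr f) (le_trans (nuB _ _))// addrC.
by rewrite lerD2r ltW.
Qed.

(** Baire's theorem by hand: every vector has bounded partial sums for some
    integer bound, and if none of these countably many sets were dense in a
    ball, nested balls avoiding them one after the other would converge to a
    vector that has no bound. *)
Lemma ex_dense_ball : exists (M : nat) x (r : R), 0 < r /\ forall y, nu (y - x) <= r ->
  forall d : R, 0 < d -> exists2 g, bounded_exp M%:R g & nu (y - g) <= d.
Proof.
apply: contrapT => H.
have step (a : nat * (X * R)) : exists b : X * R, 0 < a.2.2 ->
    [/\ nu (b.1 - a.2.1) <= a.2.2 / 2, 0 < b.2, b.2 <= a.2.2 / 2 &
     forall g, bounded_exp a.1%:R g -> b.2 < nu (b.1 - g)].
  case: a => M [x r]/=; have [r0|] := ltP 0 r; last first.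
    by move=> /le_gtF r0; exists (x, r); rewrite r0.
  have r20 : 0 < r / 2 by rewrite divr_gt0.
  apply: contrapT => K; apply: H; exists M, x, (r / 2); split=> // y yx d d0.
  apply: contrapT => L; apply: K; exists (y, Num.min (r / 2) (d / 2)) => _ /=.
  split=> //; first by rewrite lt_min r20 divr_gt0.
    by rewrite ge_min lexx.
  move=> g gM; rewrite gt_min; apply/orP; right.
  rewrite ltNge; apply/negP => h; apply: L; exists g => //.
  by apply: (le_trans h); lra.
have [s hs] := choice step.
pose a := fix a n := if n is n'.+1 then s (n', a n') else (0 : X, 1 : R).
pose x n := (a n).1; pose r n := (a n).2.
have r0 n : 0 < r n.
  elim: n => [|n IH]; first by rewrite /r/=.
  by have [] := hs (n, a n) IH.
have xr n : nu (x n.+1 - x n) <= r n / 2 by have [] := hs (n, a n) (r0 n).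
have rr n : r n.+1 <= r n / 2 by have [] := hs (n, a n) (r0 n).
have far n g : bounded_exp n%:R g -> r n.+1 < nu (x n.+1 - g).
  by have [_ _ _] := hs (n, a n) (r0 n); apply.
have r2 n : r n <= 2 ^- n.
  elim: n => [|n IH]; first by rewrite /r/= expr0 invr1.
  by rewrite (le_trans (rr n))// exprSr invfM ler_pM2r.
have tele n k : nu (x (n + k)%N - x n) <= r n - r (n + k)%N.
  elim: k => [|k IH]; first by rewrite addn0 !subrr nu0.
  rewrite addnS (le_trans (nu_tri (x (n + k)%N) _ _))//.
  by have := xr (n + k)%N; have := rr (n + k)%N; lra.
have [|F hF] := nu_complete (f := fun n => x n.+1 - x n).
  by move=> n; rewrite (le_trans (xr n))// (le_trans _ (r2 n))//; have := r0 n; lra.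
have {}hF : nu (F - x n) @[n --> \oo] --> 0.
  have -> : (fun n => nu (F - x n)) =
      (fun n => nu (F - \sum_(i < n) (x i.+1 - x i))); last exact: hF.
  apply/funext => n; congr (nu (F - _)).
  by rewrite -(big_mkord xpredT (fun n => x n.+1 - x n)) telescope_sumr// subr0.
have near n : nu (F - x n) <= r n.
  rewrite leNgt; apply/negP => h.
  have d0 : 0 < nu (F - x n) - r n by rewrite subr_gt0.
  have /cvgrPdist_lt/(_ _ d0)[N _ hN] := hF.
  have := hN (n + N)%N (leq_addl _ _); rewrite /= sub0r normrN ger0_norm//.
  have := nu_tri (x (n + N)%N) F (x n); have := tele n N; have := r0 (n + N)%N; lra.
have [M hM] := ex_bounded_exp F.
by have := far _ _ hM; rewrite nu_dist ltNge near.
Qed.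

(** Translate the ball to the origin by taking differences of two approximations,
    at x + t y and x - t y, then rescale. *)
Lemma ex_dense_unit : exists2 M : R, 0 < M & forall (d : R) y, 0 < d -> nu y <= d ->
  exists2 g, bounded_exp (d * M) g & nu (y - g) <= d / 2.
Proof.
have [M [x [r [r0 H]]]] := ex_dense_ball.
(* The two approximations at scale r have bounds M, and their difference approximates
   2 t y. *)
exists (M%:R / r + 1) => [|d y d0 yd].
  by rewrite ltr_wpDl// divr_ge0// ltW.
pose t := r / d; have t0 : 0 < t by rewrite divr_gt0.
have dt : 0 < t * d / 2 by rewrite divr_gt0// mulr_gt0.
have tn : nu (t *: y) <= r by rewrite nuZ gtr0_norm// /t mulrAC ler_pdivrMr// ler_pM2l.
have [|g1 B1 h1] := H (x + t *: y) _ (t * d / 2) dt; first by rewrite addrC addKr.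
have [|g2 B2 h2] := H (x - t *: y) _ (t * d / 2) dt.
  by rewrite addrC addKr nuN.
pose g := (2 * t)^-1 *: (g1 - g2).
have t2 : 0 < 2 * t by rewrite mulr_gt0.
have K0 : `|(2 * t)^-1| = (2 * t)^-1 by rewrite gtr0_norm// invr_gt0.
exists g.
  have := bounded_expZ (2 * t)^-1 (bounded_expD B1 (bounded_expZ (-1) B2)).
  rewrite scaleN1r normrN1 mul1r K0 -/g => -[c hc cM]; exists c => // n.
  apply: (le_trans (cM n)).
  rewrite (_ : (2 * t)^-1 * (M%:R + M%:R) = d * (M%:R / r)); last by rewrite /t; field; rewrite !gt_eqF.
  by rewrite ler_pM2l// lerDl.
have -> : y - g = (2 * t)^-1 *: ((x + t *: y - g1) - (x - t *: y - g2)).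
  rewrite (_ : x + t *: y - g1 - (x - t *: y - g2) = (2 * t) *: y - (g1 - g2)).
    by rewrite scalerBr scalerA mulVf ?gt_eqF// scale1r.
  rewrite [x + _]addrC [x - t *: y]addrC (addrAC (t *: y)) (addrAC (- (t *: y))).
     rewrite [_ + x in X in _ - X]addrC addrKA opprD !opprK addrACA [- g1 + _]addrC.
  by rewrite opprB mulr_natl mulr2n scalerDl.
have i0 : 0 <= (2 * t)^-1 by rewrite invr_ge0 ltW.
rewrite nuZ K0 (le_trans (ler_wpM2l i0 (nuB _ _)))//.
apply: (@le_trans _ _ ((2 * t)^-1 * (t * d / 2 + t * d / 2))).
  by rewrite ler_wpM2l// lerD.
by rewrite le_eqVlt; apply/orP; left; apply/eqP; field; rewrite gt_eqF.
Qed.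

(** The open mapping argument. The vector y is the sum of a series of
    approximations g k of norms decreasing as 2^-k, with bounded expansions.
    Their coefficients are summable index by index, and the coefficients of y
    are the sums; the partial sums of y are controlled by splitting the series
    after K terms. *)
Lemma unit_bounded_exp : exists2 M : R, 0 < M & forall y, nu y <= 1 ->
  bounded_exp M y.
Proof.
have [M M0 H] := ex_dense_unit; exists (2 * M) => [|y y1]; first by rewrite mulr_gt0.
have step (a : nat * X) : exists g, nu a.2 <= 2 ^- a.1 ->
    bounded_exp (2 ^- a.1 * M) g /\ nu (a.2 - g) <= 2 ^- a.1.+1.
  case: a => n h /=; have [h1|h1] := pselect (nu h <= 2 ^- n).
    have [|g B Hg] := H (2 ^- n) h _ h1; first by rewrite invr_gt0 exprn_gt0.
    by exists g => _; split=> //; rewrite exprSr invfM.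
  by exists 0 => h2; case: h1.
have [G hG] := choice step.
pose h := fix h n := if n is n'.+1 then h n' - G (n', h n') else y.
pose g n := G (n, h n).
have hn n : nu (h n) <= 2 ^- n.
  elim: n => [|n IH]; first by rewrite /= expr0 invr1.
  by have [_] := hG (n, h n) IH.
have hsum n : h n = y - \sum_(k < n) g k.
  elim: n => [|n IH]; first by rewrite big_ord0 subr0.
  by rewrite big_ord_recr/= opprD addrA -IH.
have step2 n : exists c, expansion (g n) c /\ forall k, nu (partial c k) <= 2 ^- n * M.
  by have [[c c1 c2] _] := hG (n, h n) (hn n); exists c.
have [c hc] := choice step2.
have e0 i : 0 < nu (e i).
  rewrite lt_neqAle nu_ge0 andbT eq_sym; apply/eqP => ei0.
  have [c0 [_ uniq0]] := basis 0.
  have E a : expansion 0 (fun k => (k == i)%:R * a).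
    rewrite /expansion.
    have -> : (fun n => nu (0 - partial (fun k => (k == i)%:R * a) n)) = fun=> 0.
      apply/funext => n; rewrite sub0r nuN; apply/eqP; rewrite eq_le nu_ge0 andbT.
      apply: (le_trans (nu_sum _ (fun k => ((k == i)%:R * a) *: e k))).
      rewrite big1// => k _; rewrite nuZ.
      by have [->|ki] := eqVneq (k : nat) i; rewrite ?ei0 ?mulr0// mul0r normr0 mul0r.
    exact: cvg_cst.
  have := etrans (esym (uniq0 _ (E 0))) (uniq0 _ (E 1)).
  move=> /(congr1 (fun f => f i)); rewrite eqxx !mul1r => /eqP.
  by rewrite eq_sym oner_eq0.
have cb k i : `|c k i| * nu (e i) <= 2 ^- k * (2 * M).
  have [_ b] := hc k; rewrite -nuZ.
  have -> : c k i *: e i = partial (c k) i.+1 - partial (c k) i.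
    by rewrite /partial big_ord_recr/= addrAC subrr add0r.
  by rewrite (le_trans (nuB _ _))// mulr2n mulrDl mul1r mulrDr lerD.
have lim_i i : exists d, forall K,
    `|d - \sum_(k < K) c k i| * nu (e i) <= 2 ^- K * (4 * M).
  have [k|d hd] := @ex_limit R (fun K => \sum_(k < K) c k i) (2 * M / nu (e i)).
    rewrite big_ord_recr/= addrAC subrr add0r mulrAC ler_pdivlMr//.
    by rewrite [leRHS]mulrC; exact: cb.
  exists d => K; rewrite -ler_pdivlMr//; apply: le_trans (hd K) _.
  by rewrite le_eqVlt; apply/orP; left; apply/eqP; ring.
have [d hd] := choice lim_i.
have far K n j : nu (partial d n - \sum_(k < K) partial (c k) n) <=
    2 ^- K * (2 * M) - 2 ^- (K + j) * (2 * M) + n%:R * (2 ^- (K + j) * (4 * M)).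
  elim: j => [|j IH] in K *.
    rewrite addn0 subrr add0r.
    have -> : \sum_(k < K) partial (c k) n = partial (fun i => \sum_(k < K) c k i) n.
      by rewrite /partial exchange_big/=; apply: eq_bigr => i _; rewrite scaler_suml.
    rewrite /partial -sumrB.
    under eq_bigr do rewrite -scalerBl.
    apply: (le_trans (nu_sum _ (fun i => (d i - \sum_(k < K) c k i) *: e i))).
    rewrite mulr_natl -[X in _ *+ X](card_ord n) -sumr_const.
    by apply: ler_sum => i _; rewrite nuZ.
  have := IH K.+1; rewrite big_ord_recr/= addSnnS.
  have [_ /(_ n) h1] := hc K.
  have h2 : nu (partial d n - \sum_(k < K) partial (c k) n) <=
      nu (partial d n - (\sum_(k < K) partial (c k) n + partial (c K) n)) + nu (partial (c K) n).
    apply: le_trans (nuD _ _); rewrite opprD addrA subrK//.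
  have : 2 ^- K = 2 * 2 ^- K.+1 :> R by rewrite exprSr invfM mulrCA divff// mulr1.
  set a := 2 ^- K in h1 *; set b := 2 ^- K.+1; move=> E; move: h1; rewrite E => h1 h3.
  lra.
have tail K n : nu (partial d n - \sum_(k < K) partial (c k) n) <= 2 ^- K * (2 * M).
  rewrite leNgt; apply/negP => lt.
  set D := nu _ in lt.
  have D0 : 0 < D - 2 ^- K * (2 * M) by rewrite subr_gt0.
  have Q0 : 0 < (D - 2 ^- K * (2 * M)) / (n%:R * (4 * M) + 1).
    by rewrite divr_gt0// ltr_wpDl// mulr_ge0// mulr_ge0// ltW.
  have [|j _ hj] := @ex_expr_lt R 2^-1 _ _ Q0; first by apply/andP; split; lra.
  have := far K n j; rewrite -/D => hf.
  have P0 : 0 < n%:R * (4 * M) + 1 by rewrite ltr_wpDl// mulr_ge0// mulr_ge0// ltW.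
  move: hj; rewrite ltr_pdivlMr// exprVn => hj.
  have : 2 ^- (K + j) <= 2 ^- j :> R.
    by rewrite lef_pV2 ?posrE ?exprn_gt0// ler_eXn2l// ?leq_addl// ltr1n.
  have : 0 < 2 ^- (K + j) :> R by rewrite invr_gt0 exprn_gt0.
  set a := 2 ^- (K + j) in hf *; set b := 2 ^- j in hj * => a0 ab.
  have : n%:R * (4 * M) * a <= n%:R * (4 * M) * b by rewrite ler_wpM2l// mulr_ge0// mulr_ge0// ltW.
  have := mulr_gt0 a0 M0; have b0 := lt_le_trans a0 ab.
  lra.
exists d; last by move=> n; have := tail 0%N n; rewrite big_ord0 subr0 expr0 invr1 mul1r.
apply/cvgrPdist_lt => eps eps0.
have Q0 : 0 < eps / 2 / (1 + 2 * M) by rewrite !divr_gt0// ltr_wpDr// mulr_ge0// ltW.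
have [|K _ hK] := @ex_expr_lt R 2^-1 _ _ Q0; first by apply/andP; split; lra.
have sm J : (fun N => \sum_(k < J) nu (g k - partial (c k) N)) @ \oo --> (0 : R).
  elim: J => [|J IH].
    rewrite (_ : (fun _ => _) = fun=> 0); first exact: cvg_cst.
    by apply/funext => N; rewrite big_ord0.
  rewrite (_ : (fun _ => _) = (fun N => \sum_(k < J) nu (g k - partial (c k) N)) \+
     (fun N => nu (g J - partial (c J) N))).
    have Q : (0 : R) = 0 + 0 by rewrite addr0.
    rewrite [X in _ --> X]Q; apply: cvgD; [exact: IH | exact: (proj1 (hc J))].
  by apply/funext => N; rewrite /= big_ord_recr.
have e20 : 0 < eps / 2 by rewrite divr_gt0.
have /cvgrPdist_lt/(_ _ e20)[N _ hN] := sm K.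
exists N => // n /= Nn; have := hN n Nn.
rewrite !sub0r !normrN !ger0_norm ?sumr_ge0// => h1.
have h2 : nu (y - partial d n) <= nu (h K) +
    (\sum_(k < K) nu (g k - partial (c k) n) + 2 ^- K * (2 * M)).
  have -> : y - partial d n = h K + ((\sum_(k < K) (g k - partial (c k) n)) -
      (partial d n - \sum_(k < K) partial (c k) n)).
    rewrite hsum sumrB opprB addrA [_ - _ + _ in RHS]addrA subrK.
    by rewrite addrA subrK.
  apply: (le_trans (nuD _ _)); rewrite lerD2l (le_trans (nuB _ _))// lerD//.
  exact: (nu_sum K (fun k => g k - partial (c k) n)).
have := hn K; move: hK; rewrite ltr_pdivlMr ?ltr_wpDr ?mulr_ge0 ?(ltW M0)// exprVn.
move: h1 h2; set S := \sum_(k < K) nu _; set a := 2 ^- K; lra.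
Qed.

(** A finite sum is its own expansion, by uniqueness, so its partial sums are
    bounded by a constant times its norm; a term is a difference of two
    consecutive partial sums. *)
Theorem basis_constant : exists2 C : R, 0 < C & forall c n k, (k < n)%N ->
  `|c k| * nu (e k) <= C * nu (partial c n).
Proof.
have [M M0 H] := unit_bounded_exp.
exists (2 * M) => [|c n k kn]; first by rewrite mulr_gt0.
pose c' i := if (i < n)%N then c i else 0.
have pc j : (j <= n)%N -> partial c' j = partial c j.
  move=> jn; apply: eq_bigr => i _; rewrite /c' (leq_trans _ jn)//.
have pc' j : (n <= j)%N -> partial c' j = partial c n.
  move=> nj; rewrite /partial -(subnKC nj) big_split_ord/= [X in _ + X]big1 ?addr0.
    by apply: eq_bigr => i _; rewrite /c' ltn_ord.
  by move=> i _; rewrite /c' ltnNge leq_addr/= scale0r.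
set f := partial c n.
have ef : expansion f c'.
  apply/cvgrPdist_lt => eps eps0; exists n => // j /= nj.
  by rewrite pc'// subrr nu0 subr0 normr0.
have bound t j : nu f <= t -> 0 < t -> (j <= n)%N -> nu (partial c j) <= M * t.
  move=> ft t0 jn.
  have t1 : nu (t^-1 *: f) <= 1.
    by rewrite nuZ gtr0_norm ?invr_gt0// mulrC ler_pdivrMr// mul1r.
  have [c1 hc1 cM] := H _ t1.
  have [c2 [_ uniq]] := basis (t^-1 *: f).
  have E : c1 = (fun i => t^-1 * c' i).
    by rewrite -(uniq _ hc1) -(uniq _ (expansionZ t^-1 ef)).
  have := cM j; rewrite E partialZ nuZ gtr0_norm ?invr_gt0// pc//.
  by rewrite mulrC ler_pdivrMr.
have bound0 j : (j <= n)%N -> nu (partial c j) <= M * nu f.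
  move=> jn; rewrite leNgt; apply/negP => lt.
  pose t := nu (partial c j) / (2 * M) + nu f / 2.
  have tf : nu f < t.
    have : nu f < nu (partial c j) / M by rewrite ltr_pdivlMr// mulrC.
    rewrite /t invfM; lra.
  have t0 : 0 < t by exact: le_lt_trans tf.
  have := bound t j (ltW tf) t0 jn; rewrite /t mulrDr.
  have -> : M * (nu (partial c j) / (2 * M)) = nu (partial c j) / 2.
    by field; rewrite gt_eqF.
  lra.
rewrite -nuZ.
have -> : c k *: e k = partial c k.+1 - partial c k.
  by rewrite /partial big_ord_recr/= addrAC subrr add0r.
by rewrite (le_trans (nuB _ _))// -mulrA mulr_natl mulr2n lerD// bound0// ltnW.
Qed.
End BasisConstant.

(** * Coefficients of the packets of index 2^J - 1 *)

Section PacketCoefficients.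
Context {R : realType}.
Implicit Types (v : 'cV[R]_3) (P Q : {poly R}) (g : R -> R).
Local Notation B := (@transition_mx R).
Local Notation s := (Num.sqrt 3 : R).

(** The generating polynomial of the filter a_1. *)
Definition highpass : {poly R} :=
  ((1 + s) / 4)%:P - ((3 + s) / 4) *: 'X + ((3 - s) / 4) *: 'X^2 - ((1 - s) / 4) *: 'X^3.

(** Coefficient polynomials under one step of w_n |-> w_(2n+1). The entry of b at k
    is, up to the sign, that of a_1 at 1 - k; this reflection accounts for the
    sign here and for the translations by 2^J - 1 below. *)
Definition pack (P : {poly R}) : {poly R} := - highpass * (P \Po 'X^2).

Definition qpoly J : {poly R} := iter J pack 1.

Definition vpoly v : {poly R} := (v 0 0)%:P + v 1 0 *: 'X + v 2 0 *: 'X^2.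

Lemma vpoly_comp v Q : vpoly v \Po Q = (v 0 0)%:P + v 1 0 *: Q + v 2 0 *: Q ^+ 2.
Proof.
by rewrite /vpoly !comp_polyD comp_polyC !comp_polyZ expr2 comp_polyM !comp_polyX expr2.
Qed.

(** The even and odd coefficients of the product with the filter are the images
    under B_0 and B_1: this is how the transition matrices arise from the
    filter. *)
Lemma vpoly_split v : - highpass * vpoly v =
  - (vpoly (B 0 *m v) \Po 'X^2 + 'X * (vpoly (B 1 *m v) \Po 'X^2)).
Proof.
rewrite (vec3P v) mul_B0 mul_B1 !vpoly_comp /vpoly !vec3E /highpass.
by rewrite -!mul_polyC !(polyCD, polyCN, polyCM); ring.
Qed.

Lemma qpoly_split J v : qpoly J.+1 * vpoly v =
  - ((qpoly J * vpoly (B 0 *m v)) \Po 'X^2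
     + 'X * ((qpoly J * vpoly (B 1 *m v)) \Po 'X^2)).
Proof.
rewrite /qpoly iterS /pack mulrAC vpoly_split !comp_polyM; ring.
Qed.

Lemma coef_even P Q i : (P \Po 'X^2 + 'X * (Q \Po 'X^2))`_i.*2 = P`_i.
Proof.
rewrite coefD coefXM !coef_comp_poly_Xn// -muln2 dvdn_mull// mulnK//.
case: i => [|i]; first by rewrite mul0n addr0.
by rewrite muln2 doubleS/= dvdn2/= odd_double addr0.
Qed.

Lemma coef_odd P Q i : (P \Po 'X^2 + 'X * (Q \Po 'X^2))`_i.*2.+1 = Q`_i.
Proof.
rewrite coefD coefXM !coef_comp_poly_Xn// dvdn2/= odd_double add0r.
by rewrite dvdn2 odd_double/= -muln2 mulnK.
Qed.

Lemma sum_parity (f : nat -> R) n :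
  \sum_(i < n.*2) f i = \sum_(i < n) f i.*2 + \sum_(i < n) f i.*2.+1.
Proof.
elim: n => [|n IH]; first by rewrite !big_ord0 addr0.
by rewrite doubleS !big_ord_recr/= IH addrACA -addrA.
Qed.

Lemma coef_vpoly v i : (vpoly v)`_i = if (i < 3)%N then v (inord i) 0 else 0.
Proof.
rewrite /vpoly !coefD !coefZ coefC coefX coefXn.
case: i => [|[|[|i]]] /=; rewrite ?mulr0 ?mulr1 ?addr0 ?add0r//;
  by congr (v _ _); apply: val_inj; rewrite /= inordK.
Qed.

(** Each step sorts the coefficients into even and odd ones, which follow the
    letters 0 and 1. The factor [vpoly v] makes the induction on words
    possible. *)
Lemma qpoly_lpow q J v :
  \sum_(i < 3 * 2 ^ J) `|(qpoly J * vpoly v)`_i| `^ q = wsum q J v.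
Proof.
elim: J v => [|J IH] v.
  rewrite expn0 muln1 /qpoly/= mul1r /wsum/= /lpow; apply: eq_bigr => i _.
  by rewrite coef_vpoly ltn_ord inord_val.
rewrite expnS mulnCA mul2n.
rewrite (sum_parity (fun i => `|(qpoly J.+1 * vpoly v)`_i| `^ q)) wsumS -!IH.
by congr (_ + _); apply: eq_bigr => i _; rewrite qpoly_split coefN normrN ?coef_even ?coef_odd.
Qed.

Lemma qpoly_vanish J v i : (3 * 2 ^ J <= i)%N -> (qpoly J * vpoly v)`_i = 0.
Proof.
elim: J v i => [|J IH] v i.
  by rewrite expn0 muln1 /qpoly/= mul1r coef_vpoly leqNgt => /negbTE ->.
rewrite expnS mulnCA mul2n => h.
rewrite qpoly_split coefN -[i]odd_double_half.
have h2 : (3 * 2 ^ J <= i./2)%N by rewrite -[leqLHS]doubleK half_leq.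
by case: (odd i); rewrite ?add1n ?add0n ?coef_odd ?coef_even IH// oppr0.
Qed.

Lemma vpoly_e3 : vpoly (e3 0) = 1.
Proof.
by rewrite /vpoly /e3 !mxE /= !scale0r !addr0.
Qed.

Lemma qpoly_sum q J : \sum_(i < 3 * 2 ^ J) `|(qpoly J)`_i| `^ q = wsum q J (e3 0).
Proof. by rewrite -qpoly_lpow vpoly_e3 mulr1. Qed.

Lemma size_qpoly J : (size (qpoly J) <= 3 * 2 ^ J)%N.
Proof.
by apply/leq_sizeP => i h; rewrite -[qpoly J]mulr1 -vpoly_e3 qpoly_vanish.
Qed.

Definition comb g P (x : R) : R := \sum_(i < size P) P`_i * g (x + i%:R).

Lemma comb_wide g P N x : (size P <= N)%N ->
  comb g P x = \sum_(i < N) P`_i * g (x + i%:R).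
Proof.
move=> h; rewrite /comb (big_ord_widen _ (fun i => P`_i * g (x + i%:R)) h).
rewrite big_mkcond/=; apply: eq_bigr => i _; case: ltnP => // hi.
by rewrite nth_default// mul0r.
Qed.

Lemma combD g P Q x : comb g (P + Q) x = comb g P x + comb g Q x.
Proof.
rewrite (@comb_wide _ _ (maxn (size P) (size Q)) _ (size_polyD _ _)).
rewrite (@comb_wide _ P _ _ (leq_maxl _ (size Q))).
rewrite (@comb_wide _ Q _ _ (leq_maxr (size P) _)) -big_split/=.
by apply: eq_bigr => i _; rewrite coefD mulrDl.
Qed.

Lemma combZ g c P x : comb g (c *: P) x = c * comb g P x.
Proof.
rewrite (@comb_wide _ _ _ _ (size_scale_leq c P)) /comb mulr_sumr.
by apply: eq_bigr => i _; rewrite coefZ mulrA.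
Qed.

Lemma comb0 g x : comb g 0 x = 0.
Proof. by rewrite /comb size_poly0 big_ord0. Qed.

Lemma combMX g P x : comb g (P * 'X) x = comb g P (x + 1).
Proof.
have h : (size (P * 'X)%R <= (size P).+1)%N.
  by rewrite (leq_trans (size_polyMleq _ _))// size_polyX addn2.
rewrite (comb_wide _ _ h) big_ord_recl coefMX/= mul0r add0r.
apply: eq_bigr => i _; rewrite coefMX/= /bump/= add1n.
by rewrite -natr1 [i%:R + 1]addrC addrA.
Qed.

Lemma combC g c x : comb g c%:P x = c * g x.
Proof.
by rewrite (@comb_wide _ _ 1 _ (size_polyC_leq1 _)) big_ord1 coefC addr0.
Qed.

Lemma subdivideE (c : int -> R) (l : seq int) g x : uniq l ->
  (forall k, k \notin l -> c k = 0) ->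
  subdivide c g x = \sum_(k <- l) c k * g (2 * x - k%:~R).
Proof.
move=> ul cl; rewrite /subdivide (fsbigE l)//.
  by rewrite big_mkcond/=; apply: eq_bigr => k _; rewrite in_setT.
by move=> k _ /cl ->; rewrite mul0r.
Qed.

Lemma subdivide_a0 g x : subdivide a0 g x =
  (1 + s) / 4 * g (2 * x) + (3 + s) / 4 * g (2 * x - 1) +
  (3 - s) / 4 * g (2 * x - 2) + (1 - s) / 4 * g (2 * x - 3).
Proof.
rewrite (@subdivideE _ [:: 0; 1; 2; 3])//; last by move=> [[|[|[|[|k]]]]|k].
by rewrite !big_cons big_nil /= addr0 !addrA subr0.
Qed.

Lemma b_values : [/\ @b R 1 = - ((1 + s) / 4), @b R 0 = (3 + s) / 4,
  @b R (- 1) = - ((3 - s) / 4) & @b R (- 2) = (1 - s) / 4].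
Proof.
split; rewrite /b.
- by rewrite expr1z mulN1r.
- by rewrite expr0z mul1r.
- by rewrite exprN1 invrN1 mulN1r.
- rewrite (_ : (-1) ^ (-2) = ((-1) ^+ 2)^-1 :> R)//.
  by rewrite sqrrN expr1n invr1 mul1r.
Qed.

Lemma b_vanish k : k \notin [:: 1; 0; - 1; - 2] -> @b R k = 0.
Proof.
rewrite !inE !negb_or => /and4P[k1 k2 k3 k4]; rewrite /b.
suff -> : @a0 R (1 - k) = 0 by rewrite mulr0.
have : [&& 1 - k != 0, 1 - k != 1, 1 - k != 2 & 1 - k != 3].
  by apply/and4P; split; apply/eqP => h; [move: k1|move: k2|move: k3|move: k4];
    rewrite -[k](opprK k) -[- k](addKr 1) h.
by case: (1 - k) => [[|[|[|[|j]]]]|j].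
Qed.

Lemma subdivide_b g x : subdivide b g x =
  (1 - s) / 4 * g (2 * x + 2) - (3 - s) / 4 * g (2 * x + 1) +
  (3 + s) / 4 * g (2 * x) - (1 + s) / 4 * g (2 * x - 1).
Proof.
have [b1 b0 bm1 bm2] := b_values.
rewrite (@subdivideE _ [:: 1; 0; - 1; - 2])//; last exact: b_vanish.
rewrite !big_cons big_nil b1 b0 bm1 bm2 /= addr0 subr0.
have -> : (- 1)%:~R = - 1 :> R by [].
have -> : (- 2)%:~R = - 2 :> R by [].
by rewrite !opprK; ring.
Qed.

(** Both sides are linear in P and compatible with the substitution x + 1 for x,
    which multiplies P by X on the left and by X^2 on the right. *)
Lemma comb_pack g P x :
  comb (subdivide b g) P x = comb g (pack P) (2 * x - 1).
Proof.
have combN Q y : comb g (- Q) y = - comb g Q y by rewrite -scaleN1r combZ mulN1r.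
have combM2 Q y : comb g (Q * 'X^2) y = comb g Q (y + 2).
  by rewrite expr2 mulrA !combMX -addrA.
elim/poly_ind: P x => [|P c IH] x.
  by rewrite /pack comp_poly0 mulr0 !comb0.
rewrite combD combMX IH combC /pack comp_polyD comp_polyM comp_polyX comp_polyC.
rewrite [- highpass * (_ + _)]mulrDr mulrA combD combM2; congr (_ + _).
  by congr (comb g _ _); ring.
rewrite [_ * c%:P]mulrC mul_polyC combZ; congr (_ * _).
rewrite combN /highpass !combD !combN !combZ combC.
have cX y : comb g 'X y = g (y + 1).
  by rewrite -[X in comb _ X]mul1r combMX -polyC1 combC mul1r.
have cX2 y : comb g 'X^2 y = g (y + 2).
  by rewrite -[X in comb _ X]mul1r combM2 -polyC1 combC mul1r.
have cX3 y : comb g 'X^3 y = g (y + 2 + 1) by rewrite exprS combM2 cX.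
rewrite cX cX2 cX3 subdivide_b.
rewrite (_ : 2 * x - 1 + 1 = 2 * x); last by ring.
rewrite (_ : 2 * x - 1 + 2 = 2 * x + 1); last by ring.
rewrite (_ : 2 * x + 1 + 1 = 2 * x + 2); last by ring.
by ring.
Qed.

End PacketCoefficients.

(** * Expansions of dyadic translates in wavelet packets *)

Section PacketRepresentation.
Context {R : realType} (phi : R -> R).
Local Notation s := (Num.sqrt 3 : R).
Implicit Types (f g : R -> R) (x z : R).

(** The indices 2^J - 1 are those whose J binary digits are all 1: only the
    high-pass filter is used. *)
Lemma packet_comb J P x : comb (wpacket phi (2 ^ J - 1)) P x =
  comb phi (iter J pack P) (2 ^+ J * x - (2 ^+ J - 1)).
Proof.
elim: J P x => [|J IH] P x; first by rewrite subnn expr0 mul1r subrr subr0.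
have -> : (2 ^ J.+1 - 1 = (2 * (2 ^ J - 1)).+1)%N.
  by rewrite expnS mulnBr muln1 -subSn// -{1}(expn1 2) -expnS leq_exp2l.
rewrite wpacket_odd comb_pack IH iterSr; congr (comb _ _ _).
by rewrite exprS; ring.
Qed.

(** Perfect reconstruction from the orthogonality relations of the filter; with
    the next lemma, it inverts the passage from level 1 to level 0. *)
Lemma reconstruct_even g z : g (2 * z) = 2^-1 *
  ((1 + s) / 4 * subdivide a0 g z + (3 - s) / 4 * subdivide a0 g (z + 1)
   + (3 + s) / 4 * subdivide b g z + (1 - s) / 4 * subdivide b g (z - 1)).
Proof.
rewrite !subdivide_a0 !subdivide_b.
rewrite (_ : 2 * (z + 1) - 1 = 2 * z + 1); last by ring.
rewrite (_ : 2 * (z + 1) - 2 = 2 * z); last by ring.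
rewrite (_ : 2 * (z + 1) - 3 = 2 * z - 1); last by ring.
rewrite (_ : 2 * (z + 1) = 2 * z + 2); last by ring.
rewrite (_ : 2 * (z - 1) + 2 = 2 * z); last by ring.
rewrite (_ : 2 * (z - 1) + 1 = 2 * z - 1); last by ring.
rewrite (_ : 2 * (z - 1) - 1 = 2 * z - 3); last by ring.
rewrite (_ : 2 * (z - 1) = 2 * z - 2); last by ring.
by have ss := @sqrt3_sq R; field: ss.
Qed.

Lemma reconstruct_odd g z : g (2 * z - 1) = 2^-1 *
  ((3 + s) / 4 * subdivide a0 g z + (1 - s) / 4 * subdivide a0 g (z + 1)
   - (1 + s) / 4 * subdivide b g z - (3 - s) / 4 * subdivide b g (z - 1)).
Proof.
rewrite !subdivide_a0 !subdivide_b.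
rewrite (_ : 2 * (z + 1) - 1 = 2 * z + 1); last by ring.
rewrite (_ : 2 * (z + 1) - 2 = 2 * z); last by ring.
rewrite (_ : 2 * (z + 1) - 3 = 2 * z - 1); last by ring.
rewrite (_ : 2 * (z + 1) = 2 * z + 2); last by ring.
rewrite (_ : 2 * (z - 1) + 2 = 2 * z); last by ring.
rewrite (_ : 2 * (z - 1) + 1 = 2 * z - 1); last by ring.
rewrite (_ : 2 * (z - 1) - 1 = 2 * z - 3); last by ring.
rewrite (_ : 2 * (z - 1) = 2 * z - 2); last by ring.
by have ss := @sqrt3_sq R; field: ss.
Qed.

(** Points from which the refinement equation is valid at all dyadic affine
    images. Identities between packets hold exactly at these points, which
    allows finite algebraic manipulations before passing to almost every
    point. *)
Definition refined x := forall (j : nat) (l : int),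
  phi (2 ^+ j * x - l%:~R) = subdivide a0 phi (2 ^+ j * x - l%:~R).

Lemma wpacket_even_refined n x j (l : int) : refined x ->
  wpacket phi (2 * n) (2 ^+ j * x - l%:~R) =
  subdivide a0 (wpacket phi n) (2 ^+ j * x - l%:~R).
Proof.
case: n => [|n] hx; last by rewrite wpacket_even.
by rewrite muln0 wpacket0 hx.
Qed.

Definition term := (R * (nat * int))%type.
Definition lincomb (r : seq term) x :=
  \sum_(t <- r) t.1 * wpacket phi t.2.1 (x - t.2.2%:~R).
Definition coefat (r : seq term) (k : nat * int) : R := \sum_(t <- r | t.2 == k) t.1.
Definition scaleterms c (r : seq term) : seq term := [seq (c * t.1, t.2) | t <- r].

Lemma lincomb_cat r1 r2 x : lincomb (r1 ++ r2) x = lincomb r1 x + lincomb r2 x.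
Proof. by rewrite /lincomb big_cat. Qed.

Lemma lincomb_scale c r x : lincomb (scaleterms c r) x = c * lincomb r x.
Proof. by rewrite /lincomb big_map mulr_sumr; apply: eq_bigr => t _; rewrite mulrA. Qed.

Lemma coefat_cat r1 r2 k : coefat (r1 ++ r2) k = coefat r1 k + coefat r2 k.
Proof. by rewrite /coefat big_cat. Qed.

Lemma coefat_scale c r k : coefat (scaleterms c r) k = c * coefat r k.
Proof. by rewrite /coefat big_map mulr_sumr. Qed.

(** An expansion of f whose packet indices satisfy D. Knowing D tells that a
    representation does not involve a packet whose index is outside D, and
    hence contributes nothing to the coefficient at k. *)
Definition represents (D : pred nat) (k : nat * int) (f : R -> R) (q : R) :=
  exists r : seq term, [/\ forall x, refined x -> f x = lincomb r x,
    all (fun t => D t.2.1) r & coefat r k = q].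

Lemma representsD D k f g p q : represents D k f p -> represents D k g q ->
  represents D k (fun x => f x + g x) (p + q).
Proof.
move=> [r [hf Dr hr]] [r' [hg Dr' hr']]; exists (r ++ r'); split.
- by move=> x hx; rewrite lincomb_cat hf// hg.
- by rewrite all_cat Dr.
- by rewrite coefat_cat hr hr'.
Qed.

Lemma representsZ D k f p c : represents D k f p ->
  represents D k (fun x => c * f x) (c * p).
Proof.
move=> [r [hf Dr hr]]; exists (scaleterms c r); split.
- by move=> x hx; rewrite lincomb_scale hf.
- by rewrite all_map.
- by rewrite coefat_scale hr.
Qed.

Lemma represents_sub (D D' : pred nat) k f p : {subset D <= D'} ->
  represents D k f p -> represents D' k f p.
Proof.
move=> DD' [r [hf Dr hr]]; exists r; split=> //.
by apply: sub_all Dr => t; exact: DD'.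
Qed.

Lemma represents_off (D : pred nat) k k' f p : ~~ D k'.1 ->
  represents D k f p -> represents D k' f 0.
Proof.
move=> Dk' [r [hf Dr _]]; exists r; split=> //.
rewrite /coefat big_seq_cond big1// => t /andP[tr /eqP tk].
by move/allP: Dr => /(_ _ tr); rewrite tk (negbTE Dk').
Qed.

Lemma represents_ext D k f g p : (forall x, refined x -> g x = f x) ->
  represents D k f p -> represents D k g p.
Proof.
by move=> gf [r [hf Dr hr]]; exists r; split=> // x hx; rewrite gf// hf.
Qed.

Definition coefz (P : {poly R}) (m : int) : R := if m is Posz k then P`_k else 0.

Lemma pack_parity P : pack P =
  - ((((1 + s) / 4) *: P + ((3 - s) / 4) *: ('X * P)) \Po 'X^2
     + 'X * ((- ((3 + s) / 4) *: P - ((1 - s) / 4) *: ('X * P)) \Po 'X^2)).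
Proof.
rewrite /pack /highpass comp_polyD comp_polyB !comp_polyZ !comp_polyM !comp_polyX.
rewrite -!mul_polyC !(polyCD, polyCN, polyCM); ring.
Qed.

Lemma coefz_XM P (i : int) : coefz ('X * P) i = coefz P (i - 1).
Proof.
case: i => [[|k]|k] //; first by rewrite /= coefXM.
by rewrite /coefz intS addrC addKr coefXM.
Qed.

Lemma coefz_lin a c P Q i : coefz (a *: P + c *: Q) i = a * coefz P i + c * coefz Q i.
Proof. by case: i => k /=; rewrite ?mulr0 ?addr0// coefD !coefZ. Qed.

Lemma coefz_even P Q (i : int) :
  coefz (- (P \Po 'X^2 + 'X * (Q \Po 'X^2))) (2 * i) = - coefz P i.
Proof.
case: i => k; last by rewrite NegzE mulrN -PoszM mul2n doubleS /= oppr0.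
by rewrite -PoszM mul2n /= coefN coef_even.
Qed.

Lemma coefz_odd P Q (i : int) :
  coefz (- (P \Po 'X^2 + 'X * (Q \Po 'X^2))) (2 * i + 1) = - coefz Q i.
Proof.
case: i => k; last first.
  rewrite (_ : 2 * Negz k + 1 = Negz (k.*2)) ?oppr0//.
  by rewrite !NegzE !intS -addnn PoszD; ring.
by rewrite -PoszM mul2n -PoszD addn1 /= coefN coef_odd.
Qed.

Lemma coefz_pack_odd P (i : int) : coefz (pack P) (2 * i + 1) =
  (3 + s) / 4 * coefz P i + (1 - s) / 4 * coefz P (i - 1).
Proof.
rewrite pack_parity coefz_odd -(scaleNr _ ('X * P)) coefz_lin coefz_XM; ring.
Qed.

Lemma coefz_pack_even P (i : int) : coefz (pack P) (2 * i) =
  - ((1 + s) / 4) * coefz P i - (3 - s) / 4 * coefz P (i - 1).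
Proof.
rewrite pack_parity coefz_even coefz_lin coefz_XM; ring.
Qed.

Lemma int_parity (m : int) : exists i : int, m = 2 * i \/ m = 2 * i + 1.
Proof.
exists (m %/ 2)%Z; have := divz_eq m 2; have := modz_ge0 m (isT : (2 : int) != 0).
have := ltz_pmod m (isT : 0 < (2 : int)).
case: (m %% 2)%Z => [[|[|k]]|k] // _ _ e; [left|right]; by rewrite [LHS]e mulrC ?addr0.
Qed.

Let D J n : pred nat := fun k => (k %/ 2 ^ J == n)%N.
Let top J n : nat * int := ((n.+1 * 2 ^ J).-1, 0 : int)%N.

(** Induction on the number of scales: w_n (2 y) and w_n (2 y - 1) involve w_(2n)
    and w_(2n+1), and only the latter leads to the index with all further
    digits equal to 1. The coefficients that accumulate are those of
    [pack], up to the factor 1/2 of the reconstruction formula. *)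
Lemma packet_represents J n (m : int) : represents (D J n) (top J n)
  (fun x => wpacket phi n (2 ^+ J * x - (2 ^+ J - 1) + m%:~R))
  (2 ^- J * coefz (qpoly J) m).
Proof.
elim: J n m => [|J IH] n m.
  exists [:: (1, (n, - m))]; split.
  - move=> x _; rewrite /lincomb big_seq1 /= mul1r expr0 mul1r subrr subr0.
    by rewrite mulrNz opprK.
  - by rewrite /= /D expn0 divn1 eqxx.
  - rewrite /coefat big_mkcond big_seq1 /top expn0 muln1 /= xpair_eqE eqxx/= oppr_eq0.
    rewrite expr0 invr1 mul1r /qpoly/=; case: m => [[|m]|m] //=.
      by rewrite coef1.
    by rewrite coef1.
have sub2 : {subset D J (2 * n) <= D J.+1 n}.
  by move=> k; rewrite !unfold_in /D expnSr divnMA => /eqP ->; rewrite mulKn.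
have sub3 : {subset D J (2 * n).+1 <= D J.+1 n}.
  move=> k; rewrite !unfold_in /D expnSr divnMA => /eqP ->.
  by rewrite mul2n divn2 /= uphalf_double.
have topE : top J.+1 n = top J (2 * n).+1.
  by rewrite /top expnS mulnA [(n.+1 * 2)%N]mulnC mulnS.
have toff : ~~ D J (2 * n) (top J.+1 n).1.
  rewrite topE /D /top/=.
  have -> : (((2 * n).+2 * 2 ^ J).-1 = (2 * n).+1 * 2 ^ J + (2 ^ J).-1)%N.
    by rewrite mulSn addnC -!subn1 addnBA// expn_gt0.
  have small : ((2 ^ J).-1 < 2 ^ J)%N by rewrite prednK// expn_gt0.
  by rewrite divnMDl ?expn_gt0// divn_small// addn0 gtn_eqF.
have IHe i : represents (D J.+1 n) (top J.+1 n)
    (fun x => wpacket phi (2 * n) (2 ^+ J * x - (2 ^+ J - 1) + i%:~R)) 0.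
  by apply: represents_sub sub2 _; apply: represents_off toff (IH _ _).
have IHo i : represents (D J.+1 n) (top J.+1 n)
    (fun x => wpacket phi (2 * n).+1 (2 ^+ J * x - (2 ^+ J - 1) + i%:~R))
    (2 ^- J * coefz (qpoly J) i).
  by apply: represents_sub sub3 _; rewrite topE; exact: IH.
pose y x := 2 ^+ J * x - (2 ^+ J - 1).
have yl x (i : int) : y x + i%:~R = 2 ^+ J * x - ((2 ^ J)%:Z - 1 - i)%:~R.
  by rewrite /y !rmorphB/= -pmulrn natrX; ring.
have Ae x i : refined x -> subdivide a0 (wpacket phi n) (y x + i%:~R) =
    wpacket phi (2 * n) (y x + i%:~R).
  by move=> hx; rewrite yl wpacket_even_refined.
have [i [->|->]] := int_parity m.
- have IH0 := representsZ ((3 + s) / 4) (IHe i).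
  have IH1 := representsZ ((1 - s) / 4) (IHe (i + 1)).
  have IH2 := representsZ (- ((1 + s) / 4)) (IHo i).
  have IH3 := representsZ (- ((3 - s) / 4)) (IHo (i - 1)).
  have := representsZ 2^-1 (representsD (representsD (representsD IH0 IH1) IH2) IH3).
  rewrite (_ : 2^-1 * _ = 2 ^- J.+1 * coefz (qpoly J.+1) (2 * i)); last first.
    by rewrite [qpoly J.+1]/(pack (qpoly J)) coefz_pack_even exprS invfM; ring.
  apply: represents_ext => x hx.
  have -> : 2 ^+ J.+1 * x - (2 ^+ J.+1 - 1) + (2 * i)%:~R = 2 * (y x + i%:~R) - 1.
    by rewrite /y exprS rmorphM/=; ring.
  rewrite reconstruct_odd Ae// -!wpacket_odd.
  rewrite (_ : y x + i%:~R + 1 = y x + (i + 1)%:~R); last by rewrite rmorphD/= addrA.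
  rewrite (_ : y x + i%:~R - 1 = y x + (i - 1)%:~R); last by rewrite rmorphB/= addrA.
  by rewrite Ae// /y; ring.
- have IH0 := representsZ ((1 + s) / 4) (IHe i).
  have IH1 := representsZ ((3 - s) / 4) (IHe (i + 1)).
  have IH2 := representsZ ((3 + s) / 4) (IHo i).
  have IH3 := representsZ ((1 - s) / 4) (IHo (i - 1)).
  have := representsZ 2^-1 (representsD (representsD (representsD IH0 IH1) IH2) IH3).
  rewrite (_ : 2^-1 * _ = 2 ^- J.+1 * coefz (qpoly J.+1) (2 * i + 1)); last first.
    by rewrite [qpoly J.+1]/(pack (qpoly J)) coefz_pack_odd exprS invfM; ring.
  apply: represents_ext => x hx.
  have -> : 2 ^+ J.+1 * x - (2 ^+ J.+1 - 1) + (2 * i + 1)%:~R = 2 * (y x + i%:~R).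
    by rewrite /y exprS rmorphD rmorphM/=; ring.
  rewrite reconstruct_even Ae// -!wpacket_odd.
  rewrite (_ : y x + i%:~R + 1 = y x + (i + 1)%:~R); last by rewrite rmorphD/= addrA.
  rewrite (_ : y x + i%:~R - 1 = y x + (i - 1)%:~R); last by rewrite rmorphB/= addrA.
  by rewrite Ae// /y; ring.
Qed.

End PacketRepresentation.

(** * Affine changes of variable in Lebesgue integrals *)

Section AffineChange.
Context {R : realType}.
Local Notation mu := (@lebesgue_measure R).

Definition affine (a c : R) (x : measurableTypeR R) : measurableTypeR R := a * x - c.

Lemma measurable_affine (a c : R) : measurable_fun [set: measurableTypeR R] (affine a c).
Proof.
apply: measurable_funB; last exact: measurable_cst.
by apply: measurable_funM; [exact: measurable_cst|exact: measurable_id].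
Qed.

HB.instance Definition _ a c := isMeasurableFun.Build _ _ _ _ (affine a c)
  (measurable_affine a c).

(** The pushforward of Lebesgue measure by the affine map, multiplied by its
    slope; the uniqueness theorem will identify it with Lebesgue measure. *)
Lemma ex_affine_image (a c : R) : 0 <= a ->
  exists m : {measure set (measurableTypeR R) -> \bar R},
    (forall A, m A = (a%:E * mu (affine a c @^-1` A))%E) /\
    forall f : R -> \bar R, measurable_fun [set: measurableTypeR R] f ->
      (forall x, 0 <= f x)%E ->
      (\int[m]_x f x = a%:E * \int[mu]_x f (a * x - c)%R)%E.
Proof.
move=> a0; pose m := mscale (NngNum a0) (pushforward mu (affine a c)).
exists (m (measurable_affine a c)); split=> // f mf f0.
rewrite ge0_integral_mscale// ge0_integral_pushforward//.
Qed.

(** The two measures agree on half-open intervals. *)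
Lemma lebesgue_affine (a c : R) (A : set (measurableTypeR R)) : 0 < a -> measurable A ->
  mu A = (a%:E * mu (affine a c @^-1` A))%E.
Proof.
move=> a0 mA; have [m [mE _]] := ex_affine_image c (ltW a0); rewrite -mE.
move: A mA; apply: lebesgue_measure_unique => _ [[u v] _ <-]/=.
rewrite mE (_ : affine a c @^-1` `]u, v]%classic = `](u + c) / a, (v + c) / a]%classic); last first.
  apply/seteqP; split=> x /=; rewrite !in_itv/= /affine ltr_pdivrMr// ler_pdivlMr// (mulrC x).
    by rewrite ltrBrDr lerBlDr.
  by rewrite ltrBrDr lerBlDr.
rewrite !lebesgue_measure_itv/= !lte_fin ltr_pM2r ?invr_gt0// ltrD2r.
case: ifPn => _; last by rewrite mule0.
by rewrite -!EFinB -EFinM -mulrBl opprD addrACA subrr addr0 mulrCA divff ?mulr1// gt_eqF.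
Qed.

Lemma ge0_integral_affine (a c : R) (f : R -> \bar R) : 0 < a ->
  measurable_fun [set: measurableTypeR R] f -> (forall x, 0 <= f x)%E ->
  (\int[mu]_x f (a * x - c)%R = a^-1%:E * \int[mu]_x f x)%E.
Proof.
move=> a0 mf f0; have [m [mE mI]] := ex_affine_image c (ltW a0).
have -> : (\int[mu]_x f x = \int[m]_x f x)%E.
  by apply: eq_measure_integral => A mA _; rewrite mE; exact: lebesgue_affine.
by rewrite mI// muleA -EFinM mulVf ?gt_eqF// mul1e.
Qed.

Lemma negligible_affine (a c : R) (A : set R) : 0 < a ->
  mu.-negligible A -> mu.-negligible [set x | A (a * x - c)].
Proof.
move=> a0 [N [mN N0 AN]]; exists (affine a c @^-1` N); split.
- by rewrite -[X in measurable X]setTI; exact: measurable_affine.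
- apply/eqP; have := lebesgue_affine c a0 mN; rewrite N0 => /esym/eqP.
  by rewrite mule_eq0 eqe gt_eqF.
- by move=> x /= /AN.
Qed.

End AffineChange.

(** * Norms of combinations of integer translates *)

Section Overlap.
Context {R : realType}.

Lemma card_near (K D i0 : nat) :
  (\sum_(j < K) ((i0 <= j + D) && (j <= i0 + D)) <= 2 * D + 1)%N.
Proof.
rewrite -(big_mkord xpredT (fun j => nat_of_bool ((i0 <= j + D) && (j <= i0 + D))%N)).
rewrite /index_iota subn0; set P := fun j => ((i0 <= j + D) && (j <= i0 + D))%N.
have -> : (\sum_(j <- iota 0 K) nat_of_bool (P j) = size [seq j <- iota 0 K | P j])%N.
  by rewrite size_filter -sum1_count [RHS]big_mkcond; apply: eq_bigr => j _; case: (P j).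
rewrite -(size_iota (i0 - D) (2 * D + 1)); apply: uniq_leq_size.
  exact/filter_uniq/iota_uniq.
move=> j; rewrite mem_filter !mem_iota => /andP[+ _]; rewrite /P => /andP[h1 h2]; apply/andP; split.
  by rewrite leq_subLR addnC.
rewrite addnA addn1 ltnS (leq_trans h2)// mul2n -addnn addnA leq_add2r.
by rewrite addnC -leq_subLR.
Qed.

Lemma sum_near_le (K D i0 : nat) (F : nat -> R) (A : R) :
  0 <= A -> (forall j, F j <= A) ->
  (forall j, F j != 0 -> (i0 <= j + D)%N && (j <= i0 + D)%N) ->
  \sum_(j < K) F j <= (2 * D + 1)%:R * A.
Proof.
move=> A0 FA Fn.
apply: (@le_trans _ _ (\sum_(j < K) (nat_of_bool ((i0 <= j + D) && (j <= i0 + D))%N)%:R * A)).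
  apply: ler_sum => j _; have [->|/Fn ->] := eqVneq (F j) 0; last by rewrite mul1r.
  by rewrite mulr_ge0.
by rewrite -mulr_suml -natr_sum ler_wpM2r// ler_nat card_near.
Qed.

(** At most 2 D + 1 terms are nonzero, each of them at most the largest one. *)
Lemma overlap_powR (q : R) (K D : nat) (z : nat -> R) : 0 < q ->
  (forall i j, z i != 0 -> z j != 0 -> (i <= j + D)%N) ->
  `|\sum_(i < K) z i| `^ q <= (2 * D + 1)%:R `^ q * \sum_(i < K) `|z i| `^ q.
Proof.
move=> q0 zD; have S0 : 0 <= \sum_(i < K) `|z i| `^ q.
  by apply: sumr_ge0 => i _; exact: powR_ge0.
case: K S0 => [|K] S0.
  by rewrite !big_ord0 normr0 powR0 ?gt_eqF// mulr0.
have [i0 _ hi0] := @arg_maxP _ _ 'I_K.+1 ord0 xpredT (fun i => `|z i|) isT.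
have [zi0|zi0] := eqVneq (z i0) 0.
  rewrite big1 ?normr0 ?powR0 ?gt_eqF// ?mulr_ge0 ?powR_ge0// => i _.
  by apply/eqP; rewrite -normr_le0 (le_trans (hi0 i isT))// zi0 normr0.
apply: (@le_trans _ _ (((2 * D + 1)%:R * `|z i0|) `^ q)).
  apply: ge0_ler_powR; rewrite ?nnegrE ?mulr_ge0 ?(ltW q0)//.
  apply: (le_trans (ler_norm_sum _ _ _)).
  pose F j := if (j < K.+1)%N then `|z j| else 0.
  apply: (@le_trans _ _ (\sum_(j < K.+1) F j)).
    by apply: ler_sum => j _; rewrite /F ltn_ord.
  apply: (@sum_near_le K.+1 D i0 F) => // j; rewrite /F; case: ltnP => jK; rewrite ?eqxx//.
    exact: (hi0 (Ordinal jK)).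
  by rewrite normr_eq0 => zj; rewrite !zD.
rewrite powRM// ler_wpM2l ?powR_ge0// (bigD1 i0)//= lerDl.
by apply: sumr_ge0 => i _; exact: powR_ge0.
Qed.

End Overlap.

Section Translates.
Context {R : realType}.
Local Notation mu := (@lebesgue_measure R).
Implicit Types (q p : R) (f g psi : R -> R).

(** The p-th power of the Lp norm, as an extended real number, so that inequalities
    between norms need no finiteness assumption. *)
Definition power_integral q f : \bar R := (\int[mu]_x (`|f x| `^ q)%:E)%E.

Lemma power_integral_ge0 q f : (0 <= power_integral q f)%E.
Proof. by apply: integral_ge0 => x _; rewrite lee_fin powR_ge0. Qed.

Lemma measurable_normpow q f : measurable_fun [set: measurableTypeR R] f ->
  measurable_fun [set: measurableTypeR R] (fun x => (`|f x| `^ q)%:E).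
Proof.
move=> mf; apply/measurable_EFinP.
apply: (measurableT_comp (measurable_powR _)) => //.
exact: measurableT_comp.
Qed.

Lemma measurable_shift (c : R) f : measurable_fun [set: measurableTypeR R] f ->
  measurable_fun [set: measurableTypeR R] (fun x => f (x + c)).
Proof.
move=> mf; apply: (measurableT_comp mf).
apply: (eq_measurable_fun (affine 1 (- c))); last exact: measurable_affine.
by move=> x _; rewrite /affine mul1r opprK.
Qed.

Lemma ge0_integral_shift (c : R) (f : R -> \bar R) :
  measurable_fun [set: measurableTypeR R] f -> (forall x, 0 <= f x)%E ->
  (\int[mu]_x f (x + c)%R = \int[mu]_x f x)%E.
Proof.
move=> mf f0; have := ge0_integral_affine (- c) ltr01 mf f0.
by rewrite invr1 mul1e => <-; apply: eq_integral => x _; rewrite mul1r opprK.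
Qed.

Lemma integral_shift (c : R) (f : R -> \bar R) :
  measurable_fun [set: measurableTypeR R] f ->
  (\int[mu]_x f (x + c)%R = \int[mu]_x f x)%E.
Proof.
move=> mf; rewrite integralE [RHS]integralE; congr (_ - _)%E.
  rewrite -(ge0_integral_shift c (f := f^\+%E))//; last exact: measurable_funepos.
  by apply: eq_integral => x _; rewrite !funeposE.
rewrite -(ge0_integral_shift c (f := f^\-%E))//; last exact: measurable_funeneg.
by apply: eq_integral => x _; rewrite !funenegE.
Qed.

Definition supported (M : nat) psi := forall x, psi x != 0 -> `|x| <= M%:R.

Definition translates K (t : nat -> R) psi : R -> R :=
  fun y => \sum_(m < K) t m * psi (y + m%:R).

Lemma measurable_translates K (t : nat -> R) psi :
  measurable_fun [set: measurableTypeR R] psi ->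
  measurable_fun [set: measurableTypeR R] (translates K t psi).
Proof.
move=> mpsi; apply: measurable_sum => m.
by apply: measurable_funM => //; exact: measurable_shift.
Qed.

(** At each point at most 4 M + 1 translates are nonzero, and the integral is
    invariant under translation. *)
Lemma translates_upper q M K (t : nat -> R) psi : 0 < q -> supported M psi ->
  measurable_fun [set: measurableTypeR R] psi ->
  (power_integral q (translates K t psi) <=
   ((2 * (2 * M) + 1)%:R `^ q * \sum_(m < K) `|t m| `^ q)%:E * power_integral q psi)%E.
Proof.
move=> q0 sM mpsi.
have mt m : measurable_fun [set: measurableTypeR R] (fun y => (`|t m * psi (y + m%:R)| `^ q)%:E).
  by apply: measurable_normpow; apply: measurable_funM => //;
    exact: measurable_shift.
set A : R := (2 * (2 * M) + 1)%:R `^ q.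
have A0 : 0 <= A by exact: powR_ge0.
apply: (@le_trans _ _ (\int[mu]_y (A%:E * \sum_(m < K) (`|t m * psi (y + m%:R)| `^ q)%:E))%E).
  apply: ge0_le_integral => //.
  - by apply: measurable_normpow; exact: measurable_translates.
  - by apply: measurable_funeM; apply: emeasurable_sum => m; exact: mt.
  move=> y _; rewrite sumEFin -EFinM lee_fin.
  apply: (@overlap_powR _ _ _ (2 * M) (fun m => t m * psi (y + m%:R))) => // i j.
  rewrite !mulf_eq0 !negb_or => /andP[_ /sM yi] /andP[_ /sM yj].
  rewrite -(ler_nat R) natrD natrM.
  move: yi yj; rewrite !ler_norml => /andP[i1 i2] /andP[j1 j2]; lra.
rewrite ge0_integralZl//; last 2 first.
- by apply: emeasurable_sum => m; exact: mt.
- by move=> x _; rewrite sume_ge0// => m _; rewrite lee_fin powR_ge0.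
rewrite ge0_integral_sum//.
rewrite EFinM -muleA; apply: lee_wpmul2l; first by rewrite lee_fin.
rewrite -sumEFin ge0_sume_distrl; last by move=> m _; rewrite lee_fin powR_ge0.
apply: lee_sum => m _.
under eq_integral do rewrite normrM powRM// EFinM.
rewrite ge0_integralZl//; last by apply: measurable_normpow; exact: measurable_shift.
rewrite (ge0_integral_shift m%:R (f := fun x => (`|psi x| `^ q)%:E))//.
exact: measurable_normpow.
Qed.
End Translates.

Section Pairing.
Context {R : realType}.
Local Notation mu := (@lebesgue_measure R).
Implicit Types (q p : R) (f g psi : R -> R).
Local Notation mfun f := (measurable_fun [set: measurableTypeR R] f).

Lemma power_integral_shift q f c : mfun f ->
  power_integral q (fun y => f (y + c)) = power_integral q f.
Proof.
move=> mf; rewrite /power_integral.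
rewrite (ge0_integral_shift c (f := fun x => (`|f x| `^ q)%:E))//.
exact: measurable_normpow.
Qed.

Lemma cross_integrable f g : mfun f -> mfun g ->
  (power_integral 2 f < +oo)%E -> (power_integral 2 g < +oo)%E ->
  mu.-integrable setT (fun y => (f y * g y)%:E).
Proof.
move=> mf mg f2 g2; apply: (@le_integrable _ _ _ mu _ measurableT _
    (fun y => (`|f y| `^ 2)%:E + (`|g y| `^ 2)%:E)%E).
- by apply/measurable_EFinP; exact: measurable_funM.
- move=> y _; rewrite -EFinD !abse_EFin lee_fin [leRHS]ger0_norm ?addr_ge0 ?powR_ge0//.
  rewrite normrM !powR_mulrn//; have := sqr_ge0 (`|f y| - `|g y|).
  rewrite sqrrB; have := normr_ge0 (f y); have := normr_ge0 (g y); nra.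
apply: integrableD => //.
- apply/integrableP; split; first exact: measurable_normpow.
  by under eq_integral do rewrite gee0_abs ?lee_fin ?powR_ge0//.
- apply/integrableP; split; first exact: measurable_normpow.
  by under eq_integral do rewrite gee0_abs ?lee_fin ?powR_ge0//.
Qed.

(** A bounded substitute for f, to be paired with functions in Lp when f itself is
    only known to be in L2. *)
Definition cut (T : nat) f : R -> R := fun x => if `|f x| <= T%:R then f x else 0.

Lemma cut_le T f x : `|cut T f x| <= `|f x|.
Proof. by rewrite /cut; case: ifP; rewrite ?normr0. Qed.

Lemma cut_bound T f x : `|cut T f x| <= T%:R.
Proof. by rewrite /cut; case: ifP; rewrite ?normr0. Qed.

Lemma measurable_cut T f : mfun f -> mfun (cut T f).
Proof.
move=> mf; apply: measurable_fun_ifT => //.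
by apply: measurable_fun_ler => //; exact: measurableT_comp.
Qed.

(** Dominated convergence, with |f g| as the dominating function. *)
Lemma cut_pairing_cvg f g : mfun f -> mfun g ->
  (power_integral 2 f < +oo)%E -> (power_integral 2 g < +oo)%E ->
  (\int[mu]_y (f y * cut n g y)%:E)%E @[n --> \oo] --> (\int[mu]_y (f y * g y)%:E)%E.
Proof.
move=> mf mg f2 g2; have ifg := cross_integrable mf mg f2 g2.
apply: (@dominated_cvg _ _ _ mu _ measurableT _ _ (fun y => `|(f y * g y)%:E|)%E).
- move=> n; apply/measurable_EFinP; apply: measurable_funM => //.
  exact: measurable_cut.
- move=> y _; apply: cvg_near_cst.
  exists (Num.truncn `|g y|).+1 => // n /= hn.
  rewrite /cut ifT//; apply/ltW/(lt_le_trans (truncnS_gt _)).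
  by rewrite ler_nat.
- by move=> y _; rewrite abse_EFin.
- exact: integrable_abse.
move=> n y _; rewrite !abse_EFin lee_fin !normrM ler_wpM2l//; exact: cut_le.
Qed.

Lemma power_integral_bounded q T M g : 0 < q -> supported M g ->
  (forall x, `|g x| <= T) -> mfun g -> (power_integral q g < +oo)%E.
Proof.
move=> q0 sg gT mg.
have T0 : 0 <= T by apply: le_trans (gT 0).
apply: (@le_lt_trans _ _ (\int[mu]_(x in `[(- M%:R : R)%R, (M%:R : R)%R]%classic) (T `^ q)%:E)%E).
  rewrite [leRHS]integral_mkcond; apply: ge0_le_integral => //.
  - exact: measurable_normpow.
  - by apply: (measurable_restrictT _ _).1; [exact: measurable_itv | exact: measurable_cst].
  move=> x _; rewrite patchE; case: ifPn => [_|].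
    by rewrite lee_fin ge0_ler_powR// ?nnegrE ?(ltW q0).
  rewrite notin_setE/= in_itv/= -ler_norml => h.
  have [->|/sg//] := eqVneq (g x) 0.
  by rewrite normr0 powR0 ?gt_eqF.
rewrite integral_cst//= lebesgue_measure_itv/=.
by case: ifP => _; rewrite ?mule0// -EFinB -EFinM ltry.
Qed.

Definition orthonormal_translates phi := forall k l : int,
  (\int[mu]_x (phi (x - k%:~R) * phi (x - l%:~R))%:E = (k == l)%:R%:E)%E.

Definition pairing f g : R := fine (\int[mu]_y (f y * g y)%:E)%E.

Lemma pairing_far M f g (m k : nat) : supported M f -> supported M g ->
  ~~ ((m <= k + 2 * M)%N && (k <= m + 2 * M)%N) ->
  forall y, f (y + m%:R) * g (y + k%:R) = 0.
Proof.
move=> sf sg + y; apply: contraNeq.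
rewrite mulf_eq0 negb_or => /andP[/sf + /sg].
rewrite -!(ler_nat R) !natrD !ler_norml => /andP[a1 a2] /andP[b1 b2].
by apply/andP; split; lra.
Qed.

(** Orthonormality passes to the limit in the truncation level. Compact support
    leaves only finitely many pairings to control, up to translation. *)
Lemma cut_almost_dual phi M eps : mfun phi -> (power_integral 2 phi < +oo)%E ->
  supported M phi -> orthonormal_translates phi -> 0 < eps ->
  exists T, forall m k : nat,
    `|pairing (fun y => phi (y + m%:R)) (fun y => cut T phi (y + k%:R))
      - (m == k)%:R| <= eps.
Proof.
move=> mphi phi2 sphi orth eps0.
have near_dual (i : 'I_(4 * M + 1)) : \forall T \near \oo,
    `|pairing (fun y => phi (y + (i%:R - (2 * M)%:R))) (cut T phi)
      - (nat_of_ord i == 2 * M)%N%:R| <= eps.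
  have := @cut_pairing_cvg (fun y => phi (y + (i%:R - (2 * M)%:R))) phi
    (measurable_shift _ mphi) mphi.
  rewrite power_integral_shift// => /(_ phi2 phi2).
  have -> : (\int[mu]_y (phi (y + (i%:R - (2 * M)%:R)) * phi y)%:E =
      ((nat_of_ord i == 2 * M)%N%:R)%:E)%E.
    transitivity (((2 * M)%:Z - i%:Z == 0)%:R%:E : \bar R).
      rewrite -orth; apply: eq_integral => y _; rewrite subr0.
      by rewrite intrB opprB.
    by rewrite subr_eq0 eqz_nat eq_sym.
  move=> /fine_cvgP[_ /cvgrPdist_le/(_ _ eps0)].
  by apply: filterS => T; rewrite distrC.
have [T _ /(_ T (leqnn T)) hT] := filter_forall _ near_dual.
exists T => m k.
have scut : supported M (cut T phi).
  by move=> x; rewrite /cut; case: ifP; [move=> _ /sphi|rewrite eqxx].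
have [mk|mk] := boolP ((m <= k + 2 * M)%N && (k <= m + 2 * M)%N); last first.
  rewrite /pairing; under eq_integral do rewrite (pairing_far sphi scut mk).
  rewrite integral0/=; have [emk|_] := eqVneq m k; last by rewrite subr0 normr0 ltW.
  by move: mk; rewrite emk leq_addr.
have iP : (m + 2 * M - k < 4 * M + 1)%N.
  move: mk => /andP[h1 h2]; rewrite ltn_subLR// addn1 addnS ltnS.
  by apply: (leq_trans (leq_add h1 (leqnn _))); rewrite -addnA leq_add2l -mulnDl.
have := hT (Ordinal iP).
have -> : ((m + 2 * M - k)%N == (2 * M)%N) = (m == k).
  by move: mk => /andP[h1 h2]; rewrite -(eqn_add2r k) subnK// addnC eqn_add2l.
congr (`|_ - _| <= _); rewrite /pairing; congr fine.
rewrite -(integral_shift k%:R (f := fun y => (phi (y + (_ - _)) * cut T phi y)%:E)).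
  apply: eq_integral => y _; congr (phi _ * _)%:E.
  by case/andP: mk => _ h2; rewrite natrB// natrD; lra.
apply/measurable_EFinP; apply: measurable_funM; first exact: measurable_shift.
exact: measurable_cut.
Qed.

End Pairing.

Section Lower.
Context {R : realType}.
Local Notation mu := (@lebesgue_measure R).
Local Notation mfun f := (measurable_fun [set: measurableTypeR R] f).
Variables (p p' : R).
Hypotheses (p0 : 0 < p) (p'0 : 0 < p') (pp' : p^-1 + p'^-1 = 1).

(** The duality map of l^r, without normalization. *)
Definition dual_power (r s : R) : R := Num.sg s * `|s| `^ (r - 1).

Lemma conj_mul : (p - 1) * p' = p.
Proof.
have h : p * p' = p + p'.
  by rewrite -[LHS]mulr1 -pp'; field; rewrite !gt_eqF.
by rewrite mulrBl mul1r h addrK.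
Qed.

Lemma dual_powerE s : s * dual_power p s = `|s| `^ p.
Proof.
rewrite /dual_power mulrA [s * _]mulrC -normrEsg.
have [->|s0] := eqVneq s 0; first by rewrite normr0 mul0r powR0// gt_eqF.
rewrite -[X in X * _]powRr1// -powRD; last by rewrite normr_eq0 s0 implybT.
by rewrite addrC subrK.
Qed.

Lemma norm_dual_power s : `|dual_power p s| `^ p' = `|s| `^ p.
Proof.
rewrite /dual_power normrM normr_sg [`|_ `^ _|]ger0_norm ?powR_ge0//.
have [->|s0] := eqVneq s 0; first by rewrite normr0 mul0r !powR0// gt_eqF.
by rewrite mul1r -powRrM conj_mul.
Qed.

Lemma young_dual_power (s t : R) : `|s| * `|dual_power p t| <= `|s| `^ p + `|t| `^ p.
Proof.
apply: (le_trans (conjugate_powR (normr_ge0 _) (normr_ge0 _) p0 p'0 pp')).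
have i1 : p^-1 <= 1 by rewrite -pp' lerDl invr_ge0 ltW.
have i2 : p'^-1 <= 1 by rewrite -pp' lerDr invr_ge0 ltW.
by rewrite norm_dual_power lerD// ler_piMr// ?powR_ge0.
Qed.

(** The diagonal contributes the sum of the |t_m|^p. A row of the error has at
    most 4 M + 1 nonzero entries, and Young's inequality splits each of them
    between two terms of that sum. *)
Lemma gram_lower M K (t : nat -> R) (G : nat -> nat -> R) :
  (forall m k, `|G m k - (m == k)%:R| <= (4 * (2 * (2 * M) + 1)%:R)^-1) ->
  (forall m k, ~~ ((m <= k + 2 * M)%N && (k <= m + 2 * M)%N) -> G m k = 0) ->
  2^-1 * \sum_(m < K) `|t m| `^ p <=
  \sum_(m < K) \sum_(k < K) t m * dual_power p (t k) * G m k.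
Proof.
set D := (2 * M)%N; set n : R := (2 * D + 1)%:R => Gd G0.
have n0 : 0 < n by rewrite ltr0n addn1.
pose S := \sum_(m < K) `|t m| `^ p; rewrite -/S.
have -> : \sum_(m < K) \sum_(k < K) t m * dual_power p (t k) * G m k =
    S + \sum_(m < K) \sum_(k < K) t m * dual_power p (t k) * (G m k - (m == k :> nat)%:R).
  rewrite /S -big_split/=; apply: eq_bigr => m _.
  rewrite -dual_powerE -[t m * dual_power p (t m)]mulr1.
  have -> : t m * dual_power p (t m) * 1 =
      \sum_(k < K) t m * dual_power p (t k) * (m == k :> nat)%:R.
    rewrite (bigD1 m)//= eqxx big1 ?addr0// => k /negPf km.
    by rewrite eq_sym val_eqE km mulr0.
  by rewrite -big_split/=; apply: eq_bigr => k _; rewrite -mulrDr [X in _ = _ * X]addrC subrK.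
set E := \sum_(m < K) _.
suff : `|E| <= 2^-1 * S by rewrite ler_norml => /andP[]; lra.
pose near m k := (m <= k + D)%N && (k <= m + D)%N.
pose e := (4 * n)^-1.
have e0 : 0 <= e by rewrite invr_ge0 mulr_ge0// ltW.
have bound m k : `|t m * dual_power p (t k) * (G m k - (m == k)%:R)| <=
    e * ((near m k)%:R * `|t m| `^ p + (near k m)%:R * `|t k| `^ p).
  have -> : near k m = near m k by rewrite /near andbC.
  have [nmk|nmk] := boolP (near m k).
    rewrite !mul1r [X in `|X|]mulrC normrM; apply: ler_pM => //.
    by rewrite normrM; exact: young_dual_power.
  rewrite G0// !mul0r addr0 mulr0 sub0r normrM normrN.
  have [mk|_] := eqVneq m k; last by rewrite normr0 mulr0.
  by move: nmk; rewrite /near mk leq_addr.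
have half (F : 'I_K -> R) : (forall m, 0 <= F m) ->
    \sum_(m < K) \sum_(k < K) (near m k)%:R * F m <= n * \sum_(m < K) F m.
  move=> F0; rewrite mulr_sumr; apply: ler_sum => m _.
  rewrite -mulr_suml ler_wpM2r// -natr_sum ler_nat.
  by apply: leq_trans (card_near K D m); apply: leq_sum => k _; rewrite /near.
apply: (le_trans (ler_norm_sum _ _ _)).
apply: (@le_trans _ _ (\sum_(m < K) \sum_(k < K)
    e * ((near m k)%:R * `|t m| `^ p + (near k m)%:R * `|t k| `^ p))).
  apply: ler_sum => m _; apply: (le_trans (ler_norm_sum _ _ _)).
  by apply: ler_sum => k _; exact: bound.
under eq_bigr do rewrite -mulr_sumr big_split/=.
rewrite -mulr_sumr big_split/= [X in _ + X]exchange_big/=.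
have F0 (m : 'I_K) : 0 <= `|t m| `^ p by exact: powR_ge0.
have := half _ F0; rewrite -/S; set Z := \sum_(i < K) _ => ZS.
have -> : 2^-1 * S = e * (n * S + n * S) by rewrite /e; field; rewrite gt_eqF.
by rewrite ler_wpM2l// lerD.
Qed.

Lemma translates_pairing K t u f g : mfun f -> mfun g ->
  (power_integral 2 f < +oo)%E -> (power_integral 2 g < +oo)%E ->
  (\int[mu]_y (translates K t f y * translates K u g y)%:E)%E =
  (\sum_(m < K) \sum_(k < K) t m * u k *
    pairing (fun y => f (y + m%:R)) (fun y => g (y + k%:R)))%:E.
Proof.
move=> mf mg f2 g2.
have int m k : mu.-integrable setT (fun y => (f (y + m%:R) * g (y + k%:R))%:E).
  apply: (@cross_integrable _ (fun y => f (y + m%:R)) (fun y => g (y + k%:R)));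
    by [exact: measurable_shift | rewrite power_integral_shift].
transitivity (\int[mu]_y (\sum_(m < K) \sum_(k < K)
    (t m * u k)%:E * (f (y + m%:R)%R * g (y + k%:R)%R)%:E))%E.
  apply: eq_integral => y _; rewrite /translates mulr_suml -sumEFin.
  apply: eq_bigr => m _; rewrite mulr_sumr -sumEFin; apply: eq_bigr => k _.
  by rewrite -EFinM mulrACA.
rewrite integral_sum//; last first.
  by move=> m; apply: integrable_sum => // k _; exact: integrableZl.
rewrite -sumEFin; apply: eq_bigr => m _.
rewrite integral_sum//; last by move=> k; exact: integrableZl.
rewrite -sumEFin; apply: eq_bigr => k _.
by rewrite integralZl// [RHS]EFinM /pairing fineK// integrable_fin_num.
Qed.

Lemma young_scaled (L s t : R) : 0 < L ->
  `|s * t| <= (L `^ p'^-1) `^ p * `|s| `^ p + L^-1 * `|t| `^ p'.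
Proof.
move=> L0; set l := L `^ p'^-1.
have l0 : 0 < l by exact: powR_gt0.
have lL : l `^ p' = L by rewrite /l -powRrM mulVf ?powRr1 ?(ltW L0)// gt_eqF.
have i1 : p^-1 <= 1 by rewrite -pp' lerDl invr_ge0 ltW.
have i2 : p'^-1 <= 1 by rewrite -pp' lerDr invr_ge0 ltW.
have a0 : 0 <= l * `|s| by rewrite mulr_ge0// ltW.
have b0 : 0 <= `|t| / l by rewrite divr_ge0// ltW.
have -> : `|s * t| = (l * `|s|) * (`|t| / l).
  by rewrite normrM; field; rewrite gt_eqF.
apply: (le_trans (conjugate_powR a0 b0 p0 p'0 pp')).
have -> : L^-1 * `|t| `^ p' = (`|t| / l) `^ p'.
  rewrite -[in LHS](divfK (lt0r_neq0 l0) `|t|) powRM ?(ltW l0)// lL.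
  by rewrite mulrCA mulVf ?mulr1// gt_eqF.
rewrite -powRM ?(ltW l0)//.
by rewrite lerD// ler_piMr// ?powR_ge0.
Qed.

(** Pair the combination with the combination of truncated translates whose
    coefficients are the [dual_power] of t. The truncation makes the latter
    belong to the dual space, with norm controlled by [translates_upper]; the
    pairing is at least half the sum of the |t_m|^p by [gram_lower]. The
    scale in Young's inequality is chosen so as to absorb the dual norm into
    half of the pairing. *)
Lemma translates_lower phi M : mfun phi -> (power_integral 2 phi < +oo)%E ->
  supported M phi -> orthonormal_translates phi ->
  exists2 c : R, 0 < c & forall K (t : nat -> R),
    ((c * \sum_(m < K) `|t m| `^ p)%:E <= power_integral p (translates K t phi))%E.
Proof.
move=> mphi phi2 sphi orth.
have e0 : 0 < (4 * (2 * (2 * M) + 1)%:R)^-1 :> R.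
  by rewrite invr_gt0 mulr_gt0// ltr0n addn1.
have [T hT] := cut_almost_dual mphi phi2 sphi orth e0.
set g := cut T phi in hT.
have mg : mfun g by exact: measurable_cut.
have sg : supported M g.
  by move=> x; rewrite /g /cut; case: ifP; [move=> _ /sphi|rewrite eqxx].
have g2 : (power_integral 2 g < +oo)%E.
  by apply: (@power_integral_bounded _ 2 T%:R M) => // x; exact: cut_bound.
have gp : (power_integral p' g < +oo)%E.
  by apply: (@power_integral_bounded _ p' T%:R M) => // x; exact: cut_bound.
pose A : R := (2 * (2 * M) + 1)%:R `^ p' * fine (power_integral p' g).
have A0 : 0 <= A by rewrite mulr_ge0 ?powR_ge0 ?fine_ge0 ?power_integral_ge0.
(* With this scale, the dual norm costs at most a quarter of the sum S. *)
pose L := 4 * A + 1.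
have L0 : 0 < L by rewrite /L; lra.
pose l := L `^ p'^-1.
have l0 : 0 < l by exact: powR_gt0.
exists (4 * l `^ p)^-1 => [|K t].
  by rewrite invr_gt0 mulr_gt0// powR_gt0.
set S := \sum_(m < K) _; pose u k := dual_power p (t k).
have S0 : 0 <= S by apply: sumr_ge0 => m _; exact: powR_ge0.
have uS : \sum_(m < K) `|u m| `^ p' = S.
  by apply: eq_bigr => k _; exact: norm_dual_power.
have lower : ((2^-1 * S)%:E <=
    \int[mu]_y (translates K t phi y * translates K u g y)%:E)%E.
  rewrite translates_pairing// lee_fin; 
  apply: (gram_lower (G := fun m k => pairing (fun y => phi (y + m%:R))
    (fun y => g (y + k%:R))) K t hT) => m k mk.
  rewrite /pairing; under eq_integral do rewrite (pairing_far sphi sg mk).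
  by rewrite integral0.
have mF : mfun (translates K t phi) by exact: measurable_translates.
have mH : mfun (translates K u g) by exact: measurable_translates.
have upper : (\int[mu]_y (translates K t phi y * translates K u g y)%:E <=
    (l `^ p)%:E * power_integral p (translates K t phi) +
    (L^-1)%:E * power_integral p' (translates K u g))%E.
  have L0' : (0 <= (L^-1)%:E)%E by rewrite lee_fin invr_ge0 ltW.
  have lp0 : (0 <= (l `^ p)%:E)%E by rewrite lee_fin powR_ge0.
  rewrite /power_integral -!ge0_integralZl//; try exact: measurable_normpow.
  rewrite -ge0_integralD//; last 4 first.
  - by move=> y _; rewrite mule_ge0// lee_fin powR_ge0.
  - by apply: measurable_funeM; exact: measurable_normpow.
  - by move=> y _; rewrite mule_ge0// lee_fin powR_ge0.
  - by apply: measurable_funeM; exact: measurable_normpow.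
  apply: (le_trans (lee_abs _)).
  apply: (le_trans (le_abse_integral _ _ _)) => //.
    by apply/measurable_EFinP; exact: measurable_funM.
  apply: ge0_le_integral => //.
  - by apply/measurable_EFinP; apply: measurableT_comp => //; exact: measurable_funM.
  - by apply: emeasurable_funD; apply: measurable_funeM; exact: measurable_normpow.
  move=> y _; rewrite abse_EFin -!EFinM -EFinD lee_fin.
  exact: young_scaled.
have H : (power_integral p' (translates K u g) <= (A * S)%:E)%E.
  apply: (le_trans (translates_upper K u p'0 sg mg)); rewrite uS.
  rewrite -[power_integral p' g]fineK ?ge0_fin_numE ?power_integral_ge0//.
  by rewrite -EFinM lee_fin /A mulrAC.
have := le_trans lower upper; have := power_integral_ge0 p (translates K t phi).
case: (power_integral p _) => [F||//]; last by move=> *; rewrite leey.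
move: H; have := power_integral_ge0 p' (translates K u g).
case: (power_integral p' _) => [G||//]; last by move=> _; rewrite leye_eq.
rewrite !lee_fin => G0 GS F0 h.
have LA : L^-1 * G <= 4^-1 * S.
  apply: (@le_trans _ _ (L^-1 * (A * S))); first by rewrite ler_wpM2l ?invr_ge0 ?(ltW L0).
  rewrite mulrA ler_wpM2r// ler_pdivrMl// /L; lra.
rewrite invfM mulrAC ler_pdivrMr ?powR_gt0//; rewrite [F * _]mulrC; lra.
Qed.

End Lower.

(** * Completeness of Lp and coefficients in a Schauder basis *)

Section LpSpace.
Context {R : realType}.
Local Notation mu := (@lebesgue_measure R).
Local Notation mfun f := (measurable_fun [set: measurableTypeR R] f).
Variables (p : R) (p_gt1 : 1 < p).

Let p1 : (1 <= p%:E)%E.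
Proof. by rewrite lee_fin ltW. Qed.
Let p0 : 0 < p.
Proof. exact: lt_trans p_gt1. Qed.

Definition Lp_norm (f : R -> R) : R := fine (Lnorm mu p%:E (EFin \o f)).

Lemma Lp_norm_ge0 f : 0 <= Lp_norm f.
Proof. by rewrite fine_ge0// Lnorm_ge0. Qed.

Lemma power_integral_Lnorm f : power_integral p f = poweR (Lnorm mu p%:E (EFin \o f)) p.
Proof. by rewrite powR_Lnorm// gt_eqF. Qed.

Lemma LfunE f : f \in Lfun mu p%:E <-> mfun f /\ (power_integral p f < +oo)%E.
Proof.
rewrite power_integral_Lnorm; split=> [fL|[mf hf]].
  have := sub_Lfun_mfun fL; have := sub_Lfun_finLfun fL.
  rewrite !inE/= /finite_norm => hf mf; split => //.
  exact: poweR_lty.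
rewrite inE/=; apply/andP; split; first by rewrite inE.
rewrite inE/= /finite_norm ltNge leye_eq; apply/eqP => h.
by move: hf; rewrite h poweRyr// gt_eqF.
Qed.

Lemma power_integral_norm f : f \in Lfun mu p%:E ->
  power_integral p f = (Lp_norm f `^ p)%:E.
Proof.
move=> /sub_Lfun_finLfun; rewrite inE/= /finite_norm => hf.
rewrite power_integral_Lnorm -poweR_EFin /Lp_norm fineK//.
by rewrite ge0_fin_numE// Lnorm_ge0.
Qed.

Lemma LfunD f g : f \in Lfun mu p%:E -> g \in Lfun mu p%:E ->
  (fun x => f x + g x) \in Lfun mu p%:E.
Proof. by move=> fL gL; exact: (Lfun_addr_closed mu p1).2. Qed.

Lemma Lp_normD f g : f \in Lfun mu p%:E -> g \in Lfun mu p%:E ->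
  Lp_norm (fun x => f x + g x) <= Lp_norm f + Lp_norm g.
Proof. by move=> fL gL; exact: (ler_LnormD (Lfun_Sub p1 fL) (Lfun_Sub p1 gL)). Qed.

Lemma Lfun_abs f : f \in Lfun mu p%:E -> (fun x => `|f x|) \in Lfun mu p%:E.
Proof.
move=> /LfunE[mf hf]; apply/LfunE; split; first exact: measurableT_comp.
by rewrite /power_integral; under eq_integral do rewrite normr_id.
Qed.

Lemma Lp_norm_abs f : Lp_norm (fun x => `|f x|) = Lp_norm f.
Proof. by rewrite /Lp_norm -[in RHS]Lnorm_abse. Qed.

Lemma Lp_norm_lt f e : 0 < e -> f \in Lfun mu p%:E ->
  (power_integral p f < (e `^ p)%:E)%E -> Lp_norm f < e.
Proof.
move=> e0 fL; rewrite power_integral_norm// lte_fin ltNge => h; rewrite ltNge.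
by apply: contra h => h; rewrite ge0_ler_powR// ?nnegrE ?Lp_norm_ge0 ?(ltW p0) ?(ltW e0).
Qed.

Section Completeness.
Variable f : nat -> R -> R.
Hypothesis fL : forall n, f n \in Lfun mu p%:E.
Hypothesis f_small : forall n, Lp_norm (f n) <= 2 ^- n.

Let S n x : R := \sum_(i < n) f i x.
Let G n x : R := \sum_(i < n) `|f i x|.

Let G_Lfun n : G n \in Lfun mu p%:E.
Proof.
elim: n => [|n IH].
  apply/LfunE; rewrite /G; under eq_fun do rewrite big_ord0.
  by split => //; rewrite /power_integral integral0_eq// => x _; rewrite normr0 powR0// gt_eqF.
rewrite /G; under eq_fun do rewrite big_ord_recr/=.
by apply: LfunD => //; exact: Lfun_abs.
Qed.

Let S_Lfun n : S n \in Lfun mu p%:E.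
Proof.
elim: n => [|n IH].
  apply/LfunE; rewrite /S; under eq_fun do rewrite big_ord0.
  by split => //; rewrite /power_integral integral0_eq// => x _; rewrite normr0 powR0// gt_eqF.
rewrite /S; under eq_fun do rewrite big_ord_recr/=.
exact: LfunD.
Qed.

Let G_norm n : Lp_norm (G n) <= 2.
Proof.
suff : Lp_norm (G n) <= 2 - 2 ^- n * 2.
  move=> h; apply: (le_trans h); rewrite gerBl mulr_ge0// invr_ge0 exprn_ge0//.
elim: n => [|n IH].
  rewrite expr0 invr1 mul1r subrr /G; under eq_fun do rewrite big_ord0.
  by rewrite /Lp_norm Lnorm0// gt_eqF.
rewrite /G; under eq_fun do rewrite big_ord_recr/=.
apply: (le_trans (Lp_normD (G_Lfun n) (Lfun_abs (fL n)))).
rewrite Lp_norm_abs; have := f_small n; rewrite exprS invfM; lra.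
Qed.

Let H x : \bar R := ereal_sup (range (fun n => ((G n x) `^ p)%:E)).

Let G_ge0 n x : 0 <= G n x.
Proof. by apply: sumr_ge0. Qed.

Let G_mono x : {homo (fun n => G n x) : m n / (m <= n)%N >-> m <= n}.
Proof.
by apply: homo_leq => // [y a b|n]; [exact: le_trans|rewrite /G big_ord_recr/= lerDl].
Qed.

Let GP_mono x : {homo (fun n => ((G n x) `^ p)%:E) : m n / (m <= n)%N >-> (m <= n)%E}.
Proof.
move=> m n mn; rewrite lee_fin ge0_ler_powR ?nnegrE ?G_ge0 ?(ltW p0)//.
exact: G_mono.
Qed.

Let GP_le_H n x : (((G n x) `^ p)%:E <= H x)%E.
Proof. by apply: ereal_sup_ubound; exists n. Qed.

Let H_cvg x : (fun n => ((G n x) `^ p)%:E) @ \oo --> H x.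
Proof. exact: (ereal_nondecreasing_cvgn (@GP_mono x)). Qed.

Let mGP n : mfun (fun x => ((G n x) `^ p)%:E).
Proof.
have /LfunE[mG _] := G_Lfun n; apply/measurable_EFinP.
exact: measurableT_comp (measurable_powR _) mG.
Qed.

Let mH : mfun H.
Proof. by apply: (emeasurable_fun_cvg _ _ mGP) => x _; exact: H_cvg. Qed.

Let H_ge0 x : (0 <= H x)%E.
Proof. by apply: (le_trans _ (GP_le_H 0 x)); rewrite lee_fin powR_ge0. Qed.

Let H_integral : (\int[mu]_x H x <= (2 `^ p)%:E)%E.
Proof.
have -> : (\int[mu]_x H x = \int[mu]_x limn (fun n => ((G n x) `^ p)%:E))%E.
  by apply: eq_integral => x _; apply/esym/cvg_lim => //; exact: H_cvg.
have GP_ge0 n x : (0 <= ((G n x) `^ p)%:E)%E by rewrite lee_fin powR_ge0.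
rewrite monotone_convergence//.
apply: lime_le; last first.
  apply: nearW => n; have <- : (power_integral p (G n) = \int[mu]_x ((G n x) `^ p)%:E)%E.
    by apply: eq_integral => x _; rewrite ger0_norm.
  rewrite power_integral_norm// lee_fin.
  by rewrite ge0_ler_powR ?nnegrE ?Lp_norm_ge0 ?(ltW p0).
apply: ereal_nondecreasing_is_cvgn => m n mn; apply: ge0_le_integral => //.
by move=> x _; exact: GP_mono.
Qed.

Let H_integrable : mu.-integrable setT H.
Proof.
apply/integrableP; split => //.
under eq_integral do rewrite gee0_abs//.
by rewrite (le_lt_trans H_integral)// ltry.
Qed.

Let F x : R := if (H x < +oo)%E then limn (fun n => S n x) else 0.

Let S_dist x m n : (m <= n)%N -> `|S n x - S m x| <= G n x.
Proof.
move=> /subnK <-; elim: (n - m)%N => [|k IH]; first by rewrite subrr normr0.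
rewrite addSn /S /G !big_ord_recr/= -/(S _ x) -/(G _ x) addrAC.
by rewrite (le_trans (ler_normD _ _))// lerD2r.
Qed.

Let B x : R := fine (H x) `^ p^-1.

Let G_le_B x n : (H x < +oo)%E -> G n x <= B x.
Proof.
move=> Hx; have fH : H x \is a fin_num by rewrite ge0_fin_numE.
have := GP_le_H n x; rewrite -[H x]fineK// lee_fin => h.
have -> : G n x = (G n x `^ p) `^ p^-1.
  by rewrite -powRrM mulfV ?powRr1// gt_eqF.
by rewrite /B ge0_ler_powR ?nnegrE ?powR_ge0 ?fine_ge0 ?invr_ge0 ?(ltW p0).
Qed.

Let S_cvg x : (H x < +oo)%E -> (fun n => S n x) @ \oo --> F x.
Proof.
move=> Hx; rewrite /F Hx; suff : cvgn (fun n => S n x) by [].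
have -> : (fun n => S n x) = series (fun i => f i x).
  by apply/funext => n; rewrite /series/= big_mkord.
apply: normed_cvg.
have -> : [normed series (fun i => f i x)] = (fun n => G n x).
  by apply/funext => n; rewrite /= /series/= big_mkord.
apply: nondecreasing_is_cvgn; first exact: G_mono.
by exists (B x) => _ [n _ <-]; exact: G_le_B.
Qed.

Let F_dist x n : (H x < +oo)%E -> ((`|F x - S n x| `^ p)%:E <= H x)%E.
Proof.
move=> Hx; have fH : H x \is a fin_num by rewrite ge0_fin_numE.
have h : `|F x - S n x| <= B x.
  have c : (fun k => `|S k x - S n x|) @ \oo --> `|F x - S n x|.
    by apply: cvg_norm; apply: cvgB; [exact: S_cvg | exact: cvg_cst].
  apply: (cvgr_to_le c); exists n => // k /= nk.
  exact: le_trans (S_dist x nk) (G_le_B k Hx).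
rewrite -[H x]fineK// lee_fin.
have -> : fine (H x) = B x `^ p.
  by rewrite /B -powRrM mulVf ?powRr1 ?fine_ge0// gt_eqF.
by rewrite ge0_ler_powR ?nnegrE ?powR_ge0 ?(ltW p0).
Qed.

Let mF : mfun F.
Proof.
apply: (@measurable_fun_cvg _ (measurableTypeR R) R _ (fun n x => if (H x < +oo)%E then S n x else 0)).
  move=> n; apply: measurable_fun_ifT => //; first exact: measurable_fun_lte.
  by have /LfunE[] := S_Lfun n.
move=> x _; have [Hx|Hx] := boolP (H x < +oo)%E; first exact: S_cvg.
by rewrite /F (negPf Hx); exact: cvg_cst.
Qed.

Let F_Lfun : F \in Lfun mu p%:E.
Proof.
apply/LfunE; split=> //; apply: (@le_lt_trans _ _ (\int[mu]_x H x)%E).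
  apply: ge0_le_integral => //; first exact: measurable_normpow.
  move=> x _; have [Hx|Hx] := boolP (H x < +oo)%E.
    by have := F_dist 0 Hx; rewrite /S big_ord0 subr0.
  by rewrite /F (negPf Hx) normr0 powR0// gt_eqF.
by rewrite (le_lt_trans H_integral)// ltry.
Qed.

Let FS_Lfun n : (fun x => F x - S n x) \in Lfun mu p%:E.
Proof.
apply: (LfunD F_Lfun); have := Lfun_oppr_closed (S_Lfun n).
exact.
Qed.

(** The sums of absolute values have bounded norms, so by monotone convergence
    they have an almost everywhere finite limit whose p-th power is integrable.
    It dominates the partial sums, which converge where it is finite. *)
Lemma riesz_fischer : exists2 F, F \in Lfun mu p%:E &
  Lp_norm (fun x => F x - \sum_(i < n) f i x) @[n --> \oo] --> 0.
Proof.
exists F => //.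
have mFS n : mfun (fun x => (`|F x - S n x| `^ p)%:E).
  by apply: measurable_normpow; have /LfunE[] := FS_Lfun n.
have HE x : H x \is a fin_num -> (H x < +oo)%E by rewrite ge0_fin_numE.
have c0 : {ae mu, forall x, setT x ->
    (fun n => (`|F x - S n x| `^ p)%:E) @ \oo --> (cst 0%E : R -> \bar R) x}.
  have := integrable_ae measurableT H_integrable.
  apply: filterS => x /(_ I) /HE Hx _.
  apply/fine_cvgP; split; first exact: nearW.
  apply/cvgrPdist_lt => eps eps0.
  have e0 : 0 < eps `^ p^-1 by exact: powR_gt0.
  have /cvgrPdist_lt/(_ _ e0) := S_cvg Hx.
  apply: filterS => n h; rewrite sub0r normrN/= ger0_norm ?powR_ge0//.
  have -> : eps = (eps `^ p^-1) `^ p by rewrite -powRrM mulVf ?powRr1 ?(ltW eps0)// gt_eqF.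
  by rewrite gt0_ltr_powR ?nnegrE ?powR_ge0.
have dom : {ae mu, forall x n, setT x -> (`|(`|F x - S n x| `^ p)%:E| <= H x)%E}.
  have := integrable_ae measurableT H_integrable.
  apply: filterS => x /(_ I) /HE Hx n _.
  by rewrite abse_EFin ger0_norm ?powR_ge0//; exact: F_dist.
have [_ _ int0] := dominated_convergence measurableT mFS (measurable_cst _) c0 H_integrable dom.
apply/cvgrPdist_lt => eps eps0.
move: int0; rewrite integral0 => /fine_cvgP[fin /cvgrPdist_lt/(_ _ (powR_gt0 p eps0))].
move: fin; apply: filterS2 => n fin.
rewrite sub0r normrN ger0_norm ?fine_ge0 ?integral_ge0// => h.
rewrite sub0r normrN ger0_norm ?Lp_norm_ge0//.
apply: (Lp_norm_lt eps0 (FS_Lfun n)); rewrite -[power_integral _ _]fineK ?lte_fin//.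
Qed.

End Completeness.
End LpSpace.

Section LpBasis.
Context {R : realType}.
Local Notation mu := (@lebesgue_measure R).
Variables (p : R) (p_gt1 : 1 < p).

Let p1 : (1 <= p%:E)%E.
Proof. by rewrite lee_fin ltW. Qed.

Local Notation X := (LfunType mu p1).

Let Lfun_sumE (f : nat -> X) n x : (\sum_(i < n) f i) x = \sum_(i < n) f i x.
Proof. by elim: n => [|n IH]; rewrite ?big_ord0// !big_ord_recr/= -IH. Qed.

Let nuZ (c : R) (f : X) : Lp_norm p (c *: f) = `|c| * Lp_norm p f.
Proof. by rewrite /Lp_norm LnormZ -finite_norm_fine -EFinM. Qed.

Let nuD (f g : X) : Lp_norm p (f + g) <= Lp_norm p f + Lp_norm p g.
Proof. exact: ler_LnormD. Qed.

Let nu_complete (f : nat -> X) : (forall n, Lp_norm p (f n) <= 2 ^- n) ->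
  exists F : X, Lp_norm p (F - \sum_(i < n) f i) @[n --> \oo] --> 0.
Proof.
move=> fn.
have [F FL hF] := riesz_fischer p_gt1 (fun n => LfunP (f n)) fn.
exists (Lfun_Sub p1 FL).
rewrite [X in X @ \oo](_ : _ = fun n => Lp_norm p (fun x => F x - \sum_(i < n) f i x))//.
apply/funext => n; congr (Lp_norm p _); apply/funext => x.
by rewrite -(Lfun_sumE f).
Qed.

(** The abstract theorem on the space of Lp functions, in which equality almost
    everywhere is not quotiented out: a seminorm suffices. *)
Lemma Lp_basis_constant (e : nat -> R -> R) : Lp_schauder_basis p e ->
  exists2 C : R, 0 < C & forall (c : nat -> R) n k, (k < n)%N ->
    `|c k| * Lp_norm p (e k) <= C * Lp_norm p (fun x => \sum_(i < n) c i * e i x).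
Proof.
move=> [eL basis]; pose E i : X := Lfun_Sub p1 (eL i).
have partialE c n x : (partial E c n : X) x = \sum_(i < n) c i * e i x.
  rewrite /partial; have := Lfun_sumE (fun i => c i *: E i) n x.
  by move=> ->.
have expE (f : X) c : Lp_expansion p e f c <-> expansion (fun g : X => Lp_norm p g) E f c.
  rewrite /Lp_expansion /expansion.
  have -> : (fun n => Lnorm mu p%:E (EFin \o (fun x => f x - \sum_(i < n) c i * e i x))) =
      (fun n => (Lp_norm p (f - partial E c n : X))%:E).
    apply/funext => n; rewrite /Lp_norm finite_norm_fine; congr Lnorm.
    by apply/funext => x /=; rewrite -partialE.
  split => [/fine_cvgP[_]|h]; first exact.
  by apply/fine_cvgP; split => //; exact: nearW.
have basis' (f : X) : exists! c, expansion (fun g : X => Lp_norm p g) E f c.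
  have [c [hc uniq]] := basis f (LfunP f); exists c; split; first exact/expE.
  by move=> c' /expE; exact: uniq.
have [C C0 hC] := @basis_constant _ _ (fun f : X => Lp_norm p f) E
  (fun f => Lp_norm_ge0 p f) nuZ nuD nu_complete basis'.
exists C => // c n k kn; have := hC c n k kn.
congr (_ <= _ * Lp_norm p _); apply/funext => x; exact: partialE.
Qed.

End LpBasis.

(** * Equalities almost everywhere and truncation *)

Section AlmostEverywhere.
Context {R : realType}.
Local Notation mu := (@lebesgue_measure R).
Local Notation mfun f := (measurable_fun [set: measurableTypeR R] f).
Implicit Types f g phi : R -> R.

Lemma ae_imply (P Q : R -> Prop) : (forall x, P x -> Q x) ->
  {ae mu, forall x, P x} -> {ae mu, forall x, Q x}.
Proof. by move=> PQ; apply: filterS => //; exact: (ae_filter_ringOfSetsType mu). Qed.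

Lemma ae_imply2 (P Q S : R -> Prop) : (forall x, P x -> Q x -> S x) ->
  {ae mu, forall x, P x} -> {ae mu, forall x, Q x} -> {ae mu, forall x, S x}.
Proof. by move=> PQ; apply: filterS2 => //; exact: (ae_filter_ringOfSetsType mu). Qed.

Lemma ae_affine (a c : R) (P : R -> Prop) : 0 < a ->
  {ae mu, forall x, P x} -> {ae mu, forall x, P (a * x - c)}.
Proof. by move=> a0; exact: (@negligible_affine _ a c (~` [set x | P x])). Qed.

Lemma ae_forall_int (P : int -> R -> Prop) :
  (forall l, {ae mu, forall x, P l x}) -> {ae mu, forall x l, P l x}.
Proof.
move=> h; have h1 := ae_foralln (fun n => h n%:Z); have h2 := ae_foralln (fun n => h (Negz n)).
by move: h1 h2; apply: ae_imply2 => x h1 h2 [n|n].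
Qed.

Lemma ae_refined phi :
  {ae mu, forall x, phi x = subdivide a0 phi x} -> {ae mu, forall x, refined phi x}.
Proof.
move=> h; apply: ae_foralln => j; apply: ae_forall_int => l.
by apply: (@ae_affine _ _ (fun x => phi x = subdivide a0 phi x)); rewrite ?exprn_gt0.
Qed.

Lemma power_integral_ae q f g : mfun f -> mfun g ->
  {ae mu, forall x, f x = g x} -> power_integral q f = power_integral q g.
Proof.
move=> mf mg fg; apply: ge0_ae_eq_integral => //; try exact: measurable_normpow.
have : {ae mu, forall x, setT x -> (`|f x| `^ q)%:E = (`|g x| `^ q)%:E}.
  by move: fg; apply: ae_imply => x fgx _; rewrite fgx.
exact.
Qed.

Lemma power_integral_affine q f a c : 0 < a -> mfun f ->
  power_integral q (fun x => f (a * x - c)) = (a^-1%:E * power_integral q f)%E.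
Proof.
move=> a0 mf.
rewrite /power_integral (ge0_integral_affine c (f := fun x => (`|f x| `^ q)%:E) a0)//.
exact: measurable_normpow.
Qed.

Lemma measurable_comp_affine f a c : mfun f -> mfun (fun x => f (a * x - c)).
Proof. by move=> mf; exact: (measurableT_comp mf (measurable_affine a c)). Qed.

Definition truncate (M : nat) f : R -> R := fun x => if `|x| <= M%:R then f x else 0.

Lemma supported_truncate M f : supported M (truncate M f).
Proof. by move=> x; rewrite /truncate; case: ifP; rewrite ?eqxx. Qed.

Lemma measurable_truncate M f : mfun f -> mfun (truncate M f).
Proof.
move=> mf; apply: measurable_fun_ifT => //.
by apply: measurable_fun_ler => //; exact: measurableT_comp.
Qed.

Lemma ae_truncate f (A : R) : {ae mu, forall x, A < `|x| -> f x = 0} ->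
  exists M, {ae mu, forall x, f x = truncate M f x}.
Proof.
move=> h; exists (Num.truncn `|A|).+1; apply: ae_imply h => x hx.
rewrite /truncate; case: leP => // lt; apply: hx.
by apply: le_lt_trans (ler_norm A) (lt_trans (truncnS_gt _) lt).
Qed.

Lemma orthonormal_ae f g : mfun f -> mfun g -> {ae mu, forall x, f x = g x} ->
  orthonormal_translates f -> orthonormal_translates g.
Proof.
move=> mf mg fg orth k l; rewrite -orth.
have sh (c : R) : {ae mu, forall x, f (x - c) = g (x - c)}.
  have := @ae_affine 1 c (fun x => f x = g x) ltr01 fg.
  by apply: ae_imply => x; rewrite mul1r.
have ms (h : R -> R) (c : R) : mfun h -> mfun (fun x => h (x - c)) by exact: (@measurable_shift _ (- c)).
apply: ae_eq_integral => //.
- by apply/measurable_EFinP; apply: measurable_funM; exact: ms.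
- by apply/measurable_EFinP; apply: measurable_funM; exact: ms.
by have := sh l%:~R; have := sh k%:~R; apply: ae_imply2 => x -> ->.
Qed.

Lemma translates_ae f g K t : {ae mu, forall x, f x = g x} ->
  {ae mu, forall x, translates K t f x = translates K t g x}.
Proof.
move=> fg.
have h : {ae mu, forall x n, f (x + n%:R) = g (x + n%:R)}.
  apply: ae_foralln => n; have := @ae_affine 1 (- n%:R) (fun x => f x = g x) ltr01 fg.
  by apply: ae_imply => x; rewrite mul1r opprK.
by apply: ae_imply h => x h; apply: eq_bigr => m _; rewrite h.
Qed.

End AlmostEverywhere.

(** * Norms at the scale 2^-J *)

Section PacketNorms.
Context {R : realType}.
Local Notation mu := (@lebesgue_measure R).
Local Notation mfun f := (measurable_fun [set: measurableTypeR R] f).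
Variable phi : R -> R.
Hypothesis mphi : mfun phi.
Variable M : nat.
Hypothesis phi_truncate : {ae mu, forall x, phi x = truncate M phi x}.

Definition dyadic J (f : R -> R) (x : R) : R := f (2 ^+ J * x - (2 ^+ J - 1)).

Lemma wpacket_dyadic J x : wpacket phi (2 ^ J - 1) x =
  dyadic J (translates (3 * 2 ^ J) (fun i => (qpoly J)`_i) phi) x.
Proof.
have := packet_comb phi J 1 x; rewrite combC mul1r => ->.
exact: comb_wide (size_qpoly J).
Qed.

Lemma dyadic_power_integral q J K t : power_integral q (dyadic J (translates K t phi)) =
  ((2 ^- J)%:E * power_integral q (translates K t (truncate M phi)))%E.
Proof.
have J0 : 0 < 2 ^+ J :> R by rewrite exprn_gt0.
have mK := measurable_translates K t mphi.
rewrite (power_integral_affine q (2 ^+ J - 1) J0 mK).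
have mK' := measurable_translates K t (measurable_truncate M mphi).
by rewrite (power_integral_ae q mK mK' (translates_ae K t phi_truncate)).
Qed.

Lemma dyadic_upper p : 0 < p -> (power_integral p phi < +oo)%E ->
  exists2 C : R, 0 < C & forall J K (t : nat -> R),
    (power_integral p (dyadic J (translates K t phi)) <=
     (2 ^- J * (C * \sum_(m < K) `|t m| `^ p))%:E)%E.
Proof.
move=> p0 pf; have mt := measurable_truncate M mphi.
have E := power_integral_ae p mphi mt phi_truncate.
pose I := fine (power_integral p phi).
have I0 : 0 <= I by exact/fine_ge0/power_integral_ge0.
have EI : power_integral p (truncate M phi) = I%:E.
  by rewrite -E /I fineK// ge0_fin_numE ?power_integral_ge0.
pose A : R := (2 * (2 * M) + 1)%:R `^ p.
exists (A * I + 1) => [|J K t].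
  by rewrite ltr_wpDl ?ltr01// mulr_ge0 ?powR_ge0.
rewrite dyadic_power_integral EFinM; apply: lee_wpmul2l.
  by rewrite lee_fin invr_ge0 exprn_ge0.
apply: (le_trans (translates_upper K t p0 (@supported_truncate _ M phi) mt)).
rewrite EI -EFinM lee_fin -/A; set S := \sum_(m < K) _.
have S0 : 0 <= S by apply: sumr_ge0 => m _; exact: powR_ge0.
by rewrite mulrAC ler_wpM2r// lerDl.
Qed.

Lemma packet_lower p p' : 0 < p -> 0 < p' -> p^-1 + p'^-1 = 1 ->
  (power_integral 2 phi < +oo)%E -> orthonormal_translates phi ->
  exists2 c : R, 0 < c & forall J,
    ((2 ^- J * (c * \sum_(m < 3 * 2 ^ J) `|(qpoly J : {poly R})`_m| `^ p))%:E <=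
     power_integral p (wpacket phi (2 ^ J - 1)))%E.
Proof.
move=> p0 p'0 pp' phi2 orth; have mt := measurable_truncate M mphi.
have t2 : (power_integral 2 (truncate M phi) < +oo)%E.
  by rewrite -(power_integral_ae 2 mphi mt phi_truncate).
have orth' := orthonormal_ae mphi mt phi_truncate orth.
have [c c0 hc] := translates_lower p0 p'0 pp' mt t2 (@supported_truncate _ M phi) orth'.
exists c => // J; rewrite (funext (wpacket_dyadic J)) dyadic_power_integral EFinM.
by apply: lee_wpmul2l; rewrite ?lee_fin ?invr_ge0 ?exprn_ge0.
Qed.

End PacketNorms.

(** * Wavelet packets do not form a basis *)

Section NoBasis.
Context {R : realType}.
Local Notation mu := (@lebesgue_measure R).
Local Notation mfun f := (measurable_fun [set: measurableTypeR R] f).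
Implicit Types phi : R -> R.

Lemma represents_sum phi D k K (t : nat -> R) (f : nat -> R -> R) (q : nat -> R) :
  (forall m, represents phi D k (f m) (q m)) ->
  represents phi D k (fun x => \sum_(m < K) t m * f m x) (\sum_(m < K) t m * q m).
Proof.
move=> h; elim: K => [|K IH].
  exists [::]; split => //; last by rewrite /coefat big_nil big_ord0.
  by move=> x _; rewrite /lincomb big_nil big_ord0.
rewrite big_ord_recr/=; apply: represents_ext (representsD IH (representsZ (t K) (h K))).
by move=> x _; rewrite big_ord_recr.
Qed.

Lemma translates_represents phi J K (t : nat -> R) : exists r,
  (forall x, refined phi x -> dyadic J (translates K t phi) x = lincomb phi r x) /\
  coefat r ((2 ^ J - 1)%N, 0 : int) = 2 ^- J * \sum_(m < K) t m * (qpoly J)`_m.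
Proof.
have [r [h1 _ h2]] := represents_sum K t (fun m => packet_represents phi J 0 m%:Z).
exists r; split => [x hx|]; first by rewrite -h1.
by rewrite -subn1 mul1n in h2; rewrite h2 mulr_sumr; apply: eq_bigr => m _; rewrite mulrCA.
Qed.

(** A combination of packets indexed by pairs becomes an initial segment of the
    enumeration, as long as it contains every term; i0 is included to apply
    [Lp_basis_constant] there. *)
Lemma lincomb_enum phi (sigma : nat -> nat * int) g (r : seq (@term R)) :
  cancel sigma g -> cancel g sigma -> forall i0 : nat, exists2 n, (i0 < n)%N &
  forall x, lincomb phi r x =
    \sum_(i < n) coefat r (sigma i) * wpacket phi (sigma i).1 (x - (sigma i).2%:~R).
Proof.
move=> sg gs i0; pose n := (i0 + \sum_(t <- r) g t.2).+1.
exists n => [|x]; first by rewrite ltnS leq_addr.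
rewrite /lincomb /coefat; under [RHS]eq_bigr do rewrite mulr_suml.
have gn t : t \in r -> (g t.2 < n)%N.
  by move=> tr; rewrite ltnS (big_rem t)//= addnCA leq_addr.
rewrite big_seq_cond.
under [RHS]eq_bigr do rewrite big_mkcond big_seq_cond/=.
rewrite exchange_big/=; apply: eq_bigr => t; rewrite andbT => tr.
rewrite (bigD1 (Ordinal (gn t tr)))//= gs eqxx big1 ?addr0// => i ni.
case: eqP => // e; case/eqP: ni; apply: val_inj => /=.
by rewrite e sg.
Qed.

Lemma Lfun_comb p (e : nat -> R -> R) (c : nat -> R) n : 1 < p ->
  (forall i, e i \in Lfun mu p%:E) -> (fun x => \sum_(i < n) c i * e i x) \in Lfun mu p%:E.
Proof.
move=> p1 eL; elim: n => [|n IH].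
  have -> : (fun x => \sum_(i < 0) c i * e i x) = cst 0.
    by apply/funext => x; rewrite big_ord0.
  apply/(LfunE p1); split=> //; rewrite /power_integral integral0_eq// => x _.
  by rewrite normr0 powR0// gt_eqF// (lt_trans ltr01).
under eq_fun do rewrite big_ord_recr/=.
apply: LfunD => //.
have -> : (fun x => c n * e n x) = c n \o* e n.
  by apply/funext => x /=; rewrite mulrC.
by apply: Lfun_scale => //; exact: ltW.
Qed.

(** The final computation, in which u = 2^-J, the numbers X and X' are the word
    sums of exponents p and p', b is the norm of W_J and d the norm of the test
    function, whose coefficient at W_J is u X'. The powers of u combine to
    u^-1. *)
Lemma product_from_bounds (p p' C A c u X X' b d : R) :
  0 < p -> 0 < p' -> p^-1 + p'^-1 = 1 -> 0 < C -> 0 < A -> 0 < c -> 0 < u ->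
  0 <= X -> 0 <= X' -> 0 <= b -> 0 <= d ->
  u * X' * b <= C * d -> d `^ p <= u * (A * X') -> u * (c * X) <= b `^ p ->
  X `^ p^-1 * X' `^ p'^-1 <= (C `^ p * A / c) `^ p^-1 * u^-1.
Proof.
move=> p0 p'0 pp' C0 A0 c0 u0 X0 X'0 b0 d0 hb hd hX.
have [->|X'n] := eqVneq X' 0.
  by rewrite [0 `^ _]powR0 ?gt_eqF ?invr_gt0// mulr0 mulr_ge0 ?powR_ge0 ?invr_ge0 ?(ltW u0).
have X'p : 0 < X' by rewrite lt_def X'n.
have K0 : 0 <= C `^ p * A / c.
  by apply: divr_ge0 (ltW c0); apply: mulr_ge0 (ltW A0); exact: powR_ge0.
have u'0 : 0 <= u^-1 by rewrite invr_ge0 ltW.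
have root x : 0 <= x -> x = (x `^ p) `^ p^-1.
  by move=> x0; rewrite -powRrM mulfV ?powRr1 ?gt_eqF.
have e' : p'^-1 = (p - 1) / p.
  by rewrite mulrBl mul1r mulfV ?gt_eqF// -pp' addrAC subrr add0r.
rewrite e' powRrM -powRM ?powR_ge0//.
have -> : u^-1 = (u^-1 `^ p) `^ p^-1 by exact: root.
suff : (X * X' `^ (p - 1)) `^ p^-1 <= (C `^ p * A / c * u^-1 `^ p) `^ p^-1.
  by move/le_trans; apply; rewrite powRM ?powR_ge0.
apply: ge0_ler_powR; rewrite ?nnegrE ?invr_ge0 ?(ltW p0)//.
- by rewrite mulr_ge0 ?powR_ge0.
- by rewrite mulr_ge0 ?powR_ge0.
have up : u^-1 `^ p * u `^ p = 1.
  by rewrite -powRM ?(ltW u0)// mulVf ?gt_eqF// powR1.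
have X'E : X' `^ p = X' `^ (p - 1) * X'.
  by rewrite -[X in _ * X]powRr1 ?(ltW X'p)// -powRD ?subrK// (negPf X'n) implybT.
have key : (u `^ p * X' `^ p) * (u * (c * X)) <= C `^ p * (u * (A * X')).
  apply: (@le_trans _ _ ((u * X' * b) `^ p)).
    rewrite powRM ?mulr_ge0 ?(ltW u0)// powRM ?(ltW u0)//.
    by rewrite ler_wpM2l// mulr_ge0 ?powR_ge0.
  apply: (@le_trans _ _ ((C * d) `^ p)).
    by apply: ge0_ler_powR; rewrite ?nnegrE ?mulr_ge0 ?(ltW p0) ?(ltW u0) ?(ltW C0).
  by rewrite powRM ?(ltW C0)// ler_wpM2l ?powR_ge0.
have key2 : X * X' `^ (p - 1) * (u `^ p * c) <= C `^ p * A.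
  rewrite -(ler_pM2r (mulr_gt0 u0 X'p)); apply: le_trans (le_trans _ key) _.
    by rewrite X'E le_eqVlt; apply/orP; left; apply/eqP; ring.
  by rewrite le_eqVlt; apply/orP; left; apply/eqP; ring.
have upc : 0 < u `^ p * c by rewrite mulr_gt0 ?powR_gt0.
rewrite -(ler_pM2r upc); apply: (le_trans key2).
by rewrite -[leRHS]mulrA [_ * (_ * c)]mulrA up mul1r divfK// gt_eqF.
Qed.

(** The test function of the duality argument is a finite combination of the
    basis, almost everywhere, and the bound on its coefficient at w_(2^J - 1)
    is the claimed one. *)
Lemma basis_bounds_radius phi p p' (sigma : nat -> nat * int) :
  scaling_function phi -> 1 < p -> 0 < p' -> p^-1 + p'^-1 = 1 -> bijective sigma ->
  Lp_schauder_basis p (fun i x => wpacket phi (sigma i).1 (x - (sigma i).2%:~R)) ->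
  exists C : R, forall J,
    wsum p J (e3 0) `^ p^-1 * wsum p' J (e3 0) `^ p'^-1 <= C * 2 ^+ J.
Proof.
move=> [phiL2 [A0 phiM] phiref orth] p1 p'0 pp' [g sg gs].
set e := (fun i x => _) => basis; have eL := basis.1.
have p0 : 0 < p by exact: lt_trans p1.
have [mphi phi2] := (LfunE (ltr1n R 2) phi).1 phiL2.
have [M phi_tr] := ae_truncate phiM.
have phip : (power_integral p phi < +oo)%E.
  have := eL (g (0%N, 0)); rewrite /e gs/=.
  under eq_fun do rewrite subr0.
  by move=> /(LfunE p1)[].
have [C C0 hC] := Lp_basis_constant p1 basis.
have [A A_gt0 hA] := dyadic_upper mphi phi_tr p0 phip.
have [c c0 hc] := packet_lower mphi phi_tr p0 p'0 pp' phi2 orth.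
exists ((C `^ p * A / c) `^ p^-1) => J.
pose t k := dual_power p' (qpoly J : {poly R})`_k; pose K := (3 * 2 ^ J)%N.
have [r [hr hcoef]] := translates_represents phi J K t.
pose i0 := g ((2 ^ J - 1)%N, 0 : int).
have [n i0n hn] := lincomb_enum phi r sg gs i0.
have X'E : \sum_(m < K) t m * (qpoly J)`_m = wsum p' J (e3 0).
  by rewrite -qpoly_sum; apply: eq_bigr => m _; rewrite mulrC dual_powerE.
have tE : \sum_(m < K) `|t m| `^ p = wsum p' J (e3 0).
  rewrite -qpoly_sum; apply: eq_bigr => m _.
  by rewrite (norm_dual_power p'0 p0)// addrC.
pose F x := \sum_(i < n) coefat r (sigma i) * e i x.
have FL : F \in Lfun mu p%:E by exact: (Lfun_comb (fun i => coefat r (sigma i)) n p1 eL).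
have mF : mfun F by have /(LfunE p1)[] := FL.
have mD : mfun (dyadic J (translates K t phi)).
  by apply: measurable_comp_affine; exact: measurable_translates.
have FD : {ae mu, forall x, F x = dyadic J (translates K t phi) x}.
  apply: (ae_imply _ (ae_refined phiref)) => x hx.
  by rewrite hr// hn.
have eE : e i0 = wpacket phi (2 ^ J - 1).
  by apply/funext => x; rewrite /e /i0 gs/= subr0.
rewrite -[2 ^+ J]invrK.
apply: (@product_from_bounds p p' C A c (2 ^- J) _ _ (Lp_norm p (e i0)) (Lp_norm p F)) => //.
- by rewrite -qpoly_sum sumr_ge0// => m _; exact: powR_ge0.
- by rewrite -qpoly_sum sumr_ge0// => m _; exact: powR_ge0.
- exact: Lp_norm_ge0.
- exact: Lp_norm_ge0.
- have := hC (fun i => coefat r (sigma i)) n i0 i0n.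
  rewrite /i0 gs hcoef X'E ger0_norm//; last first.
  by rewrite mulr_ge0 ?invr_ge0 ?exprn_ge0// -qpoly_sum sumr_ge0// => m _; exact: powR_ge0.
- rewrite -lee_fin -(power_integral_norm p1 FL) (power_integral_ae p mF mD FD) -tE.
  exact: hA.
- rewrite -lee_fin -(power_integral_norm p1 (eL i0)) eE -qpoly_sum.
  exact: hc.
Qed.

(** The bound O(2^J) on the product of conjugate word sums is incompatible with
    the exponential gain in [growth]. *)
Lemma packets_not_basis phi p (sigma : nat -> nat * int) :
  scaling_function phi -> 1 < p -> p != 2 -> bijective sigma ->
  ~ Lp_schauder_basis p (fun i x => wpacket phi (sigma i).1 (x - (sigma i).2%:~R)).
Proof.
move=> sphi p1 p2 bsigma basis; have p0 : 0 < p by exact: lt_trans p1.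
pose p' := p / (p - 1).
have p'0 : 0 < p' by rewrite divr_gt0// subr_gt0.
have pp' : p^-1 + p'^-1 = 1.
  by rewrite /p' invf_div mulrBl mul1r mulfV ?gt_eqF// addrC subrK.
have [C hC] := basis_bounds_radius sphi p1 p'0 pp' bsigma basis.
have [m m0 [k [c [k1 c0 hk]]]] := growth p1 p2 pp'.
have E0 : 0 < energy (e3 0 : 'cV[R]_3).
  apply: lt_le_trans (energy_ge _); rewrite /e3 !mxE/=.
  rewrite expr1n expr0n/= !addr0 mulr1//.
have bound j : k ^+ j <= C * 2 ^+ 6 / (c * energy (e3 0)).
  rewrite ler_pdivlMr ?mulr_gt0//.
  have P0 : 0 < 2 ^+ (j * m) :> R by rewrite exprn_gt0.
  rewrite -(ler_pM2r P0).
  have -> : k ^+ j * (c * energy (e3 0)) * 2 ^+ (j * m) =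
      c * k ^+ j * 2 ^+ (j * m) * energy (e3 0) by ring.
  by rewrite -[leRHS]mulrA -exprD; exact: le_trans (hk j (e3 0)) (hC (6 + j * m)%N).
set D := C * 2 ^+ 6 / _ in bound; have k0 : 0 < k by exact: lt_trans k1.
have D0 : 0 < D by apply: lt_le_trans (bound 0%N); rewrite expr0.
have kV : 0 <= k^-1 < 1 by rewrite invr_ge0 (ltW k0) invf_lt1.
have DV : 0 < D^-1 by rewrite invr_gt0.
have [j _] := ex_expr_lt kV DV.
rewrite exprVn ltf_pV2 ?posrE ?exprn_gt0// => /lt_le_trans/(_ (bound j)).
by rewrite ltxx.
Qed.

End NoBasis.

Theorem theorem4p1 (R : realType) :
  (forall N : 'M[R]_3 -> R, matrix_norm N ->
   forall p p' : R, 1 < p -> p != 2 -> p^-1 + p'^-1 = 1 ->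
     joint_spectral_radius N p transition_mx
       * joint_spectral_radius N p' transition_mx > 2)
  /\
  (forall phi : R -> R, scaling_function phi ->
   forall p : R, 1 < p -> p != 2 ->
   forall sigma : nat -> nat * int, bijective sigma ->
     ~ Lp_schauder_basis p
         (fun i x => wpacket phi (sigma i).1 (x - ((sigma i).2)%:~R))).
Proof.
split=> [N Nn p p' p1 p2 pp'|phi sphi p p1 p2 sigma bsigma].
  exact: radius_product.
exact: packets_not_basis.
Qed.
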